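(* Let $p$ be a positive integer. Consider the normalized bigradings $F(p)=F(p;1,p/2)$ and $F(1/p)=F(1/p;1/p,1/(2p))$. For any integers $m$ and $k$ and complex numbers $S$ and $E$, there is an isomorphism $$\mathrm M_k\Bigl(m;S+\frac mp,E+\frac{m^2}{2p}\Bigr)^{\vee}\cong \mathrm{RF}_{-m'/p}\Bigl(-\frac{k'}p;-S-\frac{k'}p,E+\frac{k'^2}{2p}\Bigr)$$ of bigraded $F(p;1,p/2)$-modules, where $m'=m-2p+1$ and $k'=k+p-2$.
   Context: All vector spaces are over $\mathbb C$; vertex superalgebras are also called vertex algebras; powers $(x-y)^n$ are expanded in non-negative integer powers of $y$. Algebras. $F(1/p)$ is the free generalized vertex algebra generated by one element $x$: the initial object in the category of $\mathbb Z$-graded generalized vertex algebras (in the sense of Dong–Lepowsky/Bakalov–Kac) with phase $\eta_{r,s}=e^{\pi\sqrt{-1}rs/p}$ generated by a degree $1$ element $x$ satisfying $(z-w)^{-1/p}Y(x,z)Y(x,w)=(w-z)^{-1/p}Y(x,w)Y(x,z)$. Write $Y(x,z)=\sum_{n\in\mathbb C}x(n)z^{-n-1}$. The free vertex algebra $F(p)$, defined in the same way with $1/p$ replaced by $p$ and with generator $a$, $Y(a,z)=\sum_{n\in\mathbb Z}a(n)z^{-n-1}$, is embedded in $F(1/p)$ by $a=x(-\frac{p-1}p-1)\cdots x(-\frac2p-1)x(-\frac1p-1)x$. One has $a(s)x(t)=-x(t)a(s)$ for all $s,t$. The bigrading of $F(p;1,p/2)$ puts $a(-n_r)\cdots a(-n_1)\mathbf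 1$ in bidegree $(r,\sum_i(n_i-1+\frac p2))$; that of $F(1/p;1/p,1/(2p))$ puts $x(-n_r)\cdots x(-n_1)\mathbf 1$ in bidegree $(\frac rp,\sum_i(n_i-1+\frac1{2p}))$. The modules $\mathrm M_k(m)$. For $k\in\mathbb Z$, $F(k,p)=F(p)/\sum_{n\ge0}a(-k-n)F(p)$, a quotient vertex algebra. For $m\in\mathbb Z$, $\mathrm M_k(m)$ is the free representation of order $-m$ over $F(k,p)$: the universal $F(k,p)$-module generated by a vector $v_{k,m}$ with $a(-m+n)v_{k,m}=0$ for all integers $n\ge0$. It is regarded as an $F(p)$-module via $F(p)\to F(k,p)$. $\mathrm M_k(m;S,E)$ is this module with $a(-n_r)\cdots a(-n_1)v_{k,m}$ in bidegree $(S+r,\ E+\sum_i(n_i-1+\frac p2))$. RF-type modules. For $m\in\mathbb Z$, $\mathrm M^\circ(m/p)$ is the free module of order $-m/p$ over $F(1/p)$: the universal $\mathbb Z$-graded module generated by a degree $0$ vector $v_{m/p}$ with $x(-m/p+n)v_{m/p}=0$ for all $n\in\mathbb C\setminus\mathbb Z_{<0}$. For $j\in\mathbb Z$ let $\mathrm M^\circ(m/p)^{[j]}$ be the span of monomials $x(-n_s)\cdots x(-n_1)v_{m/p}$ of length $s\ge0$ with $m+s\equiv j\pmod p$ (i.e. of charge in $j/p+\mathbb Z$, where $v_{m/p}$ has charge $m/p$ and $x$ has charge $1/p$). For $k,m\in\mathbb Z$, $$\mathrm{RF}_{k/p}(m/p)=\mathrm M^\circ(m/p)^{[k+1]}\Big/\sum_{n\in\mathbb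 Z_{\ge0}}x(-k/p-n)\,\mathrm M^\circ(m/p)^{[k]},$$ an $F(p)$-module; $\mathrm{RF}_{k/p}(m/p;S,E)$ is this module with the class of $x(-n_s)\cdots x(-n_1)v_{m/p}$ in bidegree $(S+\frac sp,\ E+\sum_i(n_i-1+\frac1{2p}))$. Restricted duals. For a bigraded $F(p;1,p/2)$-module $M=\bigoplus M_{s,e}$ with finite-dimensional pieces, $M^\vee=\bigoplus(M_{s,e})^*$ with $(M^\vee)_{s,e}=(M_{-s,e})^*$ and the generator acting by $\langle a(n)\varphi,v\rangle=\langle\varphi,e^{\pi\sqrt{-1}p/2}a(-n+p-2)v\rangle$. Homomorphisms are understood up to identification of equivalent (shifted) charge/parity gradings.
   Formalization: Proved for m ≤ k' only (for m > k' it fails, e.g. p=2, m=0, k=−1: dimensions 1 and 0); for m < 0, M_k(m) is the universal F(p)-module with a(−m+n)v=0 and all a(−k−n)=0 (n≥0), since with F(k,p)-modules it fails, e.g. p=1, k=2, m=−1. *)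

(* Defs.v *)
From HB Require Import structures.
From mathcomp Require Import all_boot all_order all_algebra.
From mathcomp Require Import boolp functions reals topology normedtype sequences derive realfun exp trigo.
From mathcomp Require Import complex.

Set Implicit Arguments.
Unset Strict Implicit.
Unset Printing Implicit Defensive.

Import Order.TTheory GRing.Theory Num.Theory.
Local Open Scope ring_scope.
Local Open Scope complex_scope.

(* The ground field is C = R[i] over an arbitrary model R of the reals. *)

Definition expipi (R : realType) (z : R[i]) : R[i] :=
  let t := pi * complex.Re z in
  (expR (- (pi * complex.Im z)))%:C * (cos t +i* sin t).

Definition cbinom (R : realType) (n : R[i]) (j : nat) : R[i] :=
  (\prod_(i < j) (n - i%:R)) / j`!%:R.

(* Equality of two infinite sums of which almost all terms vanish. *)
Definition fsum_eq (U : zmodType) (f g : nat -> U) : Prop :=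
  exists K0 : nat, forall K : nat, (K0 <= K)%N ->
    \sum_(j < K) f j = \sum_(j < K) g j.

Definition is_subspace (R : realType) (U : lmodType R[i]) (A : U -> Prop) :=
  A 0 /\ forall (c : R[i]) u v, A u -> A v -> A (c *: u + v).

Record subspace (R : realType) (U : lmodType R[i]) := Subspace {
  subspace_set :> U -> Prop;
  subspaceP : is_subspace subspace_set }.

Definition span_set (R : realType) (U : lmodType R[i]) (X : U -> Prop) (u : U) :=
  forall A : U -> Prop, is_subspace A -> (forall v, X v -> A v) -> A u.

Lemma span_is_subspace (R : realType) (U : lmodType R[i]) (X : U -> Prop) :
  is_subspace (span_set X).
Proof.
split=> [A [] //|c u v Xu Xv A sA XA].
by apply: sA.2; [exact: Xu|exact: Xv].
Qed.

Definition span (R : realType) (U : lmodType R[i]) (X : U -> Prop) :=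
  Subspace (span_is_subspace X).

Lemma preim_is_subspace (R : realType) (U W : lmodType R[i]) (f : U -> W)
    (B : subspace W) : linear f -> is_subspace (fun u => B (f u)).
Proof.
move=> lf; have [B0 BD] := subspaceP B; split=> [|c u v fu fv]; last first.
  by rewrite lf; apply: BD.
have := lf (-1) 0 0; rewrite scaler0 addr0 scaleN1r addNr => ->.
exact: B0.
Qed.

Definition subspace_mem (R : realType) (U : lmodType R[i]) (A : subspace U) :=
  [pred u | `[< A u >]].

Lemma subspace_mem_closed (R : realType) (U : lmodType R[i]) (A : subspace U) :
  submod_closed (subspace_mem A).
Proof.
have [A0 AD] := subspaceP A; split; first exact/asboolP.
by move=> c u v /asboolP Au /asboolP Av; apply/asboolP; apply: AD.
Qed.

HB.instance Definition _ (R : realType) (U : lmodType R[i]) (A : subspace U) :=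
  GRing.isSubmodClosed.Build _ U (subspace_mem A) (subspace_mem_closed A).

Record subspace_type (R : realType) (U : lmodType R[i]) (A : subspace U) :=
  SubspaceElt { subspace_val : U ; _ : subspace_val \in subspace_mem A }.

HB.instance Definition _ (R : realType) (U : lmodType R[i]) (A : subspace U) :=
  [isSub for @subspace_val R U A].
HB.instance Definition _ (R : realType) (U : lmodType R[i]) (A : subspace U) :=
  [Choice of subspace_type A by <:].
HB.instance Definition _ (R : realType) (U : lmodType R[i]) (A : subspace U) :=
  [SubChoice_isSubZmodule of subspace_type A by <:].
HB.instance Definition _ (R : realType) (U : lmodType R[i]) (A : subspace U) :=
  [SubZmodule_isSubLmodule of subspace_type A by <:].

(* An element of A viewed in the subspace A; outside A the value is 0. *)
Definition into (R : realType) (U : lmodType R[i]) (A : subspace U) (u : U) :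
  subspace_type A := insubd 0 u.

Definition quotient_type (R : realType) (U : lmodType R[i]) (B : subspace U) :
  Type := Quotient.quot (subspace_mem B).

HB.instance Definition _ (R : realType) (U : lmodType R[i]) (B : subspace U) :=
  GRing.Zmodule.on (quotient_type B).

Definition cls (R : realType) (U : lmodType R[i]) (B : subspace U) (u : U) :
  quotient_type B := (\pi_(Quotient.quot (subspace_mem B)) u)%qT.
Definition rep (R : realType) (U : lmodType R[i]) (B : subspace U)
  (q : quotient_type B) : U := repr (q : Quotient.quot (subspace_mem B)).

Section QuotientLmod.
Variables (R : realType) (U : lmodType R[i]) (B : subspace U).
Implicit Types (q : quotient_type B) (u : U).

Lemma repK q : cls B (rep q) = q. Proof. exact: reprK. Qed.

Lemma cls_eqP u v : cls B u = cls B v <-> B (u - v).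
Proof.
split=> [e|Buv].
  by apply/asboolP; have := Quotient.idealrBE (subspace_mem B) u v;
     rewrite unfold_in /= => ->; apply/eqP.
by apply/eqP; rewrite -[_ == _]Quotient.idealrBE; apply/asboolP.
Qed.

Lemma clsD u v : cls B (u + v) = cls B u + cls B v.
Proof. by rewrite /cls [in LHS]raddfD. Qed.

Definition quotient_scale (c : R[i]) q : quotient_type B := cls B (c *: rep q).

Lemma quotient_scale_cls c u : quotient_scale c (cls B u) = cls B (c *: u).
Proof.
apply/cls_eqP; rewrite -scalerBr.
have [B0 BD] := subspaceP B; rewrite -[_ *: _]addr0; apply: BD => //.
by apply/cls_eqP; rewrite repK.
Qed.

Fact quotient_scaleA a b q :
  quotient_scale a (quotient_scale b q) = quotient_scale (a * b) q.
Proof. by rewrite -[q]repK !quotient_scale_cls scalerA. Qed.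
Fact quotient_scale1 : left_id 1 quotient_scale.
Proof. by move=> q; rewrite -[q]repK !quotient_scale_cls scale1r. Qed.
Fact quotient_scaleDr : right_distributive quotient_scale +%R.
Proof.
move=> a q r; rewrite -[q]repK -[r]repK -clsD !quotient_scale_cls -clsD.
by rewrite scalerDr.
Qed.
Fact quotient_scaleDl q :
  {morph quotient_scale^~ q : a b / a + b >-> a + b}.
Proof.
by move=> a b; rewrite -[q]repK !quotient_scale_cls -clsD scalerDl.
Qed.

HB.instance Definition _ := GRing.Zmodule_isLmodule.Build R[i] (quotient_type B)
  quotient_scaleA quotient_scale1 quotient_scaleDr quotient_scaleDl.

Lemma cls_is_linear : linear (cls B : U -> quotient_type B).
Proof. by move=> c u v; rewrite clsD -quotient_scale_cls. Qed.

End QuotientLmod.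

(* Direct sum decomposition U = \bigoplus_i D i. *)
Definition is_grading (R : realType) (U : lmodType R[i]) (I : eqType)
    (D : I -> U -> Prop) : Prop :=
  [/\ forall i, is_subspace (D i),
      forall u, exists s : seq I, exists f : I -> U,
        (forall i, D i (f i)) /\ u = \sum_(i <- s) f i
    & forall (s : seq I) (f : I -> U), uniq s -> (forall i, D i (f i)) ->
        \sum_(i <- s) f i = 0 -> forall i, i \in s -> f i = 0].

(* [field_rep h gV one mulV gU mu act]: the fields
   Y(a,z) = \sum_(n in C) (act a n) z^(-n-1) make U = \bigoplus_t U_t a graded
   module over the generalized vertex algebra V = \bigoplus_r V_r whose phase is
   eta_(r,s) = exp (pi i h r s).  The integer charge t in U stands for mu + t:
   for a in V_r and u in U_t the exponents of Y(a,z)u lie in h r (mu + t) + Z.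
   Borcherds' identity is the Jacobi identity of Dong and Lepowsky, with
   Y(b,w)Y(a,z) multiplied by eta_(r,s) (-w+z)^n where
   (-w+z)^n = exp (pi i n) (w-z)^n; it is equivalent to locality
   (z-w)^n Y(a,z) Y(b,w) = eta_(r,s) exp (pi i n) (w-z)^n Y(b,w) Y(a,z), n >> 0,
   together with associativity. *)
Record field_rep (R : realType) (h : R[i])
    (V : lmodType R[i]) (gV : int -> V -> Prop) (one : V)
    (mulV : V -> R[i] -> V -> V)
    (U : lmodType R[i]) (gU : int -> U -> Prop) (mu : R[i])
    (act : V -> R[i] -> U -> U) : Prop := FieldRep {
  rep_grading : is_grading gU;
  rep_linear_l : forall n u, linear (fun a => act a n u);
  rep_linear_r : forall a n, linear (act a n);
  rep_degree : forall r t a n u, gV r a -> gU t u -> gU (r + t) (act a n u);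
  rep_field : forall r t a u, gV r a -> gU t u ->
    exists N : int, forall n, act a n u <> 0 ->
      exists2 l : int, l < N & n = l%:~R - h * r%:~R * (mu + t%:~R);
  rep_one : forall n u, act one n u = if n == -1 then u else 0;
  rep_borcherds : forall (r s t : int) a b u (m k n : R[i]),
    gV r a -> gV s b -> gU t u ->
    (exists i : int, n = i%:~R - h * r%:~R * s%:~R) ->
    (exists i : int, m = i%:~R - h * r%:~R * (mu + t%:~R)) ->
    (exists i : int, k = i%:~R - h * s%:~R * (mu + t%:~R)) ->
    fsum_eq
      (fun j => ((-1) ^+ j * cbinom n j) *:
        (act a (m + n - j%:R) (act b (k + j%:R) u)
         - (expipi (h * r%:~R * s%:~R) * expipi n) *:
           act b (n + k - j%:R) (act a (m + j%:R) u)))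
      (fun j => cbinom m j *: act (mulV a (n + j%:R) b) (m + k - j%:R) u) }.

(* Z-graded generalized vertex algebra with phase eta_(r,s) = exp (pi i h r s);
   [gva_mul a n b] is a(n)b.  The translation operator is T a = a(-2)1. *)
Record gva (R : realType) (h : R[i]) := Gva {
  gva_car :> lmodType R[i];
  gva_deg : int -> gva_car -> Prop;
  gva_one : gva_car;
  gva_mul : gva_car -> R[i] -> gva_car -> gva_car;
  gva_rep : field_rep h gva_deg gva_one gva_mul gva_deg 0 gva_mul;
  gva_deg_one : gva_deg 0 gva_one;
  gva_creation : forall a, gva_mul a (-1) gva_one = a;
  gva_regular : forall a (n : nat), gva_mul a n%:R gva_one = 0 }.

Record gmod (R : realType) (h : R[i]) (V : gva h) (mu : R[i]) := Gmod {
  gmod_car :> lmodType R[i];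
  gmod_deg : int -> gmod_car -> Prop;
  gmod_act : V -> R[i] -> gmod_car -> gmod_car;
  gmod_rep : field_rep h (@gva_deg R h V) (gva_one V) (@gva_mul R h V)
               gmod_deg mu gmod_act }.

Definition gva_hom (R : realType) (h : R[i]) (V W : gva h) (f : V -> W) : Prop :=
  [/\ linear f, f (gva_one V) = gva_one W,
      forall r a, gva_deg r a -> gva_deg r (f a)
    & forall a n b, f (gva_mul a n b) = gva_mul (f a) n (f b)].

Definition gmod_hom (R : realType) (h : R[i]) (V : gva h) (mu : R[i])
    (M N : gmod V mu) (f : M -> N) : Prop :=
  [/\ linear f, forall t u, gmod_deg t u -> gmod_deg t (f u)
    & forall a n u, f (gmod_act a n u) = gmod_act a n (f u)].

Definition gva_generated (R : realType) (h : R[i]) (V : gva h) (x : V) : Prop :=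
  forall A : V -> Prop, is_subspace A -> A (gva_one V) -> A x ->
    (forall a n b, A a -> A b -> A (gva_mul a n b)) -> forall a, A a.

Definition gmod_generated (R : realType) (h : R[i]) (V : gva h) (mu : R[i])
    (M : gmod V mu) (v : M) : Prop :=
  forall A : M -> Prop, is_subspace A -> A v ->
    (forall a n u, A u -> A (gmod_act a n u)) -> forall u, A u.

(* (z-w)^(-h) Y(x,z) Y(x,w) = (w-z)^(-h) Y(x,w) Y(x,z), coefficientwise. *)
Definition free_locality (R : realType) (h : R[i]) (V : gva h) (x : V) : Prop :=
  forall (m n : R[i]) (u : V),
    fsum_eq
      (fun j => ((-1) ^+ j * cbinom (- h) j) *:
        gva_mul x (m - h - j%:R) (gva_mul x (n + j%:R) u))
      (fun j => ((-1) ^+ j * cbinom (- h) j) *: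
        gva_mul x (n - h - j%:R) (gva_mul x (m + j%:R) u)).

Definition gva_cyclic (R : realType) (h : R[i]) (V : gva h) (x : V) : Prop :=
  [/\ gva_deg 1 x, free_locality x & gva_generated x].

(* The pair (V, x) is (F(p), a) for h = p and (F(1/p), x) for h = 1/p. *)
Definition is_free_gva (R : realType) (h : R[i]) (V : gva h) (x : V) : Prop :=
  gva_cyclic x /\
  forall (W : gva h) (y : W), gva_cyclic y ->
    exists! f : V -> W, gva_hom f /\ f x = y.

(* (M, v) is universal among the modules generated by a degree 0 vector subject
   to the condition P. *)
Definition is_universal (R : realType) (h : R[i]) (V : gva h) (mu : R[i])
    (P : forall N : gmod V mu, N -> Prop) (M : gmod V mu) (v : M) : Prop :=
  [/\ P M v, gmod_deg 0 v, gmod_generated v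
    & forall (N : gmod V mu) (w : N), P N w -> gmod_deg 0 w ->
        gmod_generated w -> exists! f : M -> N, gmod_hom f /\ f v = w].

(* M_k(m) is universal for this condition.  For m >= 0 (and w generating N) the
   second clause says exactly that N is a module over the quotient
   F(k,p) = F(p) / \sum_(n >= 0) a(-k-n)F(p): see [is_Mk_quotient].  For m < 0
   it is weaker: a(-k)1 is a multiple of T^(k-1) a if k >= 1, so on a module over
   that quotient all the a(n) with n >= 0 vanish, and m could be replaced by 0. *)
Definition Mk_cond (R : realType) (p : nat) (Fp : gva (p%:R : R[i])) (a : Fp)
    (k m : int) (N : gmod Fp 0) (w : N) : Prop :=
  (forall n : nat, gmod_act a (- m%:~R + n%:R) w = 0) /\
  (forall (n : nat) (u : N), gmod_act a (- k%:~R - n%:R) u = 0).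

Definition is_Mk (R : realType) (p : nat) (Fp : gva (p%:R : R[i])) (a : Fp)
    (k m : int) (M : gmod Fp 0) (v : M) : Prop :=
  is_universal (@Mk_cond R p Fp a k m) v.

(* F(k,p) is the quotient of F(p) by this ideal. *)
Definition Fk_ideal (R : realType) (p : nat) (Fp : gva (p%:R : R[i])) (a : Fp)
    (k : int) : subspace Fp :=
  span (fun b => exists (n : nat) (c : Fp), b = gva_mul a (- k%:~R - n%:R) c).

Definition Mk_quotient_cond (R : realType) (p : nat) (Fp : gva (p%:R : R[i]))
    (a : Fp) (k m : int) (N : gmod Fp 0) (w : N) : Prop :=
  (forall n : nat, gmod_act a (- m%:~R + n%:R) w = 0) /\
  (forall b, Fk_ideal a k b -> forall n (u : N), gmod_act b n u = 0).

(* M^o(m/p) is universal for this condition.  Its generator has charge m/p, so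
   that the charges in degree t are (m + t)/p: mu = m. *)
Definition Mcirc_cond (R : realType) (p : nat) (F1p : gva ((p%:R : R[i])^-1))
    (x : F1p) (m : int) (N : gmod F1p m%:~R) (w : N) : Prop :=
  forall n : R[i], (forall l : nat, n <> - l.+1%:R) ->
    gmod_act x (- (m%:~R / p%:R) + n) w = 0.

Definition is_Mcirc (R : realType) (p : nat) (F1p : gva ((p%:R : R[i])^-1))
    (x : F1p) (m : int) (M : gmod F1p m%:~R) (v : M) : Prop :=
  is_universal (@Mcirc_cond R p F1p x m) v.

(* [a_elt p x] is the generator
   x(-(p-1)/p-1) ... x(-2/p-1) x(-1/p-1) x of F(p) inside F(1/p). *)
Fixpoint x_monomial (R : realType) (h : R[i]) (V : gva h) (x : V) (i : nat) : V :=
  if i is j.+1 then gva_mul x (- (j.+1%:R * h) - 1) (x_monomial x j) else x.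

Definition a_elt (R : realType) (p : nat) (F1p : gva ((p%:R : R[i])^-1))
  (x : F1p) : F1p := x_monomial x p.-1.

(* [monomial y [:: n_r; ...; n_1] v] is y(-n_r) ... y(-n_1) v. *)
Definition monomial (R : realType) (h : R[i]) (V : gva h) (mu : R[i])
    (M : gmod V mu) (y : V) (ns : seq R[i]) (v : M) : M :=
  foldr (fun n u => gmod_act y (- n) u) v ns.

(* For a generator of charge q and weight d, the monomial with modes [ns]
   applied to a vector of bidegree (S, E) has bidegree (s, e). *)
Definition has_bidegree (R : realType) (q d S E : R[i]) (ns : seq R[i])
    (s e : R[i]) : Prop :=
  s = S + q *+ size ns /\ e = E + \sum_(n <- ns) (n - 1 + d).

(* Bigraded module over F(p), presented by the modes of the generator:
   [bg_act n] is a(n), [bg_deg s e] is the component of bidegree (s, e). *)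
Record bgmod (R : realType) := BgMod {
  bg_car :> lmodType R[i];
  bg_act : int -> bg_car -> bg_car;
  bg_deg : R[i] -> R[i] -> bg_car -> Prop }.

(* As a generates F(p), an isomorphism of F(p)-modules is a linear bijection
   commuting with all the a(n). *)
Definition bg_iso (R : realType) (M N : bgmod R) : Prop :=
  exists f : M -> N,
    [/\ linear f, bijective f,
        forall n u, f (bg_act n u) = bg_act n (f u)
      & forall s e u, bg_deg s e u <-> bg_deg s e (f u)].

Definition Mk_bg (R : realType) (p : nat) (Fp : gva (p%:R : R[i])) (a : Fp)
    (M : gmod Fp 0) (v : M) (S E : R[i]) : bgmod R :=
  @BgMod R M (fun n u => gmod_act a n%:~R u)
    (fun s e => span (fun u => exists ns : seq int,
       let ns' := [seq n%:~R | n <- ns] in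
       u = monomial a ns' v /\ has_bidegree 1 (p%:R / 2) S E ns' s e)).

Definition Mcirc_part (R : realType) (p : nat) (F1p : gva ((p%:R : R[i])^-1))
    (x : F1p) (m : int) (M : gmod F1p m%:~R) (v : M) (j : int) : subspace M :=
  span (fun u => exists ns : seq R[i],
    u = monomial x ns v /\ (m + (size ns)%:Z = j %[mod p%:Z])%Z).

Definition RF_kernel (R : realType) (p : nat) (F1p : gva ((p%:R : R[i])^-1))
    (x : F1p) (k m : int) (M : gmod F1p m%:~R) (v : M) : subspace M :=
  span (fun u => exists (n : nat) (w : M),
    Mcirc_part x v k w /\ u = gmod_act x (- (k%:~R / p%:R) - n%:R) w).

Lemma subspace_val_is_linear (R : realType) (U : lmodType R[i]) (A : subspace U) :
  linear (@subspace_val R U A).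
Proof. by move=> c u v; rewrite -[@subspace_val R U A]/val linearP. Qed.

Definition restrict (R : realType) (U : lmodType R[i]) (A B : subspace U) :
    subspace (subspace_type A) :=
  Subspace (preim_is_subspace B (@subspace_val_is_linear R U A)).

(* A / (B :&: A), with the class of u in A, and the operator it inherits from an
   endomorphism f of U which preserves A and B. *)
Definition subquotient (R : realType) (U : lmodType R[i]) (A B : subspace U) :=
  quotient_type (restrict A B).
Definition subcls (R : realType) (U : lmodType R[i]) (A B : subspace U) (u : U) :
  subquotient A B := cls (restrict A B) (into A u).
Definition subop (R : realType) (U : lmodType R[i]) (A B : subspace U)
    (f : U -> U) (q : subquotient A B) : subquotient A B :=
  subcls A B (f (val (rep q))).

(* That the a(n) preserve A and B follows from a(s)x(t) = - x(t)a(s). *)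
Definition RF_bg (R : realType) (p : nat) (F1p : gva ((p%:R : R[i])^-1))
    (x : F1p) (k m : int) (M : gmod F1p m%:~R) (v : M) (S E : R[i]) : bgmod R :=
  let A := Mcirc_part x v (k + 1) in
  let B := RF_kernel x k v in
  @BgMod R (subquotient A B)
    (fun n => subop (gmod_act (a_elt x) n%:~R))
    (fun s e => span (fun q => exists ns : seq R[i],
       [/\ A (monomial x ns v), q = subcls A B (monomial x ns v)
         & has_bidegree (p%:R^-1) ((2 * p%:R)^-1) S E ns s e])).

(* Linear functionals vanishing on almost all the components, i.e. the elements
   of the direct sum of the duals of the components. *)
Definition restricted_functional (R : realType) (M : bgmod R)
    (phi : M -> R[i]^o) : Prop :=
  linear phi /\ exists ds : seq (R[i] * R[i]),
    forall s e u, bg_deg s e u -> (s, e) \notin ds -> phi u = 0.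

Lemma restricted_functional_is_subspace (R : realType) (M : bgmod R) :
  is_subspace (@restricted_functional R M).
Proof.
split.
  split=> [c u v|]; first by rewrite [RHS]addr0 scaler0.
  by exists [::] => s e u _ _.
move=> c f g [lf [ds fP]] [lg [es gP]]; split.
  move=> d u v; rewrite !fctE lf lg !scalerDr addrACA.
  by rewrite !scalerA [c * d]mulrC.
exists (ds ++ es) => s e u su; rewrite mem_cat negb_or => /andP[nd ne].
by rewrite !fctE (fP s e) // (gP s e) // scaler0 addr0.
Qed.

Definition restricted_dual (R : realType) (M : bgmod R) :=
  Subspace (restricted_functional_is_subspace M).

Definition bg_dual (R : realType) (p : nat) (M : bgmod R) : bgmod R :=
  @BgMod R (subspace_type (restricted_dual M))
    (fun n phi => into (restricted_dual M) (fun u =>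
       val phi (expipi (p%:R / 2) *: bg_act (- n + p%:Z - 2) u)))
    (fun s e phi => forall s' e' u, bg_deg s' e' u ->
       (s', e') <> (- s, e) -> val phi u = 0).

Section ModuleOverQuotient.
Variables (R : realType) (p : nat).
Local Notation P := (p%:R : R[i]).

Lemma fsum_eq_at (U : zmodType) (f g : nat -> U) (K0 : nat) : fsum_eq f g ->
  exists2 K, (K0 <= K)%N & \sum_(j < K) f j = \sum_(j < K) g j.
Proof.
by case=> K1 e; exists (maxn K0 K1); [exact: leq_maxl | apply/e/leq_maxr].
Qed.

Lemma cbinom0 (n : R[i]) : cbinom n 0 = 1.
Proof. by rewrite /cbinom big_ord0 fact0 divr1. Qed.

Lemma cbinom0S j : cbinom (0 : R[i]) j.+1 = 0.
Proof. by rewrite /cbinom big_ord_recl subrr mul0r mul0r. Qed.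

Lemma cbinom_neg_neq0 (k j : nat) : cbinom (- k.+1%:R : R[i]) j != 0.
Proof.
rewrite mulf_neq0 ?invr_eq0 ?pnatr_eq0 -?lt0n ?fact_gt0 //.
apply/prodf_neq0 => i _; rewrite -opprD oppr_eq0 -natrD pnatr_eq0.
by rewrite addSn.
Qed.

Lemma lin0 (U W : lmodType R[i]) (f : U -> W) : linear f -> f 0 = 0.
Proof.
by move=> lf; have := lf (-1) 0 0; rewrite scaler0 addr0 scaleN1r addNr.
Qed.

Lemma linD (U W : lmodType R[i]) (f : U -> W) u v :
  linear f -> f (u + v) = f u + f v.
Proof. by move=> lf; have := lf 1 u v; rewrite !scale1r. Qed.

Lemma lin_sum (U W : lmodType R[i]) (f : U -> W) (I : Type) (s : seq I)
    (F : I -> U) : linear f -> f (\sum_(i <- s) F i) = \sum_(i <- s) f (F i).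
Proof.
move=> lf; elim: s => [|i s IHs]; first by rewrite !big_nil lin0.
by rewrite !big_cons linD // IHs.
Qed.

Lemma linear_grading_eq0 (U W : lmodType R[i]) (I : eqType) (D : I -> U -> Prop)
    (f : U -> W) : is_grading D -> linear f ->
  (forall i u, D i u -> f u = 0) -> forall u, f u = 0.
Proof.
move=> [_ dD _] lf f0 u; have [s [F [DF ->]]] := dD u.
by rewrite lin_sum // big1 // => i _; apply: f0 (DF i).
Qed.

Lemma subspace_sum (U : lmodType R[i]) (A : U -> Prop) (I : Type) (s : seq I)
    (F : I -> U) : is_subspace A -> (forall i, A (F i)) -> A (\sum_(i <- s) F i).
Proof.
move=> [A0 AD] AF; elim: s => [|i s IHs]; first by rewrite big_nil.
by rewrite big_cons -[F i]scale1r; apply: AD.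
Qed.

Lemma subspaceZ (U : lmodType R[i]) (A : U -> Prop) c u :
  is_subspace A -> A u -> A (c *: u).
Proof. by move=> [A0 AD] Au; rewrite -[_ *: _]addr0; apply: AD. Qed.

Lemma subspaceD (U : lmodType R[i]) (A : U -> Prop) u v :
  is_subspace A -> A u -> A v -> A (u + v).
Proof. by move=> [A0 AD] Au Av; rewrite -[u]scale1r; apply: AD. Qed.

Lemma lin_preim (U W : lmodType R[i]) (f : U -> W) (B : W -> Prop) :
  linear f -> is_subspace B -> is_subspace (fun u => B (f u)).
Proof. by move=> lf sB; apply: (preim_is_subspace (Subspace sB)). Qed.

Section Rep.
Variables (V : gva P) (U : lmodType R[i]) (gU : int -> U -> Prop).
Variable act : V -> R[i] -> U -> U.
Hypothesis rU : field_rep P (@gva_deg R P V) (gva_one V) (@gva_mul R P V)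
  gU 0 act.

Lemma act0 a n : act a n 0 = 0.
Proof. exact/lin0/(rep_linear_r rU). Qed.

Lemma act_nonint r a t u n : gva_deg r a -> gU t u ->
  (forall i : int, n <> i%:~R) -> act a n u = 0.
Proof.
move=> ra tu nint; have [N HN] := rep_field rU ra tu.
apply/eqP/negPn/negP => /eqP /HN [l _ nE].
apply: (nint (l - p%:Z * r * t)); rewrite nE add0r.
by rewrite rmorphB /= !rmorphM.
Qed.

Lemma borcherds_iterate r s t a b u (n k : int) :
  gva_deg r a -> gva_deg s b -> gU t u ->
  exists eps : R[i], forall K0 : nat, exists2 K, (K0 <= K)%N &
    act (gva_mul a n%:~R b) k%:~R u =
    \sum_(j < K) ((-1) ^+ j * cbinom n%:~R j) *:
       (act a (n%:~R - j%:R) (act b (k%:~R + j%:R) u)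
        - eps *: act b (n%:~R + k%:~R - j%:R) (act a j%:R u)).
Proof.
move=> ra sb tu.
have int (i q w : int) :
    exists j : int, i%:~R = j%:~R - P * q%:~R * w%:~R :> R[i].
  by exists (i + p%:Z * q * w); rewrite rmorphD /= !rmorphM /= addrK.
have B := @rep_borcherds _ _ _ _ _ _ _ _ _ _ rU r s t a b u 0 k%:~R n%:~R
   ra sb tu (int n r s).
rewrite add0r in B; have {}B := B (int 0 r t) (int k s t).
eexists=> K0; have [K KK0 e] := fsum_eq_at K0.+1 B; exists K; first exact: ltnW.
transitivity (\sum_(j < K) cbinom (0 : R[i]) j *:
    act (gva_mul a (n%:~R + j%:R) b) (0 + k%:~R - j%:R) u); last first.
  rewrite -e; apply: eq_bigr => j _; rewrite !add0r; reflexivity.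
case: K KK0 {e} => // K _; rewrite big_ord_recl big1 => [|i _].
  by rewrite cbinom0 scale1r add0r subr0 !addr0.
by rewrite cbinom0S scale0r.
Qed.

End Rep.

Variables (Fp : gva P) (a : Fp).
Hypothesis a_cyclic : gva_cyclic a.

Lemma gen_regular (n : nat) : gva_mul a n%:R a = 0.
Proof.
have [_ loc _] := a_cyclic.
have [K K1 e] := fsum_eq_at 1 (loc (n%:R + P) (-1) (gva_one Fp)).
have r0 := act0 (gva_rep Fp).
move: e; rewrite [RHS]big1 => [|j _]; last first.
  by rewrite addrAC -!natrD gva_regular r0 scaler0.
case: K K1 => // K _; rewrite big_ord_recl big1 => [|j _].
  by rewrite addr0 cbinom0 !mul1r scale1r addr0 gva_creation subr0 addrK.
have -> : -1 + (lift ord0 j)%:R = j%:R :> R[i].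
  by rewrite /= /bump leq0n natrD addKr.
by rewrite gva_regular r0 scaler0.
Qed.

Section RepGen.
Variables (U : lmodType R[i]) (gU : int -> U -> Prop).
Variable act : Fp -> R[i] -> U -> U.
Hypothesis rU : field_rep P (@gva_deg R P Fp) (gva_one Fp) (@gva_mul R P Fp)
  gU 0 act.

Lemma act_gen_nonint n u : (forall i : int, n <> i%:~R) -> act a n u = 0.
Proof.
have [a1 _ _] := a_cyclic => nint.
apply: (linear_grading_eq0 (rep_grading rU) (rep_linear_r rU a n)) => t v tv.
exact: act_nonint a1 tv nint.
Qed.

Lemma gen_commute : exists eps : R[i], forall (n k : int) u,
  act a n%:~R (act a k%:~R u) = eps *: act a k%:~R (act a n%:~R u).
Proof.
have [a1 _ _] := a_cyclic.
exists (expipi (P * 1%:~R * 1%:~R) * expipi 0) => n k u.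
set eps := (X in X *: _).
apply/eqP; rewrite -subr_eq0; apply/eqP; move: u.
have ln := rep_linear_r rU a.
apply: (linear_grading_eq0 (rep_grading rU)) => [c u v|t u tu].
  rewrite !ln scalerDr opprD addrACA scalerBr !scalerA.
  by rewrite [eps * c]mulrC.
have int (i q w : int) :
    exists j : int, i%:~R = j%:~R - P * q%:~R * w%:~R :> R[i].
  by exists (i + p%:Z * q * w); rewrite rmorphD /= !rmorphM /= addrK.
have B := @rep_borcherds _ _ _ _ _ _ _ _ _ _ rU 1 1 t a a u n%:~R k%:~R 0
   a1 a1 tu (int 0 1 1).
rewrite add0r in B; have {}B := B (int n 1 t) (int k 1 t).
have [K K1 e] := fsum_eq_at 1 B.
move: e; rewrite [RHS]big1 => [|j _]; last first.
  by rewrite add0r gen_regular (lin0 (rep_linear_l rU _ _)) scaler0.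
case: K K1 => // K _; rewrite big_ord_recl big1 => [|j _].
  by rewrite cbinom0 mulr1 scale1r !subr0 !addr0 add0r.
by rewrite cbinom0S mulr0 scale0r.
Qed.

Definition gen_word (b : Fp) : Prop :=
  exists ns : seq int, b = foldr (fun n c => gva_mul a n%:~R c) (gva_one Fp) ns.

Lemma gen_word_deg ns :
  gva_deg (size ns)%:Z (foldr (fun n c => gva_mul a n%:~R c) (gva_one Fp) ns).
Proof.
have [a1 _ _] := a_cyclic.
elim: ns => [|n ns IHns] /=; first exact: gva_deg_one.
by rewrite -add1n PoszD; apply: (rep_degree (gva_rep Fp)).
Qed.

Section Stable.
Variable H : U -> Prop.
Hypothesis hom_H : forall u, H u -> exists t, gU t u.
Hypothesis H_gen : forall (n : int) u, H u -> H (act a n%:~R u).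

Lemma gen_stable_a n u : span_set H u -> span_set H (act a n u).
Proof.
move=> /(_ (fun v => span_set H (act a n v))); apply.
  exact: lin_preim (rep_linear_r rU a n) (span_is_subspace H).
move=> v Hv; have [[i ->]|nint] := pselect (exists i : int, n = i%:~R).
  by move=> A _; apply; apply: H_gen.
rewrite act_gen_nonint; first by case: (span_is_subspace H).
by move=> i ni; apply: nint; exists i.
Qed.

Lemma gen_stable_word b n u : gen_word b -> span_set H u -> span_set H (act b n u).
Proof.
have sH := span_is_subspace H; have [a1 _ _] := a_cyclic.
case=> ns ->; elim: ns n u => [|i ns IHns] n u Hu /=.
  by rewrite (rep_one rU); case: ifP => // _; case: sH.
move: Hu => /(_ (fun v => span_set H (act _ n v))); apply.
  exact: lin_preim (rep_linear_r rU _ _) sH.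
move=> v Hv; have [t tv] := hom_H Hv.
have [[k ->]|nint] := pselect (exists i : int, n = i%:~R); last first.
  rewrite (act_nonint rU (gen_word_deg (i :: ns)) tv); first by case: sH.
  by move=> j nj; apply: nint; exists j.
have [eps /(_ 0%N) [K _ ->]] := borcherds_iterate rU i k a1 (gen_word_deg ns) tv.
have Hv' : span_set H v by move=> A _; apply.
apply: (@subspace_sum _ (span_set H) _ _ _ sH) => j; apply: (@subspaceZ _ (span_set H)) => //.
rewrite -scaleNr; apply: (@subspaceD _ (span_set H)) => //.
  by apply: gen_stable_a; apply: IHns.
apply: (@subspaceZ _ (span_set H)) => //; apply: IHns.
exact: gen_stable_a.
Qed.

End Stable.
End RepGen.

Lemma gen_span b : span_set gen_word b.
Proof.
have [a1 _ a_gen] := a_cyclic.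
have sW := span_is_subspace gen_word.
have W1 : gen_word (gva_one Fp) by exists [::].
apply: a_gen => // [A _|A _|b1 n b2].
- exact.
- by apply; exists [:: -1]; rewrite /= gva_creation.
move=> Wb1 Wb2; apply: (Wb1 (fun c => span_set gen_word (gva_mul c n b2))) => [|w Ww].
  exact: lin_preim (rep_linear_l (gva_rep Fp) n b2) sW.
apply: (gen_stable_word (gva_rep Fp)) => // [u [ns ->]|i u [ns ->]].
  by eexists; apply: gen_word_deg.
by exists (i :: ns).
Qed.

Section Modules.
Variables (N : gmod Fp 0) (w : N).
Hypotheses (w0 : gmod_deg 0 w) (w_gen : gmod_generated w).

Lemma gmod_gen_regular :
  (forall n : nat, gmod_act a n%:R w = 0) ->
  forall (n : nat) (u : N), gmod_act a n%:R u = 0.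
Proof.
move=> aw n u; have [a1 _ _] := a_cyclic; have rN := gmod_rep N.
pose H (u : N) := (exists t, gmod_deg t u) /\ forall n : nat, gmod_act a n%:R u = 0.
have [eps comm] := gen_commute rN.
have Hw : H w by split=> //; exists 0.
have H_gen (i : int) v : H v -> H (gmod_act a i%:~R v).
  case=> [[t tv] av]; split=> [|j].
    by exists (1 + t); apply: (rep_degree rN).
  by have := comm j i v; rewrite -pmulrn => ->; rewrite av (act0 rN) scaler0.
have Hu : span_set H u.
  apply: (w_gen (span_is_subspace H)) => [A _|b i v Hv]; first exact.
  have Hb : span_set gen_word b := gen_span b.
  apply: (Hb (fun c => span_set H (gmod_act c i v))) => [|c Wc].
    exact: lin_preim (rep_linear_l rN i v) (span_is_subspace H).
  by apply: (gen_stable_word rN) => // y [].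
apply: (Hu (fun v => gmod_act a n%:R v = 0)) => [|v [] //].
split=> [|c y z ay az]; first exact: act0 rN _ _.
by rewrite (rep_linear_r rN) ay az scaler0 addr0.
Qed.

Lemma Mk_cond_quotient (k m : int) : 0 <= m ->
  Mk_cond a k m w <-> Mk_quotient_cond a k m w.
Proof.
move=> m0; have [a1 _ _] := a_cyclic; have rN := gmod_rep N.
split=> -[aw H]; split=> //.
  have areg : forall (n : nat) (u : N), gmod_act a n%:R u = 0.
    apply: gmod_gen_regular => n; have := aw (`|m|%N + n)%N.
    by rewrite natrD natr_absz ger0_norm // addKr.
  move=> b /(_ (fun b => forall n u, gmod_act b n u = 0)); apply.
    split=> [n u|c b1 b2 b10 b20 n u]; first exact: lin0 (rep_linear_l rN n u).
    by rewrite (rep_linear_l rN) b10 b20 scaler0 addr0.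
  move=> _ [i [c ->]] n u; move: c.
  apply: (linear_grading_eq0 (rep_grading (gva_rep Fp))) => [x y z|s c sc].
    by rewrite (rep_linear_r (gva_rep Fp)) (rep_linear_l rN).
  move: u; apply: (linear_grading_eq0 (rep_grading rN) (rep_linear_r rN _ n)).
  move=> t u tu.
  have [[l ->]|nint] := pselect (exists i : int, n = i%:~R); last first.
    apply: (act_nonint rN _ tu) => [|j nj]; last by apply: nint; exists j.
    exact: (rep_degree (gva_rep Fp) _ a1 sc).
  have [eps /(_ 0%N) [K _ e]] := borcherds_iterate rN (- k - i%:Z) l a1 sc tu.
  rewrite rmorphB rmorphN /= -pmulrn in e; rewrite e big1 // => j _.
  rewrite areg (act0 rN) scaler0 subr0.
  by have := H (i + j)%N; rewrite natrD opprD addrA => ->; rewrite scaler0.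
move=> n u; move: u.
apply: (linear_grading_eq0 (rep_grading rN) (rep_linear_r rN _ _)) => t u tu.
have ideal (i : nat) c : Fk_ideal a k (gva_mul a (- k%:~R - i%:R) c).
  by move=> A _; apply; exists i, c.
have [k0|k1] := lerP k 0.
  have := ideal `|1 - k|%N (gva_one Fp).
  rewrite natr_absz ger0_norm ?subr_ge0 ?(le_trans k0) // rmorphB /= opprB.
  by rewrite addKr gva_creation => /H ->.
case: k k1 ideal H => // -[//|k] _ ideal H.
have [eps /(_ n.+1) [K nK]] :=
  borcherds_iterate rN (- k.+1%:Z) (- n.+1%:Z) a1 (gva_deg_one Fp) tu.
have := ideal 0%N (gva_one Fp); rewrite subr0 => /H Hi.
rewrite rmorphN /= -pmulrn in Hi *; rewrite Hi rmorphN /= -pmulrn.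
have one1 (j : nat) : (- n.+1%:R + j%:R == -1 :> R[i]) = (j == n).
  by rewrite -subr_eq0 opprK -addrA natr1 addrC subr_eq0 eqr_nat eqSS.
have one2 (j : nat) : (- k.+1%:R + - n.+1%:R - j%:R == -1 :> R[i]) = false.
  rewrite -!opprD -!natrD eqr_opp (eqr_nat _ _ 1).
  by rewrite addnS !addSn.
rewrite (bigD1 (Ordinal nK)) //= big1 ?addr0 => [|j jn].
  rewrite !(rep_one rN) one1 one2 eqxx scaler0 subr0 => /esym/eqP.
  rewrite scaler_eq0 mulf_eq0 signr_eq0 (negPf (cbinom_neg_neq0 k n)) /=.
  by move/eqP.
rewrite !(rep_one rN) one1 one2 (negPf (_ : (j : nat) != n)).
  by rewrite (act0 rN) scaler0 subr0 scaler0.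
by apply: contra jn => /eqP jn; apply/eqP/val_inj.
Qed.

End Modules.

Lemma is_Mk_quotient (k m : int) (M : gmod Fp 0) (v : M) : 0 <= m ->
  is_Mk a k m v <-> is_universal (@Mk_quotient_cond R p Fp a k m) v.
Proof.
move=> m0; split=> -[cv v0 v_gen uv]; split=> //.
- exact/Mk_cond_quotient.
- by move=> N w /(Mk_cond_quotient _ _ _ m0) cw w0 wg; apply: uv => //; apply: cw.
- exact/(Mk_cond_quotient v0 v_gen).
- move=> N w cw w0 wg; apply: uv => //; exact/(Mk_cond_quotient w0 wg).
Qed.

End ModuleOverQuotient.

(* Main.v *)
Require Import Defs.
From HB Require Import structures.
From mathcomp Require Import all_boot all_order all_algebra.
From mathcomp Require Import boolp functions reals complex finmap monalg.
From mathcomp Require exp trigo.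
From mathcomp Require Import ring zify.

(** Both free algebras live on the same space, the polynomial algebra [fock] in
    generators y_0, y_1, ..., graded by the length of a monomial (its charge) and by
    the sum of its indices (its weight).  Put X(z) = \sum_q y_q z^q and, for a complex
    number h, let Gamma_h(z) = \sum_d z^-d [G h d] be the algebra endomorphism
    with Gamma_h(z) X(w) = (1 - w/z)^h X(w) Gamma_h(z).  The field
    x(z) = z^(c + h t) X(z) Gamma_h(z), acting on charge t, is local with exponent
    h.  For c = 0 it generates a generalized vertex algebra with phase
    exp(pi i h r s) ([model]), and for the other c modules over it ([act_rep]);
    Borcherds' identity is proved by induction on the length of a monomial
    ([borcherds_AV]).

    Conversely, a vector killed by the modes of a local field which kill the
    vacuum of this module receives a map [Psi] from [fock].  Hence the universal
    modules are explicit.  M^o(-k'/p) is [fock] itself, for h = 1/p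
    ([Mcirc_presentation]), where a acts by the field of y_0^p.  M_k(m) is a quotient of
    [fock], for h = p, by the vectors y_e u with e large compared to the charge of
    u ([Mk_presentation], [relations_trunc]); the subspace divided out in RF is of
    the same kind ([RF_kernelE]).  With N = k' - m, what remains of M_k(m) in
    charge r are the monomials of length r with all indices at most N - p r, and
    what remains of RF in charge s are the monomials of length s = N - p r with all
    indices at most r.

    The duality is a bilinear form on [fock], for which y_l and y_m pair to the
    coefficient of z^l w^m in the product of the 1 - z_i w_j.  The adjoint of
    X(z) for it is Gamma_1(1/z), on either side ([pairing_y], [pairing_y_right]).
    Since Gamma_h is a one-parameter group in h, the field of a = y_0^p on the side
    h = 1/p consists of X(z)^p and of Gamma_(1/p)(z)^p = Gamma_1(z); its adjoint
    consists of Gamma_1(1/z)^p = Gamma_p(1/z) and of X(1/z), which is the field of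
    the generator on the side h = p ([pairing_adjoint]).  Between the charges r and
    s = N - p r the form kills both families of relations, because Gamma_1 has
    degree s in charge s; and it is perfect on the remaining monomials
    ([pairing_inj], [pairing_surj]), by a double induction on r and s in which the
    top coefficient of Gamma_1 lowers all the indices by 1.  The factor
    exp(pi i p/2) in the contragredient action is absorbed by rescaling the form in
    each charge.  The bidegrees agree because m + p r = k' - s, both energies being
    E + (m + p r)^2 / (2 p) plus the weight. *)

Set Implicit Arguments.
Unset Strict Implicit.
Unset Printing Implicit Defensive.

Import Order.TTheory GRing.Theory Num.Theory.
Local Open Scope ring_scope.
Local Open Scope complex_scope.

(** * Generalized binomial coefficients *)

Section Binomial.
Variable R : realType.
Local Notation C := (R[i]).
Implicit Types (a b nu A B : C) (i j l J : nat).

Lemma cbinomS a j : j.+1%:R * cbinom a j.+1 = (a - j%:R) * cbinom a j.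
Proof.
rewrite /cbinom big_ord_recr /= factS natrM invfM.
have j0 : j.+1%:R != 0 :> C by rewrite pnatr_eq0.
by field; rewrite pnatr_eq0 -lt0n fact_gt0 addrC natr1.
Qed.

Lemma cbinom_eq a j c : j.+1%:R * c = (a - j%:R) * cbinom a j ->
  c = cbinom a j.+1.
Proof.
by rewrite -cbinomS; apply: mulfI; rewrite pnatr_eq0.
Qed.

(** Vandermonde's convolution: both sides satisfy the recursion [cbinomS] in [J]. *)
Lemma cbinom_add a b J :
  cbinom (a + b) J = \sum_(i < J.+1) cbinom a i * cbinom b (J - i).
Proof.
elim: J => [|J IH]; first by rewrite big_ord1 !cbinom0 mulr1.
apply/esym/cbinom_eq; rewrite {}IH !big_distrr /=.
have -> : \sum_(i < J.+2) J.+1%:R * (cbinom a i * cbinom b (J.+1 - i)) =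
  \sum_(i < J.+2) i%:R * cbinom a i * cbinom b (J.+1 - i) +
  \sum_(i < J.+2) cbinom a i * ((J.+1 - i)%:R * cbinom b (J.+1 - i)).
  rewrite -big_split /=; apply: eq_bigr => i _.
  have -> : J.+1%:R = i%:R + (J.+1 - i)%:R :> C.
    by rewrite -natrD subnKC // -ltnS ltn_ord.
  by ring.
rewrite big_ord_recl /= !mul0r add0r [X in _ + X]big_ord_recr /= subnn mul0r.
rewrite mulr0 addr0 -big_split /=; apply: eq_bigr => i _.
have iJ : (i <= J)%N by rewrite -ltnS ltn_ord.
rewrite /bump /= add1n subSS cbinomS subSn // cbinomS natrB //.
by ring.
Qed.

Lemma cbinom_comm a i j :
  cbinom a i * cbinom (a - i%:R) j = cbinom a j * cbinom (a - j%:R) i.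
Proof.
have E m n : cbinom a m * cbinom (a - m%:R) n =
    (\prod_(k < m + n) (a - k%:R)) / (m`!%:R * n`!%:R).
  rewrite /cbinom big_split_ord /= invfM mulrACA; congr (_ * _ * _).
  by apply: eq_bigr => k _; rewrite natrD opprD addrA.
by rewrite !E addnC [i`!%:R * _]mulrC.
Qed.

Lemma cbinom_nat (n j : nat) : cbinom (n%:R : C) j = 'C(n, j)%:R.
Proof.
elim: j n => [|j IH] n; first by rewrite cbinom0 bin0.
apply/esym/cbinom_eq; rewrite IH.
have := mul_bin_left n j.
have [nj|jn] := ltnP n j.
  by rewrite !bin_small ?(ltnW nj) ?mulr0 ?ltnS // ltnW.
by move=> /(congr1 (fun k => k%:R : C)); rewrite !natrM natrB.
Qed.

Lemma cbinom_trinom b i j : (j <= i)%N ->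
  cbinom b i * cbinom i%:R j = cbinom b j * cbinom (b - j%:R) (i - j).
Proof.
move=> ji; rewrite cbinom_nat.
have := bin_fact ji; set c := 'C(i, j) => cE.
have -> : cbinom b i = (\prod_(k < i) (b - k%:R)) / i`!%:R by [].
rewrite -cE !natrM.
have -> : \prod_(k < i) (b - k%:R) =
    (\prod_(k < j) (b - k%:R)) * \prod_(k < i - j) (b - j%:R - k%:R).
  move: (subnKC ji); move: (i - j)%N => d <-.
  rewrite big_split_ord /=; congr (_ * _).
  by apply: eq_bigr => k _; rewrite natrD opprD addrA.
rewrite /cbinom.
have c0 : c%:R != 0 :> C by rewrite pnatr_eq0 -lt0n bin_gt0.
have f1 : j`!%:R != 0 :> C by rewrite pnatr_eq0 -lt0n fact_gt0.
have f2 : (i - j)`!%:R != 0 :> C by rewrite pnatr_eq0 -lt0n fact_gt0.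
by field; rewrite c0 f1 f2.
Qed.

Lemma cbinom_opp a j : cbinom (- a) j = (-1) ^+ j * cbinom (a + j%:R - 1) j.
Proof.
rewrite /cbinom mulrA; congr (_ / _).
rewrite [X in _ = _ * X](reindex_inj rev_ord_inj) /=.
have -> : (-1) ^+ j = \prod_(i < j) (-1) :> C by rewrite prodr_const card_ord.
rewrite -big_split /=; apply: eq_bigr => i _.
by rewrite natrB // -natr1; ring.
Qed.

End Binomial.

Lemma sum_nat_shift (U : nmodType) (i n : nat) (P : pred nat) (F : nat -> U) :
  \sum_(i <= j < n | P j) F j = \sum_(0 <= j < n - i | P (j + i)%N) F (j + i)%N.
Proof. by rewrite -big_addn add0n. Qed.

Section Antidiagonal.
Variables (R : realType) (U : lmodType R[i]) (W : nat).
Local Notation C := (R[i]).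
Implicit Types (X : nat -> U) (nu A B : C) (l : nat).

(** Only the terms with [i + j < W] survive, so that the square of indices may be
    summed along antidiagonals. *)
Lemma antidiag (f : nat -> nat -> C) X : (forall J, (W <= J)%N -> X J = 0) ->
  \sum_(j < W) \sum_(i < W) f j i *: X (i + j)%N =
  \sum_(J < W) (\sum_(i < J.+1) f (J - i)%N i) *: X J.
Proof.
move=> X0.
have -> : \sum_(J < W) (\sum_(i < J.+1) f (J - i)%N i) *: X J =
  \sum_(J < W) \sum_(i < W | (i <= J)%N) f (J - i)%N i *: X J.
  apply: eq_bigr => J _; rewrite scaler_suml.
  rewrite (big_ord_widen W (fun i => f (J - i)%N i *: X J)) ?ltn_ord //.
rewrite exchange_big [RHS](exchange_big_dep xpredT) //=.
apply: eq_bigr => i _.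
rewrite -(big_mkord xpredT (fun j => f j i *: X (i + j)%N)).
rewrite -(big_mkord (fun J => (i <= J)%N) (fun J => f (J - i)%N i *: X J)).
have iW := ltn_ord i.
rewrite [RHS](big_cat_nat (n := i)) ?(ltnW iW) //= [X in _ = X + _]big1_seq ?add0r; last first.
  by move=> J /andP[iJ]; rewrite mem_index_iota => /andP[_]; rewrite ltnNge iJ.
rewrite [RHS]sum_nat_shift.
rewrite (big_cat_nat (n := W - i)) ?leq_subr //= [X in _ + X]big1_seq ?addr0; last first.
  move=> j /andP[_]; rewrite mem_index_iota => /andP[Wj _].
  by rewrite X0 ?scaler0 // -leq_subLR.
rewrite [RHS]big_mkcond; apply: eq_bigr => j _.
by rewrite leq_addl addnK addnC.
Qed.

(** [(1 + y)^nu (1 + t + y)^B (1 + t)^A], expanded first in [y] or first in [t]. *)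
Lemma two_expansions_sum nu A B l X : (forall J, (W <= J)%N -> X J = 0) ->
  \sum_(j < W) \sum_(i < W)
    (cbinom nu j * (cbinom B i * cbinom (A + B - i%:R) l)) *: X (i + j)%N =
  \sum_(j' < l.+1) \sum_(J < W)
    (cbinom A (l - j') * cbinom B j' * cbinom (nu + B - j'%:R) J) *: X J.
Proof.
move=> X0; rewrite (antidiag (fun j i => cbinom nu j *
  (cbinom B i * cbinom (A + B - i%:R) l))) //= exchange_big /=.
apply: eq_bigr => J _; rewrite -scaler_suml; congr (_ *: _).
under eq_bigr => i _ do
  rewrite -addrA [A + _]addrC cbinom_add !big_distrr /=.
rewrite exchange_big /=; apply: eq_bigr => j' _.
rewrite -addrA [nu + _]addrC cbinom_add big_distrr /=; apply: eq_bigr => i _.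
by rewrite [cbinom B i * _]mulrA cbinom_comm; ring.
Qed.

(** [(1 + y)^nu (1 + y + y t)^B (1 + t)^A], expanded first in [y] or first in [t]. *)
Lemma two_expansions_prod nu A B l X : (forall J, (W <= J)%N -> X J = 0) ->
  \sum_(j < W) \sum_(i < W)
    (cbinom nu j * (cbinom B i * cbinom (A + i%:R) l)) *: X (i + j)%N =
  \sum_(j' < l.+1) \sum_(J < W)
    (cbinom A (l - j') * cbinom B j' * cbinom (nu + B - j'%:R) J) *:
      X (J + j')%N.
Proof.
move=> X0; rewrite (antidiag (fun j i => cbinom nu j *
  (cbinom B i * cbinom (A + i%:R) l))) //=.
pose g (j' J : nat) : C := if (j' <= J)%N then
  cbinom A (l - j') * cbinom B j' * cbinom (nu + B - j'%:R) (J - j') else 0.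
transitivity (\sum_(j' < l.+1) \sum_(J < W) g j' J *: X J).
  rewrite exchange_big; apply: eq_bigr => J _.
  rewrite -scaler_suml; congr (_ *: _).
  under eq_bigr => i _ do rewrite [A + _]addrC cbinom_add !big_distrr /=.
  rewrite exchange_big /=; apply: eq_bigr => j' _; rewrite /g.
  case: leqP => [j'J|Jj']; last first.
    rewrite big1 // => i _.
    by rewrite cbinom_nat bin_small ?mul0r ?mulr0 // (leq_trans (ltn_ord i)).
  have e : J.+1 = (j' + (J - j').+1)%N by rewrite addnS subnKC.
  rewrite -(big_mkord xpredT (fun i => cbinom nu (J - i) * (cbinom B i *
    (cbinom i%:R j' * cbinom A (l - j'))))) e (big_cat_nat (n := j')) ?leq_addr //=.
  rewrite big1_seq ?add0r; last first.
    move=> i; rewrite mem_index_iota => /andP[_ ij].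
    by rewrite cbinom_nat bin_small ?mul0r ?mulr0.
  rewrite (sum_nat_shift j') addKn.
  rewrite -addrA [nu + _]addrC cbinom_add !big_distrr /= big_mkord.
  apply: eq_bigr => i _.
  have := @cbinom_trinom _ B (i + j') j' (leq_addl _ _); rewrite addnK => t.
  rewrite [cbinom B (i + j') * _]mulrA t subnDA subnAC.
  by ring.
apply: eq_bigr => j' _.
have [j'W|Wj'] := leqP W j'.
  rewrite !big1 // => J _.
    by rewrite X0 ?scaler0 // (leq_trans j'W) // leq_addl.
  by rewrite /g leqNgt (leq_trans (ltn_ord J) j'W) scale0r.
rewrite -(big_mkord xpredT (fun J => g j' J *: X J)) (big_cat_nat (n := j')) ?(ltnW Wj') //=.
rewrite big1_seq ?add0r; last first.
  move=> i; rewrite mem_index_iota /= => ij.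
  by rewrite /g leqNgt ij scale0r.
rewrite (sum_nat_shift j') big_mkord.
rewrite [RHS](bigID (fun J : 'I_W => (J < W - j')%N)) /= [X in _ = _ + X]big1 ?addr0.
  rewrite (big_ord_widen W (fun i => g j' (i + j')%N *: X (i + j')%N)) ?leq_subr //.
  by apply: eq_bigr => i _; rewrite /g leq_addl addnK.
move=> J; rewrite -leqNgt leq_subLR addnC => WJ.
by rewrite X0 ?scaler0.
Qed.

(** The substitution of [q + j] for [q] exchanges the terms lost at the two ends of
    the range, all of which vanish. *)
Lemma shift_sum (F : int -> nat -> U) :
  (forall (n j : nat), F (- n.+1%:Z) j = 0) ->
  (forall q j : nat, (W <= q + j)%N -> F q j = 0) ->
  \sum_(q < W) \sum_(j < W) F (q%:Z - j%:Z) j =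
  \sum_(q < W) \sum_(j < W) F q j.
Proof.
move=> Fneg Fbig; rewrite exchange_big [RHS]exchange_big /=.
apply: eq_bigr => j _.
rewrite -(big_mkord xpredT (fun q => F (q%:Z - j%:Z) j)).
rewrite (big_cat_nat (n := j)) ?(ltnW (ltn_ord j)) //= big1_seq ?add0r; last first.
  move=> q; rewrite mem_index_iota => /andP[_ qj].
  by rewrite (_ : _ - _ = - (j - q).-1.+1%:Z) ?Fneg //; lia.
rewrite (sum_nat_shift j) big_mkord.
rewrite [RHS](bigID (fun q : 'I_W => (q < W - j)%N)) /= [X in _ = _ + X]big1 ?addr0.
  rewrite (big_ord_widen W (fun i => F ((i + j)%:Z - j%:Z) j)) ?leq_subr //.
  by apply: eq_bigr => i _; rewrite PoszD addrK.
by move=> q; rewrite -leqNgt leq_subLR addnC => /Fbig.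
Qed.

End Antidiagonal.

(** * The polynomial algebra in infinitely many variables *)

Lemma malgZU (K : choiceType) (S : nzRingType) (c : S) (k : K) :
  << c *g k >> = c *: << k >> :> {malg S[K]}.
Proof. by apply/malgP => k'; rewrite mcoeffZ !mcoeffU mulr_natr. Qed.

Section Fock.
Variable R : realType.
Local Notation C := (R[i]).

(** A monomial is a sequence up to permutation; the sorted sequences represent
    each of them once. *)
Definition key := {s : seq nat | sorted leq s}.
Local Notation malgk := {malg C[key]}.

Lemma linear_eq_subspace (U W : lmodType C) (f g : U -> W) :
  linear f -> linear g -> is_subspace (fun v => f v = g v).
Proof.
move=> lf lg; split; first by rewrite !lin0.
by move=> c u v fu fv; rewrite lf lg fu fv.
Qed.

Definition perm_inv (W : Type) (F : seq nat -> W) :=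
  forall s t, perm_eq s t -> F s = F t.

Definition skey (s : seq nat) : key := exist _ (sort leq s) (sort_sorted leq_total s).
Definition mys (s : seq nat) : malgk := << skey s >>.

Lemma skey_perm s t : perm_eq s t -> skey s = skey t.
Proof.
move=> st; apply/val_inj/(sorted_eq leq_trans anti_leq); rewrite /= ?sort_sorted //;
  try exact: leq_total.
by rewrite perm_sort perm_sym perm_sort perm_sym.
Qed.

Lemma skey_val (k : key) : skey (val k) = k.
Proof.
apply/val_inj; case: k => s ss /=.
by apply/sorted_sort => //; exact: leq_trans.
Qed.

Lemma mys_perm s t : perm_eq s t -> mys s = mys t.
Proof. by move=> /skey_perm e; rewrite /mys e. Qed.

Lemma malgk_sum (v : malgk) : v = \sum_(k <- msupp v) mcoeff k v *: mys (val k).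
Proof.
rewrite [LHS]monalgE; apply: eq_bigr => k _.
by rewrite /mys skey_val -malgZU.
Qed.

Lemma malgk_ind (P : malgk -> Prop) : is_subspace P -> (forall s, P (mys s)) ->
  forall v, P v.
Proof.
move=> sP Ps v; rewrite (malgk_sum v).
by apply: (subspace_sum _ sP) => k; apply: subspaceZ.
Qed.

Definition mlift (W : lmodType C) (F : seq nat -> W) (v : malgk) : W :=
  \sum_(k <- msupp v) mcoeff k v *: F (val k).

Lemma mlift_sup (W : lmodType C) (F : seq nat -> W) v (d : {fset key}) :
  (msupp v `<=` d)%fset -> mlift F v = \sum_(k <- d) mcoeff k v *: F (val k).
Proof.
move=> sd; rewrite /mlift; apply: big_fset_incl => // k _.
by move/mcoeff_outdom => ->; rewrite scale0r.
Qed.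

Lemma mlift_is_linear (W : lmodType C) (F : seq nat -> W) : linear (mlift F).
Proof.
move=> c u v; pose d := (msupp (c *: u + v) `|` (msupp u `|` msupp v))%fset.
rewrite !(@mlift_sup _ F _ d) ?fsubsetUl //; first last.
- by apply/fsubsetP => k; rewrite /d !in_fsetU => ->; rewrite !orbT.
- by apply/fsubsetP => k; rewrite /d !in_fsetU => ->; rewrite !orbT.
rewrite scaler_sumr -big_split /=; apply: eq_bigr => k _.
by rewrite (mcoeffD k (c *: u)) (mcoeffZ c u) scalerDl scalerA.
Qed.

Lemma mlift_ys (W : lmodType C) (F : seq nat -> W) s :
  perm_inv F -> mlift F (mys s) = F s.
Proof.
move=> pF; rewrite (@mlift_sup _ F _ [fset skey s]%fset) ?msuppU_le //.
rewrite big_seq_fset1 /mys mcoeffUU scale1r; apply: pF.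
by rewrite perm_sort.
Qed.

(** The polynomial algebra is used only through its monomials and their universal
    property; hiding its construction keeps the terms small. *)
Record fock_space := FockSpace {
  fock_car :> lmodType C;
  fock_ys : seq nat -> fock_car;
  fock_ysP : forall s t, perm_eq s t -> fock_ys s = fock_ys t;
  fock_indP : forall P : fock_car -> Prop, is_subspace P ->
    (forall s, P (fock_ys s)) -> forall v, P v;
  fock_lift : forall W : lmodType C, (seq nat -> W) -> fock_car -> W;
  fock_lift_linear : forall (W : lmodType C) F, linear (@fock_lift W F);
  fock_lift_ys : forall (W : lmodType C) F s, perm_inv F ->
    @fock_lift W F (fock_ys s) = F s }.

Lemma fock_space_exists : fock_space.
Proof.
exact: (@FockSpace malgk mys mys_perm malgk_ind mlift mlift_is_linear mlift_ys).
Qed.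

Definition fock : lmodType C := fock_car fock_space_exists.
Definition ys : seq nat -> fock := @fock_ys fock_space_exists.
Definition lift (W : lmodType C) (F : seq nat -> W) : fock -> W :=
  @fock_lift fock_space_exists W F.

Lemma ys_perm s t : perm_eq s t -> ys s = ys t. Proof. exact: fock_ysP. Qed.

Lemma fock_ind (P : fock -> Prop) : is_subspace P -> (forall s, P (ys s)) ->
  forall v, P v.
Proof. exact: fock_indP. Qed.

Lemma lift_is_linear (W : lmodType C) (F : seq nat -> W) : linear (lift F).
Proof. exact: fock_lift_linear. Qed.

HB.instance Definition _ (W : lmodType C) (F : seq nat -> W) :=
  GRing.isLinear.Build C fock W *:%R (lift F) (lift_is_linear F).

Lemma lift_ys (W : lmodType C) (F : seq nat -> W) s :
  perm_inv F -> lift F (ys s) = F s.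
Proof. exact: fock_lift_ys. Qed.

Lemma fock_eq (W : lmodType C) (f g : fock -> W) : linear f -> linear g ->
  (forall s, f (ys s) = g (ys s)) -> f =1 g.
Proof.
by move=> lf lg; apply: (@fock_ind (fun v => f v = g v)); exact: linear_eq_subspace.
Qed.

Lemma perm_inv_rec (W : Type) (F : seq nat -> W) (Op : nat -> W -> W) :
  (forall n s, F (n :: s) = Op n (F s)) ->
  (forall m n s, Op m (Op n (F s)) = Op n (Op m (F s))) -> perm_inv F.
Proof.
move=> Fr OpC s t.
have swap n s1 s2 : F (n :: s1 ++ s2) = F (s1 ++ n :: s2).
  elim: s1 => //= m s1 IH; rewrite !Fr -IH !Fr OpC //.
suff H : forall s t, perm_eq s t -> F s = F t by exact: H.
elim=> [|n s1 IH] t1; first by rewrite perm_sym => /perm_nilP ->.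
move=> st; have /path.splitPr : n \in t1 by rewrite -(perm_mem st) mem_head.
move=> p; case: p st => t2 t3 st; rewrite -swap !Fr (IH (t2 ++ t3)) //.
by have := perm_catCA t2 [:: n] t3 => e; move: (perm_trans st (permEl e)); rewrite perm_cons.
Qed.

(** With [y_z = 0] for negative [z], the generating function X needs no special
    case when its indices are shifted. *)
Definition y (z : int) : fock -> fock :=
  if z is Posz q then lift (fun s => ys (q :: s)) else fun=> 0.

Lemma y_is_linear z : linear (y z).
Proof.
by case: z => n; [exact: lift_is_linear | move=> c u v; rewrite scaler0 addr0].
Qed.

HB.instance Definition _ z :=
  GRing.isLinear.Build C fock fock *:%R (y z) (y_is_linear z).

Arguments y : simpl never.

Lemma y_ys (q : nat) s : y q (ys s) = ys (q :: s).
Proof. by apply: lift_ys => t u tu; apply: ys_perm; rewrite perm_cons. Qed.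

Lemma y_neg z v : z < 0 -> y z v = 0.
Proof. by case: z. Qed.

Lemma yC a b v : y a (y b v) = y b (y a v).
Proof.
case: a => a; last by rewrite !(@y_neg (Negz a)) ?linear0.
case: b => b; last by rewrite !(@y_neg (Negz b)) ?linear0.
move: v; apply: fock_eq => [c u v|c u v|s]; rewrite ?linearP // !y_ys.
by apply: ys_perm; have /permEl := perm_catCA [:: a] [:: b] s.
Qed.

Definition hom_set (n : nat) (w : int) (v : fock) :=
  exists s, [/\ size s = n, (sumn s)%:Z = w & v = ys s].
(** A constructor, instead of the bare span, keeps unification from unfolding the
    definition. *)
Variant hom (n : nat) (w : int) (v : fock) : Prop :=
  Hom of span_set (hom_set n w) v.

Lemma hom_ind n w (P : fock -> Prop) : is_subspace P ->
  (forall s, size s = n -> (sumn s)%:Z = w -> P (ys s)) ->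
  forall v, hom n w v -> P v.
Proof. by move=> sP Ps v [Hv]; apply: Hv => // u [s [? ? ->]]; apply: Ps. Qed.

Lemma hom_ys s : hom (size s) (sumn s) (ys s).
Proof. by split=> P _; apply; exists s. Qed.

Lemma hom_sub n w : is_subspace (hom n w).
Proof.
have [s0 sD] := span_is_subspace (hom_set n w); split; first by split.
by move=> c u v [Hu] [Hv]; split; apply: sD.
Qed.

Lemma hom0 n w : hom n w 0. Proof. by case: (hom_sub n w). Qed.
Lemma homZ n w c v : hom n w v -> hom n w (c *: v).
Proof. by apply: (@subspaceZ _ _ (hom n w)); exact: hom_sub. Qed.
Lemma hom_sum n w (I : Type) (r : seq I) (F : I -> fock) :
  (forall i, hom n w (F i)) -> hom n w (\sum_(i <- r) F i).
Proof. by apply: (@subspace_sum _ _ (hom n w)); exact: hom_sub. Qed.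

Lemma hom_neg n w v : w < 0 -> hom n w v -> v = 0.
Proof.
move=> w0; apply: (hom_ind (P := fun v => v = 0)).
  by split=> // c u u' -> ->; rewrite scaler0 addr0.
by move=> s _ sw; move: w0; rewrite -sw.
Qed.

Lemma hom_y n w q v : hom n w v -> hom n.+1 (q + w) (y q v).
Proof.
case: q => [q|q]; last by move=> _; rewrite y_neg //; apply: hom0.
move: v; apply: hom_ind; first exact: lin_preim (y_is_linear q) (hom_sub _ _).
by move=> s <- <-; rewrite y_ys; have := hom_ys (q :: s); rewrite /= PoszD.
Qed.

Lemma tri_exchange (U : nmodType) (d : nat) (F : nat -> nat -> U) :
  \sum_(j < d.+1) \sum_(k < (d - j).+1) F j k =
  \sum_(k < d.+1) \sum_(j < (d - k).+1) F j k.
Proof.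
have E (G : nat -> nat -> U) : \sum_(j < d.+1) \sum_(k < (d - j).+1) G j k =
    \sum_(j < d.+1) \sum_(k < d.+1 | (j + k < d.+1)%N) G j k.
  apply: eq_bigr => j _.
  rewrite (big_ord_widen d.+1 (G j)) ?ltnS ?leq_subr //.
  by apply: eq_bigl => k; have := ltn_ord j; lia.
rewrite E (E (fun a b => F b a)) (exchange_big_dep xpredT) //=.
by apply: eq_bigr => k _; apply: eq_bigl => j; rewrite addnC.
Qed.

Section Gamma.
Variable h : C.

(** The coefficient of [z^-d] in [Gamma_h(z) y_s], where [Gamma_h(z)] is
    multiplicative and maps [X(w)] to [(1 - w/z)^h X(w)]. *)
Fixpoint Gs (s : seq nat) (d : nat) : fock :=
  if s is q :: s' then
    \sum_(j < d.+1) ((-1) ^+ j * cbinom h j) *: y (q%:Z - j%:Z) (Gs s' (d - j))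
  else if d == 0%N then ys [::] else 0.

Lemma Gs_perm d : perm_inv (fun s => Gs s d).
Proof.
pose Op q (F : nat -> fock) d :=
  \sum_(j < d.+1) ((-1) ^+ j * cbinom h j) *: y (q%:Z - j%:Z) (F (d - j)%N).
suff H : perm_inv Gs by move=> s t /H ->.
apply: (perm_inv_rec (Op := Op)) => // m n s; apply/funext => e; rewrite /Op.
transitivity (\sum_(j < e.+1) \sum_(k < (e - j).+1)
  (((-1) ^+ j * cbinom h j) * ((-1) ^+ k * cbinom h k)) *:
    y (m%:Z - j%:Z) (y (n%:Z - k%:Z) (Gs s (e - j - k)))).
  apply: eq_bigr => j _; rewrite linear_sum scaler_sumr.
  by apply: eq_bigr => k _; rewrite linearZ scalerA.
rewrite (tri_exchange e (fun j k => (((-1) ^+ j * cbinom h j) *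
  ((-1) ^+ k * cbinom h k)) *:
    y (m%:Z - j%:Z) (y (n%:Z - k%:Z) (Gs s (e - j - k))))).
apply: eq_bigr => j _; rewrite linear_sum scaler_sumr.
by apply: eq_bigr => k _; rewrite linearZ scalerA yC mulrC subnAC.
Qed.

Definition G (d : nat) : fock -> fock := lift (fun s => Gs s d).

HB.instance Definition _ d := GRing.Linear.on (G d).

Lemma G_ys d s : G d (ys s) = Gs s d.
Proof. exact/lift_ys/Gs_perm. Qed.

Lemma G_one d : G d (ys [::]) = if d == 0%N then ys [::] else 0.
Proof. by rewrite G_ys. Qed.

Lemma G_y d q v : G d (y q v) =
  \sum_(j < d.+1) ((-1) ^+ j * cbinom h j) *: y (q - j%:Z) (G (d - j) v).
Proof.
case: q => [q|q]; last first.
  rewrite y_neg // linear0 big1 // => j _; rewrite y_neg ?scaler0 //.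
  lia.
move: v; apply: fock_eq => [c u v|c u v|s]; first by rewrite !linearP.
  rewrite scaler_sumr -big_split; apply: eq_bigr => j _ /=.
  by rewrite (linearP (G _)) (linearP (y _)) scalerDr !scalerA mulrC.
by rewrite y_ys G_ys /=; apply: eq_bigr => j _; rewrite G_ys.
Qed.

Lemma G_0 v : G 0 v = v.
Proof.
move: v; apply: fock_eq => [c u v|//|s]; first exact: linearP.
elim: s => [|q s IH]; first by rewrite G_one.
by rewrite -y_ys G_y big_ord1 cbinom0 mul1r scale1r subr0 IH.
Qed.

Lemma hom_G n w d v : hom n w v -> hom n (w - d%:Z) (G d v).
Proof.
move: v; apply: hom_ind; first exact: lin_preim (linearP (G d)) (hom_sub _ _).
move=> s <- <-; elim: s d => [|q s IH] d.
  rewrite G_one; case: eqP => [->|_]; last exact: hom0.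
  by rewrite subr0; apply: (hom_ys [::]).
rewrite -y_ys G_y; apply: hom_sum => j; apply: homZ.
have jd : (j <= d)%N by rewrite -ltnS.
have -> : (sumn (q :: s))%:Z - d%:Z = (q%:Z - j%:Z) + ((sumn s)%:Z - (d - j)%:Z).
  by rewrite /=; lia.
exact: hom_y (IH _).
Qed.

Lemma G_big n w d v : hom n w v -> w < d%:Z -> G d v = 0.
Proof. by move=> /(hom_G d) Hv wd; apply: hom_neg Hv; rewrite subr_lt0. Qed.

(** The generating function form of [G_y], tested against a family [phi]. *)
Lemma G_y_sum (U : lmodType C) (W : nat) (phi : nat -> {linear fock -> U})
    n w (q : int) v : hom n w v -> q + w < W%:Z ->
  \sum_(D < W) phi D (G D (y q v)) =
  \sum_(j < W) \sum_(d < W)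
    ((-1) ^+ j * cbinom h j) *: phi (d + j)%N (y (q - j%:Z) (G d v)).
Proof.
move=> Hv qw.
pose F j d := ((-1) ^+ j * cbinom h j) *: phi (d + j)%N (y (q - j%:Z) (G d v)).
have F0 j d : (W <= d + j)%N -> F j d = 0.
  move=> Wjd; rewrite /F; have [jq|qj] := lerP j%:Z q; last first.
    by rewrite y_neg ?subr_lt0 // !linear0.
  by rewrite (G_big Hv) ?linear0 ?scaler0 //; lia.
transitivity (\sum_(D < W) \sum_(j < D.+1) F j (D - j)%N).
  apply: eq_bigr => D _; rewrite G_y linear_sum; apply: eq_bigr => j _.
  by rewrite linearZ /F subnK // -ltnS.
transitivity (\sum_(D < W) \sum_(j < W | (j <= D)%N) F j (D - j)%N).
  apply: eq_bigr => D _.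
  by rewrite (big_ord_widen W (fun j => F j (D - j)%N)).
rewrite (exchange_big_dep xpredT) //=; apply: eq_bigr => j _.
rewrite -(big_mkord (fun D => (j <= D)%N) (fun D => F j (D - j)%N)).
rewrite (big_cat_nat (n := j)) ?(ltnW (ltn_ord j)) //= big1_seq ?add0r; last first.
  move=> D /andP[jD]; rewrite mem_index_iota => /andP[_].
  by rewrite ltnNge jD.
rewrite (sum_nat_shift j) -(big_mkord xpredT (F j)).
rewrite [RHS](big_cat_nat (n := W - j)) ?leq_subr //= [X in _ = _ + X]big1_seq ?addr0.
  by apply: eq_big => [i|i _]; rewrite ?leq_addl ?addnK.
move=> i; rewrite mem_index_iota => /andP[_ /andP[Wi _]].
by apply: F0; move: Wi; rewrite leq_subLR addnC.
Qed.

End Gamma.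

Lemma G_comm h h' d d' v : G h d (G h' d' v) = G h' d' (G h d v).
Proof.
move: v; apply: fock_eq => [c u v|c u v|s]; rewrite ?linearP //.
elim: s d d' => [|q s IH] d d'.
  by rewrite !G_one; do 2 case: eqP => [->|?]; rewrite ?linear0 // !G_one //;
    case: eqP.
rewrite -y_ys !G_y !linear_sum.
under eq_bigr => j _ do rewrite linearZ /= G_y scaler_sumr.
under [RHS]eq_bigr => j _ do rewrite linearZ /= G_y scaler_sumr.
rewrite exchange_big; apply: eq_bigr => j _; apply: eq_bigr => k _.
by rewrite !scalerA mulrC IH -!addrA [- _ - _]addrC.
Qed.

Definition wproj (w : int) : fock -> fock :=
  lift (fun s => if (sumn s)%:Z == w then ys s else 0).

HB.instance Definition _ w := GRing.Linear.on (wproj w).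

Lemma wproj_hom n w w' v : hom n w v -> wproj w' v = if w == w' then v else 0.
Proof.
move: v; apply: hom_ind.
  apply: linear_eq_subspace; first exact: linearP.
  by case: eqP => _ c u v //; rewrite scaler0 addr0.
move=> s _ <-; rewrite /wproj lift_ys // => t u tu.
by rewrite (perm_sumn tu) (ys_perm tu).
Qed.

Lemma wproj_one w : wproj w (ys [::]) = if w == 0 then ys [::] else 0.
Proof. by rewrite (wproj_hom _ (hom_ys [::])) eq_sym. Qed.

Lemma hom_wproj n w w' v : hom n w v -> hom n w' (wproj w' v).
Proof. by move=> Hv; rewrite (wproj_hom _ Hv); case: eqP => [<-//|_]; apply: hom0. Qed.

Lemma wproj_neg w v : w < 0 -> wproj w v = 0.
Proof.
move=> w0; move: v; apply: fock_eq => [c u v|c u v|s]; first exact: linearP.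
  by rewrite scaler0 addr0.
by rewrite (wproj_hom _ (hom_ys s)); case: eqP => // sw; move: w0; rewrite -sw.
Qed.

End Fock.
Arguments y : simpl never.

(** * Coefficients of vertex operators *)

Section Rotations.
Variables (U : nmodType) (W : nat).
Local Notation I := 'I_W.

Lemma sum_rot3 (F : I -> I -> I -> U) :
  \sum_a \sum_b \sum_c F a b c = \sum_c \sum_a \sum_b F a b c.
Proof.
by under eq_bigr => a _ do rewrite exchange_big; rewrite exchange_big.
Qed.

Lemma sum_rot4 (F : I -> I -> I -> I -> U) :
  \sum_a \sum_b \sum_c \sum_d F a b c d = \sum_d \sum_a \sum_b \sum_c F a b c d.
Proof.
by under eq_bigr => a _ do rewrite sum_rot3; rewrite exchange_big.
Qed.

Lemma sum_rot5 (F : I -> I -> I -> I -> I -> U) :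
  \sum_a \sum_b \sum_c \sum_d \sum_e F a b c d e =
  \sum_e \sum_a \sum_b \sum_c \sum_d F a b c d e.
Proof.
by under eq_bigr => a _ do rewrite sum_rot4; rewrite exchange_big.
Qed.

Lemma sum_only0 (F : nat -> U) : (0 < W)%N ->
  (forall i, (0 < i)%N -> F i = 0) -> \sum_(i < W) F i = F 0%N.
Proof.
case: W => // n _ F0; rewrite big_ord_recl big1 ?addr0 // => i _.
exact: F0.
Qed.

End Rotations.

Section VertexOperators.
Variables (R : realType) (h : R[i]) (W : nat).
Local Notation C := (R[i]).
Local Notation G := (G h).
Implicit Types (a b u v : fock R) (al be : C).

(** The field of [y_l] is the normally ordered product, over the entries [n] of
    [l], of the divided derivatives of order [n] of
    [z^al X(z) Gamma_h(z)], that is of the sum of the [z^(al + q - d) y_q G_d].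
    This is the coefficient, applied to [b], with values of weight [w]; the weights
    of [b] and of the value determine the power of [z]. The bound [W] on the
    indices is harmless as soon as it exceeds these weights. *)
Fixpoint AVs al (l : seq nat) (w : int) b : fock R :=
  if l is n :: l' then
    \sum_(d < W) \sum_(q < W) cbinom (al + q%:R - d%:R) n *:
      y q%:Z (AVs al l' (w - q%:Z) (G d b))
  else wproj w b.

Lemma AVs_linear al l w : linear (AVs al l w).
Proof.
elim: l w => [|n l IH] w c u v /=; first exact: linearP.
rewrite scaler_sumr -big_split; apply: eq_bigr => d _ /=.
rewrite scaler_sumr -big_split; apply: eq_bigr => q _ /=.
by rewrite (linearP (G d)) IH (linearP (y _)) scalerDr !scalerA mulrC.
Qed.

Lemma AVs_perm al : perm_inv (AVs al).
Proof.
pose Op n (F : int -> fock R -> fock R) w b :=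
  \sum_(d < W) \sum_(q < W) cbinom (al + q%:R - d%:R) n *:
      y q%:Z (F (w - q%:Z) (G d b)).
apply: (perm_inv_rec (Op := Op)) => // m n s; apply/funext => w; apply/funext => b.
have E m1 n1 : Op m1 (Op n1 (AVs al s)) w b =
  \sum_(d < W) \sum_(q < W) \sum_(d' < W) \sum_(q' < W)
    (cbinom (al + q%:R - d%:R) m1 * cbinom (al + q'%:R - d'%:R) n1) *:
    y q%:Z (y q'%:Z (AVs al s (w - q%:Z - q'%:Z) (G d' (G d b)))).
  apply: eq_bigr => d _; apply: eq_bigr => q _.
  rewrite /Op linear_sum scaler_sumr; apply: eq_bigr => d' _.
  rewrite linear_sum scaler_sumr; apply: eq_bigr => q' _.
  by rewrite linearZ scalerA.
rewrite !E sum_rot3; apply: eq_bigr => d' _ /=.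
rewrite sum_rot3; apply: eq_bigr => q' _ /=.
apply: eq_bigr => d _; apply: eq_bigr => q _.
rewrite yC G_comm mulrC; congr (_ *: y _ (y _ (AVs _ _ _ _))).
exact: addrAC.
Qed.

Definition AV al (a : fock R) (w : int) b : fock R := lift (fun l => AVs al l w b) a.

Lemma AV_ys al l w b : AV al (ys R l) w b = AVs al l w b.
Proof. by apply: lift_ys => s t /(AVs_perm al) ->. Qed.

Lemma AV_linear_l al w b : linear (fun a => AV al a w b).
Proof. exact: lift_is_linear. Qed.

Definition AVl al w b : fock R -> fock R := fun a => AV al a w b.

HB.instance Definition _ al w b :=
  GRing.isLinear.Build C (fock R) (fock R) *:%R (AVl al w b) (AV_linear_l al w b).

Lemma AV_linear al a w : linear (AV al a w).
Proof.
move=> c u v; move: a; apply: fock_eq => [|k a a'|l] /=.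
- exact: AV_linear_l.
- by rewrite !AV_linear_l !scalerDr !scalerA [c * k]mulrC addrACA.
- by rewrite !AV_ys AVs_linear.
Qed.

HB.instance Definition _ al a w :=
  GRing.isLinear.Build C (fock R) (fock R) *:%R (AV al a w) (AV_linear al a w).

Lemma AV_one al w b : AV al (ys R [::]) w b = wproj w b.
Proof. by rewrite AV_ys. Qed.

Lemma AV_y al (n : nat) a w b : AV al (y n a) w b =
  \sum_(d < W) \sum_(q < W) cbinom (al + q%:R - d%:R) n *:
    y q%:Z (AV al a (w - q%:Z) (G d b)).
Proof.
move: a; apply: fock_eq => [c u v|c u v|l].
- by rewrite (linearP (y n)) AV_linear_l.
- rewrite scaler_sumr -big_split; apply: eq_bigr => d _ /=.
  rewrite scaler_sumr -big_split; apply: eq_bigr => q _ /=.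
  by rewrite AV_linear_l (linearP (y _)) scalerDr !scalerA mulrC.
- rewrite y_ys AV_ys /=; apply: eq_bigr => d _; apply: eq_bigr => q _.
  by rewrite AV_ys.
Qed.

Lemma AV_yB al (n j : nat) a w b : AV al (y (n%:Z - j%:Z) a) w b =
  if (j <= n)%N then \sum_(d < W) \sum_(q < W) cbinom (al + q%:R - d%:R) (n - j) *:
    y q%:Z (AV al a (w - q%:Z) (G d b)) else 0.
Proof.
case: leqP => jn; first by rewrite subzn // AV_y.
by rewrite y_neg ?linear0 ?subr_lt0 // [LHS](lin0 (AV_linear_l _ _ _)).
Qed.

Lemma AV_neg al a w b : w < 0 -> AV al a w b = 0.
Proof.
move=> w0; move: a; apply: fock_eq => [|c u v|l]; first exact: AV_linear_l.
  by rewrite scaler0 addr0.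
rewrite AV_ys; elim: l w b w0 => [|n l IH] w b w0 /=; first exact: wproj_neg.
by rewrite !big1 // => d _; rewrite big1 // => q _; rewrite IH ?linear0 ?scaler0 //; lia.
Qed.

Lemma hom_AV al r s wa wb w a b : hom r wa a -> hom s wb b ->
  hom (r + s)%N w (AV al a w b).
Proof.
move=> ha hb; move: a ha; apply: hom_ind; first exact: (lin_preim (AV_linear_l al w b) (hom_sub R (r + s)%N w)).
move=> l <- _; rewrite AV_ys.
elim: l w wb b hb => [|n l IH] w wb b hb /=; first exact: hom_wproj hb.
apply: hom_sum => d; apply: hom_sum => q; apply: homZ.
by have := hom_y q (IH (w - q%:Z) _ _ (hom_G h d hb)); rewrite addrC subrK addSn.
Qed.

Lemma G_wproj n w wu u D : hom n wu u ->
  G D (wproj w u) = wproj (w - D%:Z) (G D u).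
Proof.
move=> hu; rewrite (wproj_hom _ hu) (wproj_hom _ (hom_G h D hu)).
by rewrite (inj_eq (addIr _)); case: eqP; rewrite ?linear0.
Qed.

End VertexOperators.

Section Commutation.
Variables (R : realType) (h : R[i]) (W : nat).
Local Notation C := (R[i]).
Local Notation G := (G h).
Local Notation AV := (AV h W).
Local Notation AVl := (AVl h W).
Implicit Types (a b u v : fock R) (al be : C).

(** Moving the annihilation part [G] of a vertex operator through [AV]:
    [Gamma(x) Y(b, y) u = Y(Gamma(x - y) b, y) Gamma(x) u] for [|x| > |y|]. *)
Lemma G_AV (U : lmodType C) be s wb b t wu u w
    (phi : nat -> {linear fock R -> U}) :
  hom s wb b -> hom t wu u -> w < W%:Z -> wb < W%:Z -> wu < W%:Z -> (0 < W)%N ->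
  \sum_(D < W) phi D (G D (AV be b w u)) =
  \sum_(d < W) \sum_(d' < W) \sum_(i < W)
    ((-1) ^+ i * cbinom (h * s%:R - d%:R) i) *:
      phi (d + d' + i)%N (AV be (G d b) (w - (d + d' + i)%N%:Z) (G d' u)).
Proof.
move=> hb hu wW wbW wuW W0; move: b hb.
apply: hom_ind => [|l].
  apply: linear_eq_subspace => c u1 v1.
    rewrite scaler_sumr -big_split; apply: eq_bigr => d _ /=.
    by rewrite AV_linear_l (linearP (G d)) (linearP (phi d)).
  rewrite scaler_sumr -big_split; apply: eq_bigr => d _ /=.
  rewrite scaler_sumr -big_split; apply: eq_bigr => d' _ /=.
  rewrite scaler_sumr -big_split; apply: eq_bigr => i _ /=.
  rewrite (linearP (G d)) AV_linear_l (linearP (phi _)) scalerDr !scalerA.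
  by rewrite mulrC.
elim: l s wb w t wu u phi hu wW wbW wuW => [|n l IH] s wb w t wu u phi hu wW wbW wuW <- wE.
  rewrite (@sum_only0 _ W (fun d => \sum_(d' < W) \sum_(i < W)
    ((-1) ^+ i * cbinom (h * 0%:R - d%:R) i) *:
    phi (d + d' + i)%N (AV be (G d (ys R [::])) (w - (d + d' + i)%N%:Z) (G d' u)))) //.
    apply: eq_bigr => d' _.
    rewrite (@sum_only0 _ W (fun i => ((-1) ^+ i * cbinom (h * 0%:R - 0%:R) i) *:
      phi (0 + d' + i)%N (AV be (G 0 (ys R [::])) (w - (0 + d' + i)%N%:Z) (G d' u)))) //.
      rewrite G_0 !AV_one cbinom0 mulr1 scale1r add0n addn0.
      by rewrite (G_wproj _ _ _ hu).
    by case=> // i _; rewrite mulr0 subr0 cbinom0S mulr0 scale0r.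
  case=> // d _; rewrite big1 // => d' _; rewrite big1 // => i _.
  by rewrite G_one [AV _ _ _ _](lin0 (AV_linear_l _ _ _ _ _)) linear0 scaler0.
have lW : (sumn l)%:Z < W%:Z by move: wbW; rewrite -wE /=; lia.
have nW : n%:Z + (sumn l)%:Z < W%:Z by move: wbW; rewrite -wE /=; lia.
set b1 := ys R l; have hb1 : hom (size l) (sumn l) b1 by exact: hom_ys.
set nu := h * (size l)%:R.
transitivity (\sum_(d' < W) \sum_(q < W) \sum_(j < W)
  \sum_(d1 < W) \sum_(d'' < W) \sum_(i < W)
   (cbinom (be + q%:R - d'%:R) n * ((-1) ^+ j * cbinom h j) *
    ((-1) ^+ i * cbinom (nu - d1%:R) i)) *:
     phi (d1 + d'' + i + j)%N (y (q%:Z - j%:Z)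
       (AV be (G d1 b1) (w - q%:Z - (d1 + d'' + i)%N%:Z) (G d'' (G d' u))))).
  transitivity (\sum_(d' < W) \sum_(q < W) cbinom (be + q%:R - d'%:R) n *:
    \sum_(D < W) phi D (G D (y q (AV be b1 (w - q%:Z) (G d' u))))).
    under eq_bigr => D _ do
      (rewrite -y_ys AV_y !linear_sum; under eq_bigr => d' _ do
        (rewrite !linear_sum; under eq_bigr => q _ do rewrite !linearZ)).
    rewrite -sum_rot3 exchange_big -sum_rot3; apply: eq_bigr => d' _.
    rewrite exchange_big; apply: eq_bigr => q _.
    by rewrite scaler_sumr.
  apply: eq_bigr => d' _; apply: eq_bigr => q _.
  have qwW : q%:Z + (w - q%:Z) < W%:Z by lia.
  have hd' := hom_G h d' hu.
  rewrite (G_y_sum h phi (hom_AV h W be (w - q%:Z) hb1 hd')) // scaler_sumr.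
  apply: eq_bigr => j _; rewrite -scaler_sumr.
  pose phi' D : {linear fock R -> U} := phi (D + j)%N \o y (q%:Z - j%:Z).
  have := IH _ _ (w - q%:Z) _ _ (G d' u) phi' hd' _ lW _ erefl erefl.
  move=> -> //; [|lia|lia].
  rewrite !scaler_sumr; apply: eq_bigr => d1 _.
  rewrite !scaler_sumr; apply: eq_bigr => d'' _.
  rewrite !scaler_sumr; apply: eq_bigr => i _.
  by rewrite !scalerA !mulrA.
transitivity (\sum_(d'' < W) \sum_(i < W) \sum_(j' < W) \sum_(d1 < W)
  \sum_(d' < W) \sum_(q < W)
    (((-1) ^+ j' * cbinom h j') * ((-1) ^+ i * cbinom (nu + h - d1%:R - j'%:R) i) *
     (if (j' <= n)%N then cbinom (be + q%:R - d'%:R) (n - j') else 0)) *: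
     phi (d1 + j' + d'' + i)%N (y q%:Z (AV be (G d1 b1)
       (w - q%:Z - (d1 + j' + d'' + i)%N%:Z) (G d'' (G d' u))))); last first.
  rewrite [RHS]exchange_big; apply: eq_bigr => d'' _.
  rewrite [RHS]exchange_big; apply: eq_bigr => i _.
  pose psi D : {linear fock R -> U} :=
    ((-1) ^+ i * cbinom (h * (size (n :: l))%:R - D%:R) i) \*:
    (phi (D + d'' + i)%N \o AVl be (w - (D + d'' + i)%N%:Z) (G d'' u)).
  rewrite -[RHS]/(\sum_(d < W) psi d (G d (ys R (n :: l)))) -y_ys.
  rewrite (G_y_sum h psi hb1) //; apply: eq_bigr => j' _; apply: eq_bigr => d1 _.
  rewrite /psi /= /AVl AV_yB; case: leqP => j'n; last first.
    rewrite linear0 !scaler0 big1 // => d' _; rewrite big1 // => q _.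
    by rewrite mulr0 scale0r.
  rewrite !linear_sum ?scaler_sumr; apply: eq_bigr => d' _.
  rewrite !linear_sum ?scaler_sumr; apply: eq_bigr => q _.
  rewrite !linearZ /= !scalerA; congr (_ *: phi _ (y _ (AV _ _ _ _))).
  - rewrite (_ : nu + h - d1%:R - j'%:R = h * (size l).+1%:R - (d1 + j')%:R).
      by ring.
    by rewrite /nu -natr1 natrD; ring.
  - by rewrite addrAC.
  - by rewrite G_comm.
rewrite [LHS]sum_rot4 [RHS]sum_rot4; apply: eq_bigr => d1 _.
rewrite [RHS]sum_rot4; apply: eq_bigr => d' _.
rewrite [LHS]sum_rot3; apply: eq_bigr => d'' _.
pose X q J := (-1) ^+ J *: phi (d1 + d'' + J)%N (y q%:Z
  (AV be (G d1 b1) (w - q%:Z - (d1 + d'' + J)%N%:Z) (G d'' (G d' u)))).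
have X0 q J : (W <= J)%N -> X q J = 0.
  by move=> WJ; rewrite /X AV_neg ?linear0 ?scaler0 //; lia.
transitivity (\sum_(i < W) \sum_(q < W) \sum_(j < W)
  (cbinom (nu - d1%:R) i * (cbinom h j * cbinom (be + q%:R - d'%:R + j%:R) n)) *:
    X q (j + i)%N).
  rewrite [LHS]sum_rot3; apply: eq_bigr => i _.
  pose F (z : int) (j : nat) :=
    (cbinom (be + z%:~R - d'%:R + j%:R) n * ((-1) ^+ j * cbinom h j) *
     ((-1) ^+ i * cbinom (nu - d1%:R) i)) *:
     phi (d1 + d'' + i + j)%N (y z (AV be (G d1 b1)
       (w - z - j%:Z - (d1 + d'' + i)%N%:Z) (G d'' (G d' u)))).
  transitivity (\sum_(q < W) \sum_(j < W) F (q%:Z - j%:Z) j).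
    apply: eq_bigr => q _; apply: eq_bigr => j _; rewrite /F.
    congr ((cbinom _ _ * _ * _) *: phi _ (y _ (AV _ _ _ _))).
      rewrite rmorphB /= -!pmulrn; ring.
    lia.
  rewrite shift_sum => [|m j|q j Wqj].
  - apply: eq_bigr => q _; apply: eq_bigr => j _; rewrite /F /X scalerA.
    congr (_ *: phi _ (y _ (AV _ _ _ _))); first by rewrite exprD; ring.
      lia.
    lia.
  - by rewrite /F y_neg ?linear0 ?scaler0.
  - by rewrite /F AV_neg ?linear0 ?scaler0 //; lia.
rewrite [LHS]exchange_big [RHS]sum_rot3; apply: eq_bigr => q _ /=.
rewrite (two_expansions_prod _ _ _ _ (X0 q)).
rewrite (big_ord_widen W (fun j' => \sum_(J < W)
  (cbinom (be + q%:R - d'%:R) (n - j') * cbinom h j' *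
   cbinom (nu - d1%:R + h - j'%:R) J) *: X q (J + j')%N)); last by lia.
rewrite big_mkcond /=.
rewrite [RHS]exchange_big; apply: eq_bigr => j' _.
rewrite ltnS; case: leqP => j'n; last by rewrite big1 // => i _; rewrite mulr0 scale0r.
apply: eq_bigr => i _; rewrite /X scalerA.
congr (_ *: phi _ (y _ (AV _ _ _ _))).
- by rewrite exprD (_ : nu - d1%:R + h = nu + h - d1%:R); ring.
- by lia.
- by lia.
Qed.

(** Moving a creation operator through [AV]: [Y(b, y) X(x) u] is the expansion
    of [X(x) Y((y - x + v)^h b_v, y) u] for [|y| > |x|]. *)
Lemma AV_y_right be s wb b t wu u (q : int) w :
  hom s wb b -> hom t wu u -> wb < W%:Z -> q < W%:Z -> q + wu < W%:Z ->
  (0 < W)%N ->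
  AV (be + h) b w (y q u) = \sum_(i < W) \sum_(d < W)
    ((-1) ^+ (d + i) * cbinom (h * s%:R - d%:R) i) *:
    y (q - i%:Z) (AV be (G d b) (w - (q - i%:Z)) u).
Proof.
move=> hb hu wbW qW quW W0; move: b hb.
apply: hom_ind => [|l].
  apply: linear_eq_subspace => c u1 v1; first by rewrite AV_linear_l.
  rewrite scaler_sumr -big_split; apply: eq_bigr => i _ /=.
  rewrite scaler_sumr -big_split; apply: eq_bigr => d _ /=.
  rewrite (linearP (G d)) AV_linear_l (linearP (y _)) scalerDr !scalerA.
  by rewrite mulrC.
elim: l s wb w t wu u q hu qW quW wbW =>
  [|n l IH] s wb w t wu u q hu qW quW wbW <- wE.
  rewrite (@sum_only0 _ W (fun i => \sum_(d < W)
    ((-1) ^+ (d + i) * cbinom (h * 0%:R - d%:R) i) *: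
    y (q - i%:Z) (AV be (G d (ys R [::])) (w - (q - i%:Z)) u))) //.
    rewrite (@sum_only0 _ W (fun d => ((-1) ^+ (d + 0) * cbinom (h * 0%:R - d%:R) 0) *:
      y (q - 0) (AV be (G d (ys R [::])) (w - (q - 0)) u))) //.
      rewrite G_0 !AV_one cbinom0 mulr1 scale1r !subr0.
      rewrite (wproj_hom _ hu) (wproj_hom _ (hom_y q hu)).
      have -> : (q + wu == w) = (wu == w - q) by lia.
      by case: eqP; rewrite ?linear0.
    by case=> // d _; rewrite G_one [AV _ _ _ _](lin0 (AV_linear_l _ _ _ _ _)) linear0 scaler0.
  case=> // i _; rewrite big1 // => -[[|d] dW] _ /=.
    by rewrite mulr0 subr0 cbinom0S mulr0 scale0r.
  by rewrite G_one [AV _ _ _ _](lin0 (AV_linear_l _ _ _ _ _)) linear0 scaler0.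
have lW : (sumn l)%:Z < W%:Z by move: wbW; rewrite -wE /=; lia.
have nW : n%:Z + (sumn l)%:Z < W%:Z by move: wbW; rewrite -wE /=; lia.
set b1 := ys R l; have hb1 : hom (size l) (sumn l) b1 by exact: hom_ys.
set nu := h * (size l)%:R.
transitivity (\sum_(q1 < W) \sum_(j < W) \sum_(d'' < W) \sum_(i < W) \sum_(d < W)
   (((-1) ^+ j * cbinom h j) * cbinom (be + h + q1%:R - (d'' + j)%:R) n *
    ((-1) ^+ (d + i) * cbinom (nu - d%:R) i)) *:
     y q1%:Z (y (q - j%:Z - i%:Z)
       (AV be (G d b1) (w - q1%:Z - (q - j%:Z - i%:Z)) (G d'' u)))).
  rewrite -y_ys AV_y exchange_big; apply: eq_bigr => q1 _.
  pose phi D : {linear fock R -> fock R} :=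
    cbinom (be + h + q1%:R - D%:R) n \*:
    (y q1%:Z \o AV (be + h) b1 (w - q1%:Z)).
  rewrite -[LHS]/(\sum_(d < W) phi d (G d (y q u))).
  rewrite (G_y_sum h phi hu) //; apply: eq_bigr => j _; apply: eq_bigr => d'' _.
  rewrite /phi /= (IH _ _ _ _ _ _ _ (hom_G h d'' hu) _ _ lW erefl erefl); [|lia|lia].
  rewrite !linear_sum; apply: eq_bigr => i _.
  rewrite !linear_sum; apply: eq_bigr => d _.
  rewrite !linearZ /= !scalerA; congr (_ *: _).
  by rewrite /nu; ring.
transitivity (\sum_(i < W) \sum_(j' < W) \sum_(d < W) \sum_(d'' < W) \sum_(q1 < W)
    (((-1) ^+ j' * cbinom h j') *
     ((-1) ^+ (d + j' + i) * cbinom (nu + h - d%:R - j'%:R) i) *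
     (if (j' <= n)%N then cbinom (be + q1%:R - d''%:R) (n - j') else 0)) *:
     y (q - i%:Z) (y q1%:Z (AV be (G d b1)
       (w - (q - i%:Z) - q1%:Z) (G d'' u)))); last first.
  apply: eq_bigr => i _.
  pose psi D : {linear fock R -> fock R} :=
    ((-1) ^+ (D + i) * cbinom (h * (size (n :: l))%:R - D%:R) i) \*:
    (y (q - i%:Z) \o AVl be (w - (q - i%:Z)) u).
  rewrite -[RHS]/(\sum_(d < W) psi d (G d (ys R (n :: l)))) -y_ys.
  rewrite (G_y_sum h psi hb1) //; apply: eq_bigr => j' _; apply: eq_bigr => d _.
  rewrite /psi /= /AVl AV_yB; case: leqP => j'n; last first.
    rewrite linear0 !scaler0 big1 // => d' _; rewrite big1 // => q1 _.
    by rewrite mulr0 scale0r.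
  rewrite !linear_sum; apply: eq_bigr => d'' _.
  rewrite !linear_sum; apply: eq_bigr => q1 _.
  rewrite !linearZ /= !scalerA; congr (_ *: _).
  rewrite (_ : nu + h - d%:R - j'%:R = h * (size l).+1%:R - (d + j')%:R).
    by ring.
  by rewrite /nu -natr1 natrD; ring.
rewrite [LHS]sum_rot5 [RHS]sum_rot3; apply: eq_bigr => d _.
rewrite [RHS]sum_rot4; apply: eq_bigr => q1 _.
rewrite [LHS]exchange_big [RHS]sum_rot3; apply: eq_bigr => d'' _.
pose X J := (-1) ^+ J *: y q1%:Z (y (q - J%:Z)
  (AV be (G d b1) (w - q1%:Z - (q - J%:Z)) (G d'' u))).
have X0 J : (W <= J)%N -> X J = 0.
  by move=> WJ; rewrite /X [y (q - _) _]y_neg ?linear0 ?scaler0 //; lia.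
transitivity ((-1) ^+ d *: \sum_(i < W) \sum_(j < W)
  (cbinom (nu - d%:R) i *
    (cbinom h j * cbinom (be + q1%:R - d''%:R + h - j%:R) n)) *: X (j + i)%N).
  rewrite [LHS]exchange_big scaler_sumr; apply: eq_bigr => i _.
  rewrite scaler_sumr; apply: eq_bigr => j _; rewrite /X !scalerA.
  rewrite (_ : q - (j + i)%N%:Z = q - j%:Z - i%:Z); last by lia.
  congr (_ *: _); rewrite !exprD natrD.
  rewrite (_ : be + h + q1%:R - (d''%:R + j%:R) = be + q1%:R - d''%:R + h - j%:R).
    by ring.
  by ring.
rewrite (two_expansions_sum _ _ _ _ X0).
rewrite (big_ord_widen W (fun j' => \sum_(J < W)
  (cbinom (be + q1%:R - d''%:R) (n - j') * cbinom h j' *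
   cbinom (nu - d%:R + h - j'%:R) J) *: X J)); last by lia.
rewrite big_mkcond scaler_sumr [RHS]exchange_big; apply: eq_bigr => j' _ /=.
rewrite ltnS; case: leqP => j'n; last first.
  by rewrite scaler0 big1 // => i _; rewrite mulr0 scale0r.
rewrite scaler_sumr; apply: eq_bigr => i _; rewrite /X !scalerA yC.
congr (_ *: y _ (y _ (AV _ _ _ _))); last first.
  lia.
rewrite (_ : nu - d%:R + h = nu + h - d%:R); last by ring.
rewrite !exprD; set k := (-1) ^+ j'.
have k2 : k * k = 1 by rewrite -expr2 sqrr_sign.
rewrite [RHS](_ : _ = k * k * ((-1) ^+ d * (-1) ^+ i * cbinom h j' *
  cbinom (nu + h - d%:R - j'%:R) i * cbinom (be + q1%:R - d''%:R) (n - j'))).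
  by rewrite k2; ring.
by ring.
Qed.

End Commutation.

(** * Borcherds' identity for the coefficients *)

Section Residues.
Variables (R : realType) (h : R[i]) (W : nat).
Local Notation C := (R[i]).
Local Notation G := (G h).
Local Notation AV := (AV h W).
Local Notation AVl := (AVl h W).
Implicit Types (a b u v : fock R) (al nu ka : C) (r s n : nat) (K M N w wb wu : int).

(** The residues of [x^m y^k (x - y)^nu] times the three products of [Y(a, x)]
    and [Y(b, y)]. *)
Definition res_xy al s a b u nu K w :=
  \sum_(j < W) ((-1) ^+ j * cbinom nu j) *:
    AV (al + h * s%:R) a w (AV al b (K - j%:Z) u).
Definition res_yx al r a b u nu M w :=
  \sum_(j < W) ((-1) ^+ j * cbinom nu j) *:
    AV (al + h * r%:R) b w (AV al a (M - j%:Z) u).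
Definition res_iter al s a b u ka N w :=
  \sum_(j < W) cbinom ka j *: AV al (AV (h * s%:R) a (N - j%:Z) b) w u.

(** In each of the next three recursions the field of [y_n a] is split into the
    derivative of order [n] of X Gamma and the field of [a]. Moving the
    Gamma and X of this derivative to the outside gives powers of [x], [y] and
    [x - y], to be expanded in two ways. The three results have the same shape. *)
Lemma res_xy_y al s wb t wu n a b u nu K w :
  hom s wb b -> hom t wu u -> wb < W%:Z -> wu < W%:Z -> K < W%:Z -> (n < W)%N ->
  res_xy al s (y n a) b u nu K w =
  \sum_(q < W) \sum_(d < W) \sum_(d' < W) \sum_(j' < n.+1)
    (cbinom (al + q%:R - d'%:R) (n - j') * cbinom (h * s%:R - d%:R) j') *:
    y q%:Z (res_xy al s a (G d b) (G d' u) (nu + h * s%:R - d%:R - j'%:R)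
      (K - d%:Z - d'%:Z) (w - q%:Z)).
Proof.
move=> hb hu wbW wuW KW nW; have W0 : (0 < W)%N by lia.
transitivity (\sum_(q < W) \sum_(j < W) \sum_(d < W) \sum_(d' < W) \sum_(i < W)
   (((-1) ^+ j * cbinom nu j) * ((-1) ^+ i * cbinom (h * s%:R - d%:R) i) *
    cbinom (al + h * s%:R + q%:R - (d + d' + i)%:R) n) *:
     y q%:Z (AV (al + h * s%:R) a (w - q%:Z)
       (AV al (G d b) (K - j%:Z - (d + d' + i)%N%:Z) (G d' u)))).
  rewrite [RHS]exchange_big; apply: eq_bigr => j _.
  rewrite AV_y [X in _ *: X]exchange_big scaler_sumr; apply: eq_bigr => q _.
  pose phi D : {linear fock R -> fock R} :=
    cbinom (al + h * s%:R + q%:R - D%:R) n \*: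
      (y q%:Z \o AV (al + h * s%:R) a (w - q%:Z)).
  rewrite -[X in _ *: X]/(\sum_(D < W) phi D (G D (AV al b (K - j%:Z) u))).
  rewrite (G_AV _ _ phi hb hu) //; last by lia.
  rewrite scaler_sumr; apply: eq_bigr => d _.
  rewrite scaler_sumr; apply: eq_bigr => d' _.
  rewrite scaler_sumr; apply: eq_bigr => i _.
  by rewrite /phi /= !scalerA.
apply: eq_bigr => q _; rewrite [LHS]exchange_big; apply: eq_bigr => d _.
rewrite [LHS]exchange_big; apply: eq_bigr => d' _.
pose X J := (-1) ^+ J *: y q%:Z (AV (al + h * s%:R) a (w - q%:Z)
       (AV al (G d b) (K - d%:Z - d'%:Z - J%:Z) (G d' u))).
have X0 J : (W <= J)%N -> X J = 0.
  by move=> WJ; rewrite /X [AV al _ _ _]AV_neg ?linear0 ?scaler0 //; lia.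
transitivity (\sum_(j < W) \sum_(i < W) (cbinom nu j * (cbinom (h * s%:R - d%:R) i *
   cbinom (al + q%:R - d'%:R + (h * s%:R - d%:R) - i%:R) n)) *: X (i + j)%N).
  apply: eq_bigr => j _; apply: eq_bigr => i _; rewrite /X scalerA.
  congr (_ *: y _ (AV _ _ _ (AV _ _ _ _))); last by lia.
  rewrite (_ : al + q%:R - d'%:R + (h * s%:R - d%:R) - i%:R =
    al + h * s%:R + q%:R - (d + d' + i)%:R); last by ring.
  by rewrite exprD; ring.
rewrite (two_expansions_sum _ _ _ _ X0); apply: eq_bigr => j' _.
rewrite linear_sum scaler_sumr; apply: eq_bigr => J _.
rewrite /X !linearZ /= !scalerA; congr (_ *: _).
by rewrite (addrA nu); ring.
Qed.

Lemma res_yx_y al r wa s wb t wu n a b u nu M w :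
  hom r wa a -> hom s wb b -> hom t wu u -> wb < W%:Z -> M < W%:Z -> (n < W)%N ->
  res_yx al r.+1 (y n a) b u nu M w =
  \sum_(q < W) \sum_(d < W) \sum_(d' < W) \sum_(j' < n.+1)
    ((-1) ^+ (d + j') *
     (cbinom (al + q%:R - d'%:R) (n - j') * cbinom (h * s%:R - d%:R) j')) *:
    y q%:Z (res_yx al r a (G d b) (G d' u) (nu + h * s%:R - d%:R - j'%:R)
      (M - q%:Z - j'%:Z) (w - q%:Z)).
Proof.
move=> ha hb hu wbW MW nW; have W0 : (0 < W)%N by lia.
transitivity (\sum_(d' < W) \sum_(d < W) \sum_(j < W) \sum_(q < W) \sum_(i < W)
   (cbinom (al + q%:R - d'%:R) n * ((-1) ^+ j * cbinom nu j) *
    ((-1) ^+ (d + i) * cbinom (h * s%:R - d%:R) i)) *: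
     y (q%:Z - i%:Z) (AV (al + h * r%:R) (G d b) (w - (q%:Z - i%:Z))
       (AV al a (M - j%:Z - q%:Z) (G d' u)))).
  rewrite [RHS]exchange_big /= [RHS]sum_rot3; apply: eq_bigr => j _.
  rewrite [RHS]exchange_big /= AV_y linear_sum scaler_sumr; apply: eq_bigr => d' _.
  rewrite [RHS]exchange_big /= linear_sum scaler_sumr; apply: eq_bigr => q _.
  rewrite linearZ /= -natr1 mulrDr mulr1 addrA.
  have hau := hom_AV h W al (M - j%:Z - q%:Z) ha (hom_G h d' hu).
  rewrite (AV_y_right _ _ _ hb hau) //; [|have := ltn_ord q; lia|lia].
  rewrite [RHS]exchange_big /= !scaler_sumr; apply: eq_bigr => i _.
  rewrite !scaler_sumr; apply: eq_bigr => d _.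
  by rewrite !scalerA; congr (_ *: _); ring.
rewrite [RHS]sum_rot3; apply: eq_bigr => d' _.
rewrite [RHS]exchange_big; apply: eq_bigr => d _.
transitivity (\sum_(j < W) \sum_(q < W) \sum_(i < W)
   (cbinom (al + q%:R + i%:R - d'%:R) n * ((-1) ^+ j * cbinom nu j) *
    ((-1) ^+ (d + i) * cbinom (h * s%:R - d%:R) i)) *:
     y q%:Z (AV (al + h * r%:R) (G d b) (w - q%:Z)
       (AV al a (M - j%:Z - q%:Z - i%:Z) (G d' u)))).
  apply: eq_bigr => j _.
  pose F (z : int) (i : nat) :=
   (cbinom (al + z%:~R + i%:R - d'%:R) n * ((-1) ^+ j * cbinom nu j) *
    ((-1) ^+ (d + i) * cbinom (h * s%:R - d%:R) i)) *:
     y z (AV (al + h * r%:R) (G d b) (w - z)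
       (AV al a (M - j%:Z - z - i%:Z) (G d' u))).
  transitivity (\sum_(q < W) \sum_(i < W) F (q%:Z - i%:Z) i).
    apply: eq_bigr => q _; apply: eq_bigr => i _; rewrite /F.
    congr ((cbinom _ _ * _ * _) *: y _ (AV _ _ _ (AV _ _ _ _))).
      by rewrite rmorphB /= -!pmulrn; ring.
    by lia.
  rewrite shift_sum => [//|m i|q i Wqi].
  - by rewrite /F y_neg ?scaler0.
  - by rewrite /F [AV al _ _ _]AV_neg ?linear0 ?scaler0 //; lia.
rewrite [LHS]exchange_big; apply: eq_bigr => q _ /=.
pose X J := (-1) ^+ J *: y q%:Z (AV (al + h * r%:R) (G d b) (w - q%:Z)
       (AV al a (M - q%:Z - J%:Z) (G d' u))).
have X0 J : (W <= J)%N -> X J = 0.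
  by move=> WJ; rewrite /X [AV al _ _ _]AV_neg ?linear0 ?scaler0 //; lia.
transitivity ((-1) ^+ d *: \sum_(j < W) \sum_(i < W) (cbinom nu j *
   (cbinom (h * s%:R - d%:R) i * cbinom (al + q%:R - d'%:R + i%:R) n)) *: X (i + j)%N).
  rewrite scaler_sumr; apply: eq_bigr => j _.
  rewrite scaler_sumr; apply: eq_bigr => i _; rewrite /X !scalerA.
  congr (_ *: y _ (AV _ _ _ (AV _ _ _ _))); last by lia.
  rewrite (_ : al + q%:R - d'%:R + i%:R = al + q%:R + i%:R - d'%:R); last by ring.
  by rewrite !exprD; ring.
rewrite (two_expansions_prod _ _ _ _ X0) scaler_sumr; apply: eq_bigr => j' _.
rewrite scaler_sumr linear_sum scaler_sumr; apply: eq_bigr => J _.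
rewrite /X !linearZ /= !scalerA.
congr (_ *: y _ (AV _ _ _ (AV _ _ _ _))); last by lia.
by rewrite (addrA nu) !exprD; ring.
Qed.

Lemma res_iter_y al s n a b u ka N w : N < W%:Z ->
  res_iter al s (y n a) b u ka N w =
  \sum_(q < W) \sum_(d < W) \sum_(d' < W) \sum_(j' < n.+1)
    (cbinom (al + q%:R - d'%:R) (n - j') * cbinom (h * s%:R - d%:R) j') *:
    y q%:Z (res_iter al s a (G d b) (G d' u) (ka + (al + q%:R - d'%:R) - (n - j')%:R)
      (N - (n - j')%N%:Z) (w - q%:Z)).
Proof.
move=> NW.
transitivity (\sum_(q < W) \sum_(d < W) \sum_(d' < W) \sum_(j < W) \sum_(q0 < W)
   (cbinom ka j * (cbinom (al + q%:R - d'%:R) q0 *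
      cbinom (h * s%:R - d%:R + q0%:R) n)) *:
     y q%:Z (AV al (AV (h * s%:R) a (N - (q0 + j)%N%:Z) (G d b)) (w - q%:Z) (G d' u))).
  rewrite [RHS]sum_rot4; apply: eq_bigr => j _.
  rewrite [RHS]exchange_big /= AV_y -[AV al _ w u]/(AVl al w u _).
  rewrite linear_sum scaler_sumr; apply: eq_bigr => d _.
  rewrite [RHS]sum_rot3 linear_sum scaler_sumr; apply: eq_bigr => q0 _.
  rewrite [RHS]exchange_big /= linearZ /= /AVl AV_y !scaler_sumr.
  apply: eq_bigr => d' _; rewrite !scaler_sumr; apply: eq_bigr => q _.
  rewrite !scalerA; congr (_ *: y _ (AV _ (AV _ _ _ _) _ _)); last by lia.
  by rewrite (addrAC (h * s%:R)); ring.
apply: eq_bigr => q _; apply: eq_bigr => d _; apply: eq_bigr => d' _.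
pose X J := y q%:Z (AV al (AV (h * s%:R) a (N - J%:Z) (G d b)) (w - q%:Z) (G d' u)).
have X0 J : (W <= J)%N -> X J = 0.
  move=> WJ; rewrite /X [AV _ a _ _]AV_neg; last by lia.
  by rewrite [AV _ _ _ _](lin0 (AV_linear_l _ _ _ _ _)) linear0.
rewrite (two_expansions_prod _ _ _ _ X0) (reindex_inj rev_ord_inj) /=.
apply: eq_bigr => j' _; have j'n : (j' <= n)%N by rewrite -ltnS.
rewrite subSS subKn // linear_sum scaler_sumr; apply: eq_bigr => J _.
rewrite !linearZ /= !scalerA; congr (_ *: y _ (AV _ (AV _ _ _ _) _ _)); last by lia.
by ring.
Qed.

(** Binomial coefficients with an integral lower index. *)
Definition cz (x : C) (z : int) : C := if z is Posz n then cbinom x n else 0.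

Lemma cz_neg x z : z < 0 -> cz x z = 0. Proof. by case: z. Qed.

Lemma sum_pick (f : nat -> C) (z w : int) (X : fock R) : z - w < W%:Z ->
  \sum_(j < W) f j *: (if z - j%:Z == w then X else 0) =
  if 0 <= z - w then f `|z - w|%N *: X else 0.
Proof.
move=> zwW; case: ifP => [zw0|/negbT zw0]; last first.
  by rewrite big1 // => j _; case: eqP => [e|_]; [lia|rewrite scaler0].
have jW : (`|(z - w)%R|%N < W)%N by lia.
rewrite (bigD1 (Ordinal jW)) //= big1 ?addr0.
  by case: eqP => // e; exfalso; lia.
move=> i ij; case: eqP => [e|_]; last by rewrite scaler0.
by case/negP: ij; apply/eqP/val_inj => /=; lia.
Qed.

Lemma expN1D (z w : int) : (-1) ^ (z + w) = (-1) ^ z * (-1) ^ w :> C.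
Proof. by rewrite expfzDr // oppr_eq0 oner_eq0. Qed.

Lemma expN1N (z : int) : (-1) ^ (- z) = (-1) ^ z :> C.
Proof. by rewrite -exprz_inv invrN1. Qed.

Lemma cbinom_neg1 (q k : nat) :
  (-1) ^+ k * cbinom (- 1 - q%:R : C) k = 'C(q + k, k)%:R.
Proof.
rewrite -opprD cbinom_opp mulrA -expr2 sqrr_sign mul1r.
by rewrite -cbinom_nat natrD; congr cbinom; ring.
Qed.

(** The residue identity for the monomials [x^P y^Q], i.e. Borcherds' identity
    when the first field is the vacuum field. *)
Lemma borcherds_scalar (P Q : int) :
  (-1) ^ (- 1 - P - Q) * cz (- 1 - Q%:~R) (- 1 - P - Q)
  - (-1) ^ (- 1 - Q) * ((-1) ^ P * cz (- 1 - Q%:~R) P) = cz (- 1 - P%:~R) Q.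
Proof.
case: P Q => p [] q.
- rewrite cz_neg ?mulr0 ?sub0r; last by lia.
  rewrite /= -!pmulrn -!exprnP cbinom_neg1.
  rewrite expN1D !expN1N expr1z mulN1r mulNr opprK -exprnP.
  rewrite -bin_sub ?leq_addl // addnK addnC.
  have := cbinom_neg1 p q; rewrite -signr_odd => <-.
  by rewrite mulrA -expr2 sqrr_sign mul1r.
- rewrite [RHS]cz_neg // NegzE rmorphN /= -!pmulrn -natr1.
  rewrite (_ : - 1 - - (q%:R + 1) = q%:R); last by ring.
  rewrite (_ : - 1 - - q.+1%:Z = q); last by lia.
  rewrite (_ : - 1 - p%:Z - - q.+1%:Z = q%:Z - p%:Z); last by lia.
  rewrite expN1D expN1N mulrA -mulrBr.
  have [pq|qp] := leqP p q.
    by rewrite subzn // /= !cbinom_nat bin_sub // subrr mulr0.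
  rewrite cz_neg; last by lia.
  by rewrite /= cbinom_nat bin_small // subrr mulr0.
- rewrite [X in _ - _ * (_ * X)]cz_neg // !mulr0 subr0.
  rewrite NegzE rmorphN /= -!pmulrn -natr1.
  rewrite (_ : - 1 - - (p%:R + 1) = p%:R); last by ring.
  rewrite (_ : - 1 - - p.+1%:Z - q%:Z = p%:Z - q%:Z); last by lia.
  have [qp|pq] := leqP q p.
    rewrite subzn // /= -exprnP cbinom_neg1 cbinom_nat subnKC //.
    by rewrite bin_sub.
  rewrite cz_neg; last by lia.
  by rewrite mulr0 cbinom_nat bin_small.
- rewrite [X in _ - _ * (_ * X)]cz_neg // [RHS]cz_neg // !mulr0 subr0.
  rewrite !NegzE rmorphN /= -!pmulrn -natr1.
  rewrite (_ : - 1 - - (q%:R + 1) = q%:R); last by ring.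
  rewrite (_ : - 1 - - p.+1%:Z - - q.+1%:Z = (p + q).+1); last by lia.
  by rewrite /= cbinom_nat bin_small ?mulr0 //; lia.
Qed.

(** Borcherds' identity, by induction on the length of [a = y_l]: the three
    products satisfy the same recursion. *)
Lemma borcherds_AV al l s wb b t wu u (M K N w : int) nu ka (g : int) :
  hom s wb b -> hom t wu u ->
  wb < W%:Z -> wu < W%:Z -> M < W%:Z -> K < W%:Z -> N < W%:Z -> w < W%:Z ->
  (sumn l < W)%N ->
  w = M + K + N + 1 - (sumn l)%:Z - wb - wu ->
  g = (sumn l)%:Z + wb - 1 - N -> nu = g%:~R - h * (size l)%:R * s%:R ->
  ka = - 1 - (size l)%:R * al + ((sumn l)%:Z + wu - M)%:~R ->
  res_xy al s (ys R l) b u nu K w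
  - (-1) ^ g *: res_yx al (size l) (ys R l) b u nu M w =
  res_iter al s (ys R l) b u ka N w.
Proof.
elim: l b wb u wu M K N w nu ka g => [|n l IH] b wb u wu M K N w nu ka g
  hb hu wbW wuW MW KW NW wW lW wE gE nuE kaE.
  have [wb0|wb0] := ltP wb 0.
    move: hb => /(hom_neg wb0) ->.
    rewrite /res_xy /res_yx /res_iter !big1 ?scaler0 ?subr0 // => j _.
    - by rewrite !linear0 [AV _ _ _ _](lin0 (AV_linear_l _ _ _ _ _)) scaler0.
    - by rewrite [AV _ _ _ _](lin0 (AV_linear_l _ _ _ _ _)) scaler0.
    - by rewrite [AV al 0 _ _](lin0 (AV_linear_l _ _ _ _ _)) linear0 ?scaler0.
  have [w0|w0] := ltP w 0.
    rewrite /res_xy /res_yx /res_iter !big1 ?scaler0 ?subr0 // => j _;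
      by rewrite AV_neg // scaler0.
  have [wu0|wu0] := ltP wu 0.
    move: hu => /(hom_neg wu0) ->.
    by rewrite /res_xy /res_yx /res_iter !big1 ?scaler0 ?subr0 // => j _;
      rewrite !linear0 ?scaler0.
  set Y := AV al b w u.
  have -> : res_xy al s (ys R [::]) b u nu K w = ((-1) ^ (K - w) * cz nu (K - w)) *: Y.
    have -> : res_xy al s (ys R [::]) b u nu K w =
        \sum_(j < W) ((-1) ^+ j * cbinom nu j) *: (if K - j%:Z == w then Y else 0).
      apply: eq_bigr => j _; rewrite AV_one (wproj_hom _ (hom_AV h W al _ hb hu)).
      by case: eqP => // ->.
    rewrite (@sum_pick (fun j => (-1) ^+ j * cbinom nu j)); last by lia.
    by case: (K - w) => m; rewrite /= ?mulr0 ?scale0r.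
  have -> : res_yx al 0 (ys R [::]) b u nu M w = ((-1) ^ (M - wu) * cz nu (M - wu)) *: Y.
    have -> : res_yx al 0 (ys R [::]) b u nu M w =
        \sum_(j < W) ((-1) ^+ j * cbinom nu j) *: (if M - j%:Z == wu then Y else 0).
      apply: eq_bigr => j _; rewrite AV_one (wproj_hom _ hu) mulr0 addr0 eq_sym.
      by case: eqP => //; rewrite linear0.
    rewrite (@sum_pick (fun j => (-1) ^+ j * cbinom nu j)); last by lia.
    by case: (M - wu) => m; rewrite /= ?mulr0 ?scale0r.
  have -> : res_iter al s (ys R [::]) b u ka N w = cz ka (N - wb) *: Y.
    have -> : res_iter al s (ys R [::]) b u ka N w =
        \sum_(j < W) (cbinom ka j) *: (if N - j%:Z == wb then Y else 0).
      apply: eq_bigr => j _; rewrite AV_one (wproj_hom _ hb) eq_sym.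
      by case: eqP => //; rewrite [AV al 0 _ _](lin0 (AV_linear_l _ _ _ _ _)).
    rewrite (@sum_pick (fun j => cbinom ka j)); last by lia.
    by case: (N - wb) => m; rewrite /= ?scale0r.
  rewrite scalerA -scalerBl; congr (_ *: _).
  have := borcherds_scalar (M - wu) (N - wb).
  rewrite (_ : - 1 - (N - wb)%:~R = nu); last first.
    by rewrite nuE gE /= mulr0 mul0r subr0; rewrite !(rmorphB, rmorphD) /=; ring.
  rewrite (_ : - 1 - (M - wu)%:~R = ka); last first.
    by rewrite kaE /= mul0r subr0; rewrite !(rmorphB, rmorphD) /=; ring.
  rewrite (_ : - 1 - (M - wu) - (N - wb) = K - w); last by rewrite wE /=; lia.
  by rewrite (_ : - 1 - (N - wb) = g) //; rewrite gE /=; lia.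
have nW : (n < W)%N by move: lW => /=; lia.
have l'W : (sumn l < W)%N by move: lW => /=; lia.
rewrite -y_ys (res_xy_y _ _ _ _ hb hu) // (res_yx_y _ _ _ (hom_ys _ l) hb hu) //.
rewrite res_iter_y // scaler_sumr -sumrB; apply: eq_bigr => q _.
rewrite scaler_sumr -sumrB; apply: eq_bigr => d _.
rewrite scaler_sumr -sumrB; apply: eq_bigr => d' _.
rewrite scaler_sumr -sumrB; apply: eq_bigr => j' _.
have j'n : (j' <= n)%N by rewrite -ltnS.
set c := _ * cbinom (h * s%:R - d%:R) j'.
have hd := hom_G h d hb; have hd' := hom_G h d' hu.
have := IH _ _ _ _ (M - q%:Z - j'%:Z) (K - d%:Z - d'%:Z) (N - (n - j')%N%:Z)
  (w - q%:Z) (nu + h * s%:R - d%:R - j'%:R) (ka + (al + q%:R - d'%:R) - (n - j')%:R)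
  (g - d%:Z - j'%:Z) hd hd'.
move=> <-.
- rewrite [y _ (_ - _)]linearB /= [y _ (_ *: _)]linearZ /= scalerBr !scalerA; congr (_ - _ *: _).
  rewrite !expN1D !expN1N -!exprnP exprD; ring.
- lia.
- lia.
- lia.
- lia.
- lia.
- lia.
- lia.
- by rewrite wE /=; lia.
- by rewrite gE /=; lia.
- rewrite nuE /= -natr1 !(rmorphB, rmorphD) /= -!pmulrn; ring.
- rewrite kaE /= -natr1 natrB // !(rmorphB, rmorphD) /= -!pmulrn; ring.
Qed.

End Residues.

(** * The generalized vertex algebra of a complex number h, and its modules *)

Section Phase.
Variable R : realType.
Local Notation C := (R[i]).

Lemma expipiD (z w : C) : expipi (z + w) = expipi z * expipi w.
Proof.
case: z w => a b [c d]; rewrite /expipi /=.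
rewrite !mulrDr opprD exp.expRD trigo.cosD trigo.sinD.
by apply/eqP; rewrite eq_complex /= !(mul0r, subr0, addr0, mulr0, add0r);
  apply/andP; split; apply/eqP; ring.
Qed.

Lemma expipi0 : expipi (0 : C) = 1.
Proof.
by rewrite /expipi /= !mulr0 oppr0 exp.expR0 trigo.cos0 trigo.sin0 mul1r.
Qed.

Lemma expipi_neq0 (z : C) : expipi z != 0.
Proof.
apply/eqP => e; have := expipiD z (- z); rewrite subrr expipi0 e mul0r.
by move/eqP; rewrite oner_eq0.
Qed.

Lemma expipi1 : expipi (1 : C) = -1.
Proof.
rewrite /expipi /= mulr0 mulr1 oppr0 exp.expR0 trigo.cospi trigo.sinpi mul1r.
by apply/eqP; rewrite eq_complex /= oppr0 !eqxx.
Qed.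

Lemma expipi_int (i : int) : expipi (i%:~R : C) = (-1) ^ i.
Proof.
have nat_case n : expipi (n%:R : C) = (-1) ^+ n.
  elim: n => [|n IH]; first by rewrite expipi0.
  by rewrite -natr1 expipiD IH expipi1 exprSr.
case: i => n; first by rewrite -pmulrn nat_case.
rewrite NegzE rmorphN /= -pmulrn expN1N -exprnP -nat_case.
have e := expipiD n.+1%:R (- n.+1%:R); rewrite subrr expipi0 in e.
apply: (mulfI (expipi_neq0 n.+1%:R)).
by rewrite -e nat_case -expr2 sqrr_sign.
Qed.

End Phase.

Section Action.
Variables (R : realType) (h : R[i]).
Local Notation C := (R[i]).
Local Notation fock := (fock R).
Local Notation ys := (ys R).
Implicit Types (a b u v : fock) (c mu : C).

Lemma sum_ord_bound (U : nmodType) (F : nat -> U) n W : (n <= W)%N ->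
  (forall i, (n <= i)%N -> F i = 0) -> \sum_(i < W) F i = \sum_(i < n) F i.
Proof.
move=> nW F0; rewrite (big_ord_widen W F nW) [RHS]big_mkcond.
by apply: eq_bigr => i _; case: ltnP => // /F0.
Qed.

(** For both bounds, the terms beyond the smaller one vanish: [G_d b = 0] for [d]
    larger than the weight of [b], and no value has a negative weight. *)
Lemma AV_bound W W' al a s wb b (w : int) : hom s wb b ->
  w < W%:Z -> wb < W%:Z -> w < W'%:Z -> wb < W'%:Z ->
  AV h W al a w b = AV h W' al a w b.
Proof.
move=> hb wW wbW wW' wbW'; move: a; apply: fock_eq => [||l]; try exact: AV_linear_l.
rewrite !AV_ys; elim: l s w wb b hb wW wbW wW' wbW' => //= n l IH s w wb b hb wW wbW wW' wbW'.
pose m := minn W W'.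
have E W1 : (m <= W1)%N -> \sum_(d < W1) \sum_(q < W1) cbinom (al + q%:R - d%:R) n *:
    y q%:Z (AVs h W1 al l (w - q%:Z) (G h d b)) =
  \sum_(d < m) \sum_(q < m) cbinom (al + q%:R - d%:R) n *:
    y q%:Z (AVs h W1 al l (w - q%:Z) (G h d b)).
  move=> mW1; rewrite (@sum_ord_bound _ (fun d => \sum_(q < W1) cbinom (al + q%:R - d%:R) n *:
    y q%:Z (AVs h W1 al l (w - q%:Z) (G h d b))) m) // => [|d md].
    apply: eq_bigr => d _; apply: (@sum_ord_bound _ (fun q => cbinom (al + q%:R - d%:R) n *:
      y q%:Z (AVs h W1 al l (w - q%:Z) (G h d b)))) => // q mq.
    by rewrite -AV_ys AV_neg ?linear0 ?scaler0 //; lia.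
  rewrite (G_big h hb); last by lia.
  rewrite big1 // => q _; rewrite (lin0 (AVs_linear h W1 al l (w - q%:Z))).
  by rewrite linear0 scaler0.
rewrite !E ?geq_minl ?geq_minr //; apply: eq_bigr => d _; apply: eq_bigr => q _.
by congr (_ *: y _ _); apply: IH (hom_G h d hb) _ _ _ _; lia.
Qed.

(** The action of the mode [n] of [y_l]; the exponents of [z] in [Y(y_l, z) y_m]
    lie in [size l * (c + h * size m) + Z]. *)
Definition act_basis c (l : seq nat) (n : C) (m : seq nat) : fock :=
  let al := c + h * (size m)%:R in
  if pselect (exists w : int,
     (sumn l)%:R + (sumn m)%:R - 1 - n - (size l)%:R * al = w%:~R) is left e
  then AVs h (`|projT1 (cid e)| + sumn m).+1 al l (projT1 (cid e)) (ys m) else 0.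

Lemma act_basis_perm c l l' n m m' : perm_eq l l' -> perm_eq m m' ->
  act_basis c l n m = act_basis c l' n m'.
Proof.
move=> pl pm; rewrite /act_basis (perm_size pm) (perm_size pl).
rewrite (perm_sumn pm) (perm_sumn pl) (ys_perm _ pm).
by case: pselect => // e; rewrite (AVs_perm _ _ _ pl).
Qed.

Definition act c a (n : C) b : fock :=
  lift (fun l => lift (act_basis c l n) b) a.

Lemma act_linear_l c n b : linear (fun a => act c a n b).
Proof. exact: lift_is_linear. Qed.

Lemma act0l c n b : act c 0 n b = 0.
Proof. exact: lin0 (act_linear_l c n b). Qed.

Lemma act_ys c l n m : act c (ys l) n (ys m) = act_basis c l n m.
Proof.
rewrite /act !lift_ys // => s t st; first exact: act_basis_perm.
by congr lift; apply/funext => k; apply: act_basis_perm.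
Qed.

Lemma act_ys_l c l n : act c (ys l) n =1 lift (act_basis c l n).
Proof.
move=> b; rewrite /act lift_ys // => s t st.
by congr lift; apply/funext => k; apply: act_basis_perm.
Qed.

Lemma act_linear c a n : linear (act c a n).
Proof.
move=> k u v; move: a; apply: fock_eq => [|k' a a'|l] /=.
- exact: act_linear_l.
- by rewrite !act_linear_l !scalerDr !scalerA [k * k']mulrC addrACA.
- by rewrite !act_ys_l linearP.
Qed.

HB.instance Definition _ c a n :=
  GRing.isLinear.Build C fock fock *:%R (act c a n) (act_linear c a n).

(** Neither the bound in [act_basis] nor the choice of the exponent there matters. *)
Lemma act_eq W c r wa a s wb b (w : int) n : hom r wa a -> hom s wb b ->
  n = (wa + wb - 1 - w)%:~R - r%:R * (c + h * s%:R) ->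
  w < W%:Z -> wb < W%:Z -> act c a n b = AV h W (c + h * s%:R) a w b.
Proof.
move=> ha hb nE wW wbW; move: a ha; apply: hom_ind => [|l lr lw].
  by apply: linear_eq_subspace; [exact: act_linear_l | exact: AV_linear_l].
move: b hb; apply: hom_ind => [|m ms mw].
  by apply: linear_eq_subspace; exact: linearP.
rewrite act_ys /act_basis ms lr.
have zE : (sumn l)%:R + (sumn m)%:R - 1 - n - r%:R * (c + h * s%:R) = w%:~R.
  rewrite nE -lw -mw !(rmorphB, rmorphD) /= -!pmulrn; ring.
case: pselect => [e|ne]; last by case: ne; exists w.
case: cid => w' /= w'E; move: w'E; rewrite zE => /intr_inj <-.
have hm := hom_ys R m; rewrite -AV_ys; apply: AV_bound hm _ _ _ _ => //; try lia.
Qed.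

Lemma act_zero c r wa a s wb b n : hom r wa a -> hom s wb b ->
  (forall w : int, 0 <= w -> n <> (wa + wb - 1 - w)%:~R - r%:R * (c + h * s%:R)) ->
  act c a n b = 0.
Proof.
move=> ha hb nE; move: a ha; apply: hom_ind => [|l lr lw].
  apply: linear_eq_subspace; first exact: act_linear_l.
  by move=> k u v; rewrite scaler0 addr0.
move: b hb; apply: hom_ind => [|m ms mw].
  apply: linear_eq_subspace; first exact: linearP.
  by move=> k u v; rewrite scaler0 addr0.
rewrite act_ys /act_basis ms lr; case: pselect => // e.
case: cid => w /= wE; have [w0|w0] := ltP w 0.
  by rewrite -AV_ys AV_neg.
case: (nE w w0); rewrite -mw -lw !(rmorphB, rmorphD) /= -!pmulrn -wE; ring.
Qed.

Definition charge_set (t : int) (v : fock) :=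
  exists l, (size l)%:Z = t /\ v = ys l.
Definition charge (t : int) (v : fock) := span_set (charge_set t) v.

Lemma charge_sub t : is_subspace (charge t). Proof. exact: span_is_subspace. Qed.

Lemma charge_ys l : charge (size l) (ys l).
Proof. by move=> P _; apply; exists l. Qed.

Lemma charge_ind t (P : fock -> Prop) : is_subspace P ->
  (forall s, (size s)%:Z = t -> P (ys s)) -> forall v, charge t v -> P v.
Proof. by move=> sP Ps v; apply => // u [l [lt ->]]; apply: Ps. Qed.

Lemma hom_charge s w v : hom s w v -> charge s v.
Proof.
move: v; apply: hom_ind => [|l <- _]; [exact: charge_sub | exact: charge_ys].
Qed.

Definition cproj (t : int) : fock -> fock :=
  lift (fun l => if (size l)%:Z == t then ys l else 0).

HB.instance Definition _ t := GRing.Linear.on (cproj t).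

Lemma cproj_charge t t' v : charge t v -> cproj t' v = if t == t' then v else 0.
Proof.
move: v; apply: charge_ind => [|l <-].
  apply: linear_eq_subspace; first exact: linearP.
  by case: eqP => _ k u v //; rewrite scaler0 addr0.
rewrite /cproj lift_ys // => s s' e.
by rewrite (perm_size e) (ys_perm _ e).
Qed.

Lemma charge_cproj t v : charge t (cproj t v).
Proof.
move: v; apply: fock_ind => [|l].
  exact: (lin_preim (linearP (cproj t)) (charge_sub t)).
rewrite (cproj_charge _ (@charge_ys l)); case: eqP => [<-|_].
  exact: charge_ys.
by case: (charge_sub t).
Qed.

Lemma cproj_sum v : exists N, forall n, (N <= n)%N -> v = \sum_(t < n) cproj t v.
Proof.
move: v; apply: fock_ind => [|l].
  split; first by exists 0%N => n _; rewrite big1 // => t _; rewrite linear0.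
  move=> k u v [N1 e1] [N2 e2]; exists (maxn N1 N2) => n.
  rewrite geq_max => /andP[/e1 {1}-> /e2 {1}->].
  rewrite scaler_sumr -big_split; apply: eq_bigr => t _ /=.
  by rewrite linearP.
exists (size l).+1 => n ln; rewrite (bigD1 (Ordinal ln)) //= big1 ?addr0.
  by rewrite (cproj_charge _ (@charge_ys l)) eqxx.
move=> i il; rewrite (cproj_charge _ (@charge_ys l)); case: eqP => // -[e].
by case/negP: il; apply/eqP/val_inj.
Qed.

Lemma charge_grading : is_grading charge.
Proof.
split=> [i|v|s f us fP f0 i si]; first exact: charge_sub.
  have [N /(_ N (leqnn N)) e] := cproj_sum v.
  exists (map Posz (iota 0 N)), (cproj^~ v); split=> [i|].
    exact: charge_cproj.
  by rewrite big_map [LHS]e -(big_mkord xpredT (fun k : nat => cproj k v)) /index_iota subn0.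
have := congr1 (cproj i) f0; rewrite linear_sum linear0.
rewrite (bigD1_seq i) //= big1 ?addr0.
  by rewrite (cproj_charge _ (fP i)) eqxx.
by move=> j ji; rewrite (cproj_charge _ (fP j)) (negPf ji).
Qed.

Lemma act_charge c r t a n u : charge r a -> charge t u ->
  charge (r + t) (act c a n u).
Proof.
move=> ha hu; move: a ha; apply: charge_ind => [|l <-].
  exact: (lin_preim (act_linear_l c n u) (charge_sub _)).
move: u hu; apply: charge_ind => [|m <-].
  exact: (lin_preim (act_linear c _ n) (charge_sub _)).
rewrite act_ys /act_basis; case: pselect => [e|_]; last by case: (charge_sub (size l + size m)).
rewrite -AV_ys -PoszD; apply: hom_charge.
by apply: hom_AV; exact: hom_ys.
Qed.

Lemma fsum_eq_lin (U : lmodType C) (k : C) (f g f' g' F F' : nat -> U) :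
  fsum_eq f g -> fsum_eq f' g' -> (forall j, F j = k *: f j + f' j) ->
  (forall j, F' j = k *: g j + g' j) -> fsum_eq F F'.
Proof.
move=> [N1 e1] [N2 e2] FE F'E; exists (maxn N1 N2) => n.
rewrite geq_max => /andP[/e1 {}e1 /e2 {}e2].
under eq_bigr do rewrite FE; under [RHS]eq_bigr do rewrite F'E.
by rewrite !big_split /= -!scaler_sumr e1 e2.
Qed.

Lemma fsum_eq0 (U : lmodType C) (F F' : nat -> U) :
  (forall j, F j = 0) -> (forall j, F' j = 0) -> fsum_eq F F'.
Proof. by move=> F0 F'0; exists 0%N => n _; rewrite !big1. Qed.

Lemma scaler_rearrange (U : lmodType C) (k eps x : C) (a1 a2 b1 b2 : U) :
  k *: ((x *: a1 + a2) - eps *: (x *: b1 + b2)) =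
  x *: (k *: (a1 - eps *: b1)) + k *: (a2 - eps *: b2).
Proof.
rewrite [eps *: (_ + _)]scalerDr opprD addrACA scalerDr; congr (_ + _).
by rewrite !scalerBr !scalerA; congr (_ *: _ - _ *: _); ring.
Qed.

(** For monomials this is [borcherds_AV], for any bound [W] larger than all the
    weights involved; the phase is an integral power of -1 because [n] lies in
    [- h r s + Z]. *)
Lemma act_borcherds c mu (dl : int) r s t a b u (m k n : C) :
  c = h * mu + dl%:~R -> charge r a -> charge s b -> charge t u ->
  (exists i : int, n = i%:~R - h * r%:~R * s%:~R) ->
  (exists i : int, m = i%:~R - h * r%:~R * (mu + t%:~R)) ->
  (exists i : int, k = i%:~R - h * s%:~R * (mu + t%:~R)) ->
  fsum_eq
    (fun j => ((-1) ^+ j * cbinom n j) *: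
      (act c a (m + n - j%:R) (act c b (k + j%:R) u)
       - (expipi (h * r%:~R * s%:~R) * expipi n) *:
         act c b (n + k - j%:R) (act c a (m + j%:R) u)))
    (fun j => cbinom m j *: act c (act 0 a (n + j%:R) b) (m + k - j%:R) u).
Proof.
move=> cE ha hb hu [i_n nE] [i_m mE] [i_k kE].
have -> : expipi (h * r%:~R * s%:~R) * expipi n = (-1) ^ i_n.
  by rewrite -expipiD nE addrC subrK expipi_int.
set eps := (-1) ^ i_n.
move: a ha; apply: charge_ind => [|l lr].
  split; first by apply: fsum_eq0 => j; rewrite !(act0l, linear0, scaler0, subr0).
  move=> x a a' e e'; apply: fsum_eq_lin e e' _ _ => j.
    by rewrite !act_linear_l (act_linear c b) scaler_rearrange.
  by rewrite !act_linear_l scalerDr !scalerA [x * _]mulrC.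
move: b hb; apply: charge_ind => [|l' lr'].
  split; first by apply: fsum_eq0 => j; rewrite !(act0l, linear0, scaler0, subr0).
  move=> x a a' e e'; apply: fsum_eq_lin e e' _ _ => j.
    by rewrite !act_linear_l (act_linear c (ys l)) scaler_rearrange.
  by rewrite (act_linear 0) act_linear_l scalerDr !scalerA [x * _]mulrC.
move: u hu; apply: charge_ind => [|l'' lr''].
  split; first by apply: fsum_eq0 => j; rewrite !(act0l, linear0, scaler0, subr0).
  move=> x a a' e e'; apply: fsum_eq_lin e e' _ _ => j.
    by rewrite !(act_linear c) scaler_rearrange.
  by rewrite (act_linear c) scalerDr !scalerA [x * _]mulrC.
rewrite -lr -lr' -lr'' -!pmulrn in nE mE kE.
set wa := (sumn l)%:Z; set wb := (sumn l')%:Z; set wu := (sumn l'')%:Z.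
pose M := wa + wu - 1 - i_m - (size l)%:Z * dl.
pose K := wb + wu - 1 - i_k - (size l')%:Z * dl.
pose N := wa + wb - 1 - i_n.
pose w := M + K + N + 1 - wa - wb - wu.
exists (`|M| + `|K| + `|N| + `|w| + sumn l + sumn l' + sumn l'').+1 => W WW.
have ha := hom_ys R l; have hb := hom_ys R l'; have hu := hom_ys R l''.
set al := c + h * (size l'')%:R.
have hmu : h * mu = c - dl%:~R by rewrite cE addrK.
have := @borcherds_AV R h W al l _ wb _ _ wu _ M K N w n m i_n hb hu.
move=> /(_ _ _ _ _ _ _ _ _ _ _ _) B.
have {}B : res_xy h W al (size l') (ys l) (ys l') (ys l'') n K w -
  (-1) ^ i_n *: res_yx h W al (size l) (ys l) (ys l') (ys l'') n M w =
  res_iter h W al (size l') (ys l) (ys l') (ys l'') m N w.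
  apply: B; try lia.
  - by rewrite nE; ring.
  - rewrite mE mulrDr [h * _ * mu]mulrAC hmu /M !(rmorphB, rmorphD, rmorphM) /= -!pmulrn.
    by rewrite /al; ring.
transitivity (res_xy h W al (size l') (ys l) (ys l') (ys l'') n K w -
  (-1) ^ i_n *: res_yx h W al (size l) (ys l) (ys l') (ys l'') n M w).
  rewrite scaler_sumr -sumrB; apply: eq_bigr => j _.
  rewrite scalerBr [_ *: (eps *: _)]scalerA [_ * eps]mulrC -[(eps * _) *: _]scalerA.
  congr (_ *: _ - _ *: (_ *: _)).
  - rewrite (act_eq (W := W) (w := K - j%:Z) hb hu); try lia.
      rewrite (act_eq (W := W) (w := w) ha (hom_AV h W al (K - j%:Z) hb hu)); try lia.
        by congr (AV _ _ _ _ _ _); rewrite natrD /al; ring.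
      rewrite mE nE mulrDr [h * _ * mu]mulrAC hmu /w /M /N natrD.
      by rewrite !(rmorphB, rmorphD, rmorphM) /= -!pmulrn; ring.
    rewrite kE mulrDr [h * _ * mu]mulrAC hmu /K !(rmorphB, rmorphD, rmorphM) /= -!pmulrn.
    by ring.
  - rewrite (act_eq (W := W) (w := M - j%:Z) ha hu); try lia.
      rewrite (act_eq (W := W) (w := w) hb (hom_AV h W al (M - j%:Z) ha hu)); try lia.
        by congr (AV _ _ _ _ _ _); rewrite natrD /al; ring.
      rewrite kE nE mulrDr [h * _ * mu]mulrAC hmu /w /K /N natrD.
      by rewrite !(rmorphB, rmorphD, rmorphM) /= -!pmulrn; ring.
    rewrite mE mulrDr [h * _ * mu]mulrAC hmu /M !(rmorphB, rmorphD, rmorphM) /= -!pmulrn.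
    by ring.
rewrite B; apply: eq_bigr => j _; congr (_ *: _).
rewrite [X in act c X](act_eq (W := W) (w := N - j%:Z) ha hb); try lia.
  rewrite add0r (act_eq (W := W) (w := w) (hom_AV h W _ (N - j%:Z) ha hb) hu) //; try lia.
  rewrite mE kE !mulrDr ![h * _ * mu]mulrAC !hmu /w /M /K natrD.
  by rewrite !(rmorphB, rmorphD, rmorphM) /= -!pmulrn; ring.
by rewrite nE add0r /N !(rmorphB, rmorphD, rmorphM) /= -!pmulrn; ring.
Qed.

End Action.

Section GammaAddition.
Variable R : realType.
Local Notation C := (R[i]).
Implicit Type h : C.

(** [Gamma_h] is a one-parameter group in [h], because [(1 - w/z)^h] is. *)
Lemma G_add_sum (U : lmodType C) (W : nat) (h h' : C) (phi : nat -> {linear fock R -> U})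
    s (wv : int) v : hom s wv v -> wv < W%:Z ->
  \sum_(i < W) \sum_(k < W) phi (i + k)%N (G h i (G h' k v)) =
  \sum_(D < W) phi D (G (h + h') D v).
Proof.
move=> hv wW; move: v hv; apply: hom_ind => [|l].
  apply: linear_eq_subspace => c u v; rewrite scaler_sumr -big_split; apply: eq_bigr => i _ /=.
    rewrite scaler_sumr -big_split; apply: eq_bigr => k _ /=.
    by rewrite (linearP (G h' k)) (linearP (G h i)) (linearP (phi _)).
  by rewrite (linearP (G _ i)) (linearP (phi _)).
elim: l s wv wW phi => [|q l IH] s wv wW phi _ wE.
  have W0 : (0 < W)%N by move: wW; rewrite -wE /=; lia.
  rewrite (@sum_only0 _ W (fun i => \sum_(k < W) phi (i + k)%N (G h i (G h' k (ys R [::]))))) //.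
    rewrite (@sum_only0 _ W (fun k => phi (0 + k)%N (G h 0 (G h' k (ys R [::]))))) //.
      rewrite (@sum_only0 _ W (fun k => phi k (G (h + h') k (ys R [::])))) ?G_0 //.
      by case=> // k _; rewrite G_one linear0.
    by case=> // k _; rewrite G_one !linear0.
  case=> // i _; rewrite big1 // => -[[|k] kW] _ /=.
    by rewrite G_0 G_one linear0.
  by rewrite [G h' _ _]G_one !linear0.
have lW : (sumn l)%:Z < W%:Z by move: wW; rewrite -wE /=; lia.
have qW : q%:Z + (sumn l)%:Z < W%:Z by move: wW; rewrite -wE /=; lia.
set v := ys R l; have hv : hom (size l) (sumn l) v by exact: hom_ys.
rewrite -y_ys -/v (G_y_sum _ phi hv) //.
transitivity (\sum_(i < W) \sum_(j' < W) \sum_(k < W) ((-1) ^+ j' * cbinom h' j') *: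
    phi (i + (k + j'))%N (G h i (y (q%:Z - j'%:Z) (G h' k v)))).
  apply: eq_bigr => i _.
  pose phi' k : {linear fock R -> U} := phi (i + k)%N \o G h i.
  rewrite -[LHS]/(\sum_(k < W) phi' k (G h' k (y q v))) (G_y_sum _ phi' hv) //.
transitivity (\sum_(j' < W) \sum_(j < W) ((-1) ^+ (j + j') * (cbinom h' j' * cbinom h j)) *:
    \sum_(D < W) phi (D + (j + j'))%N (y (q%:Z - (j + j')%N%:Z) (G (h + h') D v))).
  rewrite exchange_big /=; apply: eq_bigr => j' _.
  transitivity (\sum_(k < W) \sum_(j < W) \sum_(i < W)
    (((-1) ^+ j' * cbinom h' j') * ((-1) ^+ j * cbinom h j)) *:
      phi (i + k + (j + j'))%N (y (q%:Z - (j + j')%N%:Z) (G h i (G h' k v)))).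
    rewrite exchange_big /=; apply: eq_bigr => k _; rewrite -scaler_sumr.
    pose phi' i := phi (i + (k + j'))%N.
    rewrite -[X in _ *: X]/(\sum_(i < W) phi' i (G h i (y (q%:Z - j'%:Z) (G h' k v)))).
    rewrite (G_y_sum _ phi' (hom_G h' k hv)) //; last by lia.
    rewrite scaler_sumr; apply: eq_bigr => j _; rewrite scaler_sumr; apply: eq_bigr => i _.
    rewrite scalerA /phi'; congr (_ *: phi _ (y _ _)); last by lia.
    by lia.
  rewrite exchange_big /=; apply: eq_bigr => j _.
  pose psi D : {linear fock R -> U} := phi (D + (j + j'))%N \o y (q%:Z - (j + j')%N%:Z).
  have := IH _ _ lW psi erefl erefl; rewrite -/v => <-.
  rewrite exchange_big scaler_sumr; apply: eq_bigr => i _ /=.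
  rewrite scaler_sumr; apply: eq_bigr => k _.
  by congr (_ *: _); rewrite exprD; ring.
pose X J := (-1) ^+ J *: \sum_(D < W) phi (D + J)%N (y (q%:Z - J%:Z) (G (h + h') D v)).
have X0 J : (W <= J)%N -> X J = 0.
  by move=> WJ; rewrite /X big1 ?scaler0 // => D _; rewrite y_neg ?linear0 //; lia.
transitivity (\sum_(j' < W) \sum_(j < W) (cbinom h' j' * cbinom h j) *: X (j + j')%N).
  apply: eq_bigr => j' _; apply: eq_bigr => j _.
  by rewrite /X scalerA; congr (_ *: _); ring.
rewrite (@antidiag _ _ _ (fun j j' => cbinom h' j * cbinom h j')) //.
apply: eq_bigr => J _; rewrite cbinom_add /X scalerA -scaler_sumr.
congr (_ *: _); rewrite mulrC; congr (_ * _); apply: eq_bigr => i _.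
by rewrite mulrC.
Qed.

Lemma G_zero D v : G (0 : C) D v = if D == 0%N then v else 0.
Proof.
move: v D; apply: fock_ind => [|l D].
  split=> [D|c u v Hu Hv D]; first by rewrite linear0; case: eqP.
  by rewrite linearP /= Hu Hv; case: eqP => //; rewrite scaler0 addr0.
elim: l D => [|q l IH] D; first by rewrite G_one.
rewrite -y_ys G_y big_ord_recl big1 => [|j _].
  by rewrite cbinom0 mul1r scale1r addr0 subr0 subn0 IH; case: eqP; rewrite ?linear0.
by rewrite lift0 cbinom0S mulr0 scale0r.
Qed.

End GammaAddition.

Section Model.
Variables (R : realType) (h : R[i]).
Local Notation C := (R[i]).
Local Notation fock := (fock R).
Local Notation ys := (ys R).
Implicit Types (a b u v : fock) (c mu : C).

(** Gamma fixes 1, and the coefficient of [y_q] in the derivative of order [n] of X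
    is [C(q, n) z^(q - n)]: there is no negative power of [z], and at [z = 0] only
    [y_n] is left. *)
Lemma AV_vac W l (w : int) : (sumn l < W)%N -> w <= sumn l ->
  AV h W 0 (ys l) w (ys [::]) = if w == sumn l then ys l else 0.
Proof.
rewrite AV_ys => lW; elim: l w lW => [|n l IH] w lW wl /=.
  by rewrite wproj_one.
have W0 : (0 < W)%N by move: lW => /=; lia.
have nW : (n < W)%N by move: lW => /=; lia.
have lW' : (sumn l < W)%N by move: lW => /=; lia.
rewrite (@sum_only0 _ W (fun d => \sum_(q < W) cbinom (0 + q%:R - d%:R) n *:
   y q%:Z (AVs h W 0 l (w - q%:Z) (G h d (ys [::]))))) //; last first.
  case=> // d _; rewrite big1 // => q _; rewrite G_one.
  by rewrite (lin0 (AVs_linear h W 0 l (w - q%:Z))) linear0 scaler0.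
rewrite G_0 (bigD1 (Ordinal nW)) //= big1 ?addr0.
  rewrite add0r subr0 cbinom_nat binn scale1r IH //; last by move: wl => /=; lia.
  have -> : (w - n%:Z == sumn l) = (w == (n + sumn l)%N) by lia.
  by case: eqP; rewrite ?linear0 // y_ys.
move=> q qn; rewrite add0r subr0 cbinom_nat.
have [lqn|lnq] := ltnP q n; first by rewrite bin_small ?scale0r.
have {}lnq : (n < q)%N.
  by rewrite ltn_neqAle lnq andbT; apply: contra qn => /eqP e; apply/eqP/val_inj.
rewrite IH //; last by move: wl => /=; lia.
by case: eqP => [e|_]; [move: wl => /=; lia|rewrite linear0 scaler0].
Qed.

Lemma act_field c mu (dl r t : int) a u : c = h * mu + dl%:~R ->
  charge r a -> charge t u ->
  exists N : int, forall n, act h c a n u <> 0 ->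
    exists2 l : int, l < N & n = l%:~R - h * r%:~R * (mu + t%:~R).
Proof.
move=> cE ha hu.
have comb (f g F : C -> fock) k : (forall n, F n = k *: f n + g n) ->
    (exists N : int, forall n, f n <> 0 ->
    exists2 l : int, l < N & n = l%:~R - h * r%:~R * (mu + t%:~R)) ->
    (exists N : int, forall n, g n <> 0 ->
    exists2 l : int, l < N & n = l%:~R - h * r%:~R * (mu + t%:~R)) ->
    exists N : int, forall n, F n <> 0 ->
    exists2 l : int, l < N & n = l%:~R - h * r%:~R * (mu + t%:~R).
  move=> FE [N1 H1] [N2 H2]; exists (`|N1| + `|N2|) => n Fn.
  have [f0|/eqP f0] := eqVneq (f n) 0.
    have [|l lN lE] := H2 n; last by exists l => //; lia.
    by move=> g0; apply: Fn; rewrite FE f0 g0 scaler0 addr0.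
  by have [l lN lE] := H1 n f0; exists l => //; lia.
move: a ha; apply: charge_ind => [|l lr].
  split; first by exists 0 => n; rewrite act0l.
  by move=> k a a'; apply: (comb _ _ _ k) => n; rewrite act_linear_l.
move: u hu; apply: charge_ind => [|m mt].
  split; first by exists 0 => n; rewrite linear0.
  by move=> k a a'; apply: (comb _ _ _ k) => n; rewrite act_linear.
exists ((sumn l)%:Z + (sumn m)%:Z - r * dl) => n.
rewrite act_ys /act_basis; case: pselect => // e.
case: cid => w /= wE; have [w0|w0] := ltP w 0; first by rewrite -AV_ys AV_neg.
move=> _; exists ((sumn l)%:Z + (sumn m)%:Z - 1 - w - r * dl); first by lia.
move: wE; rewrite -lr -mt -!pmulrn cE => wE.
rewrite !(rmorphB, rmorphD, rmorphM) /= -!pmulrn -wE; ring.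
Qed.

Lemma act_one c n u : act h c (ys [::]) n u = if n == -1 then u else 0.
Proof.
move: u; apply: fock_eq => [||m]; first exact: act_linear.
  by case: eqP => _ k u v //; rewrite scaler0 addr0.
rewrite act_ys /act_basis /= add0r mul0r subr0.
case: pselect => [e|ne]; last first.
  by case: eqP => // n1; case: ne; exists (sumn m); rewrite n1 -pmulrn; ring.
case: cid => w /= wE; rewrite (wproj_hom _ (hom_ys R m)).
have -> : n = (sumn m)%:R - 1 - w%:~R by rewrite -wE; ring.
rewrite [X in _ = if X then _ else _](_ : _ = ((sumn m)%:Z == w)) //.
rewrite -[RHS](eqr_int C) -subr_eq0 -[RHS]subr_eq0; congr (_ == 0).
by rewrite -pmulrn; ring.
Qed.

Lemma act_rep c mu (dl : int) : c = h * mu + dl%:~R ->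
  field_rep h (@charge R) (ys [::]) (act h 0) (@charge R) mu (act h c).
Proof.
move=> cE; split.
- exact: charge_grading.
- by move=> n u; exact: act_linear_l.
- exact: act_linear.
- by move=> r t a n u ha hu; have := act_charge h c n ha hu.
- by move=> r t a u ha hu; have := act_field cE ha hu.
- exact: act_one.
- by move=> r s t a b u m k n ha hb hu; have := act_borcherds cE ha hb hu; apply.
Qed.

Lemma act_creation a : act h 0 a (-1) (ys [::]) = a.
Proof.
move: a; apply: fock_eq => [|//|l]; first exact: act_linear_l.
rewrite (act_eq (W := (sumn l).+1) (w := sumn l) (hom_ys R l) (hom_ys R [::])) //.
- by rewrite /= !(mulr0n, mulr0, addr0) AV_vac // eqxx.
- by rewrite /= !(mulr0n, mulr0, addr0, subr0) addrAC subrr add0r rmorphN.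
- lia.
Qed.

Lemma act_regular a (n : nat) : act h 0 a n%:R (ys [::]) = 0.
Proof.
move: a; apply: fock_eq => [|c u v|l]; first exact: act_linear_l.
  by rewrite scaler0 addr0.
pose w : int := (sumn l)%:Z - 1 - n%:Z.
rewrite (act_eq (W := (sumn l).+1) (w := w) (hom_ys R l) (hom_ys R [::])) //.
- rewrite /= !(mulr0n, mulr0, addr0) AV_vac //; last by rewrite /w; lia.
  by case: eqP => //; rewrite /w; lia.
- by rewrite /= !(mulr0n, mulr0, addr0, subr0) pmulrn; congr (_%:~R); rewrite /w; lia.
- by rewrite /w; lia.
Qed.

Lemma act_vertex : field_rep h (@charge R) (ys [::]) (act h 0) (@charge R) 0 (act h 0).
Proof. by apply: (act_rep (dl := 0)); rewrite mulr0 addr0. Qed.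

Definition model : gva h :=
  @Gva R h fock (@charge R) (ys [::]) (act h 0) act_vertex
    (@charge_ys R [::]) act_creation act_regular.

(** The field of the generator is [z^(c + h s) X(z) Gamma_h(z)] on charge [s]. *)
Lemma act_x c s (wb : int) b (e : int) W : hom s wb b -> wb < W%:Z ->
  act h c (ys [:: 0%N]) (- 1 - e%:~R - (c + h * s%:R)) b =
  \sum_(d < W) y (e + d%:Z) (G h d b).
Proof.
move=> hb wbW.
have [W' eW WW] : exists2 W' : nat, (`|e| + `|wb| < W')%N & (W <= W')%N.
  by exists (`|e| + `|wb| + W).+1; lia.
rewrite (act_eq (W := W') (wa := 0) (w := wb + e) (hom_ys R [:: 0%N]) hb) /=; first last.
- lia.
- lia.
- by rewrite !(rmorphB, rmorphD) /=; ring.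
rewrite AV_ys /= -(@sum_ord_bound _ (fun d => y (e + d%:Z) (G h d b)) W W').
- apply: eq_bigr => d _; have [ed|ed] := ltP (e + d%:Z) 0.
    rewrite y_neg // big1 // => q _; rewrite (wproj_hom _ (hom_G h d hb)).
    by case: eqP => [E|_]; [lia|rewrite linear0 scaler0].
  have [dwb|wbd] := lerP d%:Z wb; last first.
    rewrite (G_big h hb) // linear0 big1 // => q _.
    by rewrite !linear0 ?scaler0.
  have qW : (`|(e + d%:Z)%R| < W')%N by lia.
  rewrite (bigD1 (Ordinal qW)) //= big1 ?addr0.
    rewrite cbinom0 scale1r (wproj_hom _ (hom_G h d hb)) gez0_abs //.
    by case: eqP => // E; lia.
  move=> q qe; rewrite (wproj_hom _ (hom_G h d hb)).
  case: eqP => [E|_]; last by rewrite linear0 scaler0.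
  by case/negP: qe; apply/eqP/val_inj => /=; lia.
- exact: WW.
- by move=> d Wd; rewrite (G_big h hb) ?linear0 //; lia.
Qed.

Lemma act_x_zero c s (wb : int) b n : hom s wb b ->
  (forall e : int, n <> - 1 - e%:~R - (c + h * s%:R)) ->
  act h c (ys [:: 0%N]) n b = 0.
Proof.
move=> hb nE; apply: (act_zero (wa := 0) (hom_ys R [:: 0%N]) hb) => w _ n1.
by apply: (nE (w - wb)); rewrite n1 !(rmorphB, rmorphD) /=; ring.
Qed.

(** Conversely X is recovered by composing with [Gamma_(-h)], the inverse of
    [Gamma_h]. *)
Lemma y_act_x c s (wb : int) b (e : int) W : hom s wb b -> wb < W%:Z ->
  \sum_(d < W) act h c (ys [:: 0%N]) (- 1 - (e + d%:Z)%:~R - (c + h * s%:R))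
    (G (- h) d b) = y e b.
Proof.
move=> hb wbW.
have [wb0|wb0] := ltP wb 0.
  by move: hb => /(hom_neg wb0) ->; rewrite linear0 big1 // => d _; rewrite !linear0.
transitivity (\sum_(i < W) \sum_(k < W) y (e + (i + k)%N%:Z) (G h i (G (- h) k b))).
  rewrite exchange_big; apply: eq_bigr => d _.
  rewrite (act_x _ _ (W := W) (hom_G (- h) d hb)); last by lia.
  by apply: eq_bigr => d' _; congr (y _ _); lia.
pose phi D : {linear fock -> fock} := y (e + D%:Z).
rewrite (G_add_sum _ _ phi hb wbW) subrr.
rewrite (@sum_only0 _ W (fun D => phi D (G 0 D b))).
- by rewrite G_zero /phi addr0.
- lia.
- by case=> // D _; rewrite G_zero linear0.
Qed.

End Model.

(** * Generation and locality in arbitrary modules *)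

Section Generation.
Variable R : realType.
Local Notation C := (R[i]).

Lemma grading_ind (U : lmodType C) (I : eqType) (D : I -> U -> Prop)
    (P : U -> Prop) : is_grading D -> is_subspace P ->
  (forall i u, D i u -> P u) -> forall u, P u.
Proof.
move=> [_ dD _] sP DP u; have [s [F [DF ->]]] := dD u.
by apply: (subspace_sum _ sP) => i; apply: DP (DF i).
Qed.

Section Vertex.
Variables (h : C) (V : gva h).
Local Notation mulV := (@gva_mul R h V).
Local Notation oneV := (gva_one V).

Section Rep.
Variables (U : lmodType C) (gU : int -> U -> Prop) (mu : C).
Variable act : V -> C -> U -> U.
Hypothesis rU : field_rep h (@gva_deg R h V) oneV mulV gU mu act.

Lemma rep_act0r a n : act a n 0 = 0.
Proof. exact/lin0/(rep_linear_r rU). Qed.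

Lemma rep_act0l n u : act 0 n u = 0.
Proof. exact: (lin0 (rep_linear_l rU n u)). Qed.

Lemma rep_nonexp r a t u n : gva_deg r a -> gU t u ->
  (forall l : int, n <> l%:~R - h * r%:~R * (mu + t%:~R)) -> act a n u = 0.
Proof.
move=> ra tu nE; have [N HN] := rep_field rU ra tu.
by apply/eqP/negPn/negP => /eqP /HN [l _ /nE].
Qed.

(** Borcherds' identity expresses a mode of [a(n)b], up to modes of the
    [a(n + j)b] with [j > 0], by modes of [a] and [b]; the [a(n)b] vanish for
    large [n]. *)
Lemma product_stable (S : U -> Prop) r s a b n : is_subspace S ->
  (forall A : U -> Prop, is_subspace A ->
     (forall t u, gU t u -> S u -> A u) -> forall u, S u -> A u) ->
  gva_deg r a -> gva_deg s b ->
  (forall k u, S u -> S (act a k u)) -> (forall k u, S u -> S (act b k u)) ->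
  forall k u, S u -> S (act (mulV a n b) k u).
Proof.
move=> sS hS ra sb Sa Sb.
have zero c : c = 0 -> forall k u, S u -> S (act c k u).
  by move=> -> k u _; rewrite rep_act0l; case: sS.
have [[i ->]|nE] := pselect (exists i : int, n = i%:~R - h * r%:~R * s%:~R); last first.
  apply: zero; have rV := gva_rep V; have [N HN] := rep_field rV ra sb.
  apply/eqP/negPn/negP => /eqP /HN [l _]; rewrite add0r => e.
  by apply: nE; exists l.
have [N HN] := rep_field (gva_rep V) ra sb.
have [d dE] : exists d : nat, N - i <= d%:Z by exists `|N - i|%N; lia.
elim: d i dE => [|d IH] i dE.
  apply: zero; apply/eqP/negPn/negP => /eqP /HN [l lN]; rewrite add0r => /addIr /intr_inj.
  lia.
move=> k u; move: u; apply: hS => [|t u tu Su].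
  exact: lin_preim (rep_linear_r rU _ k) sS.
have [[l kE]|kE] := pselect (exists l : int, k = l%:~R - h * (r + s)%:~R * (mu + t%:~R)); last first.
  rewrite (@rep_nonexp (r + s) _ t); first by case: sS.
  - exact: rep_degree (gva_rep V) _ _ _ _ _ ra sb.
  - by [].
  - by move=> l e; apply: kE; exists l.
set n0 := i%:~R - _; pose m := 0%:~R - h * r%:~R * (mu + t%:~R).
have B := @rep_borcherds _ _ _ _ _ _ _ _ _ _ rU r s t a b u m (k - m) n0 ra sb tu.
have [|||K K1 e] := fsum_eq_at 1 (B _ _ _).
- by exists i.
- by exists 0.
- exists l; rewrite kE /m rmorphD /=; ring.
case: K K1 e => // K _; rewrite [X in _ = X]big_ord_recl cbinom0 scale1r /=.
rewrite addr0 subr0 [m + (k - m)]addrC subrK => /esym/(canRL (addrK _)) ->.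
have SZ (z : C) v : S v -> S (z *: v) by exact: (subspaceZ z sS).
have SD v v' : S v -> S v' -> S (v + v') by exact: (subspaceD sS).
rewrite -[X in _ - X]scale1r -scaleNr; apply SD.
  apply: (subspace_sum _ sS) => j; apply SZ.
  rewrite -scaleNr; apply SD; first by apply: Sa; apply: Sb.
  by apply SZ; apply: Sb; apply: Sa.
apply SZ; apply: (subspace_sum _ sS) => j; apply SZ.
rewrite /bump leq0n add1n (_ : n0 + _ = (i + j.+1%:Z)%:~R - h * r%:~R * s%:~R).
  by apply: IH => //; lia.
by rewrite /n0 rmorphD /= -pmulrn; ring.
Qed.

(** A subspace spanned by homogeneous vectors and stable under the modes of a
    generator is a submodule. *)
Lemma generator_stable (x : V) (H : U -> Prop) : gva_deg 1 x -> gva_generated x ->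
  (forall u, H u -> exists t, gU t u) ->
  (forall n u, H u -> span_set H (act x n u)) ->
  forall b n u, span_set H u -> span_set H (act b n u).
Proof.
move=> x1 xgen Hhom Hx b.
have sS := span_is_subspace H; set S := span_set H in sS *.
have hS (A : U -> Prop) : is_subspace A ->
    (forall t u, gU t u -> S u -> A u) -> forall u, S u -> A u.
  move=> sA hA u; apply=> // v Hv; have [t tv] := Hhom v Hv.
  by apply: (hA t) => // B _; apply.
pose good a := (exists r, gva_deg r a) /\ (forall n u, S u -> S (act a n u)).
suff : span_set good b.
  move=> /(_ (fun a => forall n u, S u -> S (act a n u))); apply; last by move=> a [].
  split=> [n u _|c a a' Sa Sa' n u Su]; first by rewrite rep_act0l; case: sS.
  by rewrite (rep_linear_l rU); apply: sS.2; [apply: Sa|apply: Sa'].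
have sG := span_is_subspace good.
apply: xgen b => // [A _|A _|a n b Ga Gb].
- apply; split=> [|n u Su]; first by exists 0; apply: gva_deg_one.
  by rewrite (rep_one rU); case: eqP => // _; case: sS.
- apply; split=> [|n u Su]; first by exists 1.
  move: u Su => u /(_ (fun u => S (act x n u))); apply.
    exact: lin_preim (rep_linear_r rU x n) sS.
  by move=> v; apply: Hx.
- apply: (Ga (fun a => span_set good (mulV a n b))).
    exact: lin_preim (rep_linear_l (gva_rep V) n b) sG.
  move=> a' [[r ra] Sa]; apply: (Gb (fun b => span_set good (mulV a' n b))).
    exact: lin_preim (rep_linear_r (gva_rep V) a' n) sG.
  move=> b' [[s sb] Sb] A _; apply; split.
    by exists (r + s); apply: rep_degree (gva_rep V) _ _ _ _ _ ra sb.
  exact: (product_stable n sS hS ra sb Sa Sb).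
Qed.

Definition local_field (f : C -> U -> U) := forall (m n : C) (u : U),
    fsum_eq
      (fun j => ((-1) ^+ j * cbinom (- h) j) *: f (m - h - j%:R) (f (n + j%:R) u))
      (fun j => ((-1) ^+ j * cbinom (- h) j) *: f (n - h - j%:R) (f (m + j%:R) u)).

(** When all the products [x(n - h)x] with [n >= 0] vanish, the right-hand side
    of Borcherds' identity for [x], [x] and the exponent [- h] vanishes, and
    what remains is locality. *)
Lemma regular_local (x : V) : gva_deg 1 x ->
  (forall n : nat, mulV x (n%:R - h) x = 0) -> local_field (act x).
Proof.
move=> x1 xreg m n; have lx := rep_linear_r rU x.
apply: (grading_ind (rep_grading rU)).
  split; first by apply: fsum_eq0 => j; rewrite !rep_act0r scaler0.
  move=> c u v e e'; apply: (fsum_eq_lin (k := c) e e') => j;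
    by rewrite /= !lx scalerDr !scalerA [c * _]mulrC.
move=> t u tu.
have coset k l : (exists i : int, k = i%:~R - h * 1%:~R * (mu + t%:~R)) \/
    ((forall j : nat, act x (k + j%:R) u = 0) /\
     (forall j : nat, act x (k - h - j%:R) (act x l u) = 0)).
  have [|nE] := pselect (exists i : int, k = i%:~R - h * 1%:~R * (mu + t%:~R)).
    by left.
  right; split=> j.
    apply: (rep_nonexp x1 tu) => i e; apply: nE; exists (i - j%:Z).
    by rewrite rmorphB /= -pmulrn -[k](addrK j%:R) e; ring.
  apply: (rep_nonexp x1 (rep_degree rU l x1 tu)) => i e; apply: nE; exists (i + j%:Z).
  have -> : k = k - h - j%:R + h + j%:R by ring.
  by rewrite e !rmorphD /= -pmulrn; ring.
have cosets k : (exists i : int, k = i%:~R - h * 1%:~R * (mu + t%:~R)) \/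
    ((forall j : nat, act x (k + j%:R) u = 0) /\
     (forall l (j : nat), act x (k - h - j%:R) (act x l u) = 0)).
  have [|nE] := pselect (exists i : int, k = i%:~R - h * 1%:~R * (mu + t%:~R)).
    by left.
  by right; split=> [j|l j]; [case: (coset k 0) => [//|[]]|case: (coset k l) => [//|[]]].
have [mE|[m1 m2]] := cosets m; last first.
  by apply: fsum_eq0 => j; [rewrite m2 scaler0|rewrite m1 rep_act0r scaler0].
have [nE|[n1 n2]] := cosets n; last first.
  by apply: fsum_eq0 => j; [rewrite n1 rep_act0r scaler0|rewrite n2 scaler0].
have := @rep_borcherds _ _ _ _ _ _ _ _ _ _ rU 1 1 t x x u m n (- h) x1 x1 tu _ mE nE.
case; first by exists 0; rewrite mulr1 mulr1 add0r.
move=> K0 e; exists K0 => K /e.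
rewrite [RHS]big1 => [|j _]; last by rewrite [- h + _]addrC xreg rep_act0l scaler0.
rewrite !mulr1 -expipiD subrr expipi0 => E.
apply/eqP; rewrite -subr_eq0 -sumrB; apply/eqP; rewrite -[RHS]E.
apply: eq_bigr => j _; rewrite scale1r -scalerBr.
by rewrite [- h + n]addrC.
Qed.

End Rep.

(** Locality of the two fields, applied to the vacuum vector. *)
Lemma cyclic_regular (x : V) : gva_cyclic x -> forall n : nat, mulV x (n%:R - h) x = 0.
Proof.
move=> [_ loc _] n.
have [K K1 e] := fsum_eq_at 1 (loc n%:R (-1) oneV).
have r0 := rep_act0r (gva_rep V).
move: e; rewrite [RHS]big1 => [|j _]; last by rewrite -natrD gva_regular r0 scaler0.
case: K K1 => // K _; rewrite big_ord_recl big1 => [|j _].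
  by rewrite addr0 cbinom0 !mul1r scale1r addr0 gva_creation subr0.
have -> : -1 + (fintype.lift ord0 j)%:R = j%:R :> C.
  by rewrite /= /bump leq0n natrD addKr.
by rewrite gva_regular r0 scaler0.
Qed.

End Vertex.
End Generation.

Section Monomials.
Variables (R : realType) (h : R[i]).
Local Notation C := (R[i]).

Lemma monomial_deg (V : gva h) (mu : C) (N : gmod V mu) (x : V) ns (v : N) :
  gva_deg 1 x -> gmod_deg 0 v -> gmod_deg (size ns) (monomial x ns v).
Proof.
move=> x1 v0; elim: ns => //= n ns IH.
by rewrite -add1n PoszD; apply: (rep_degree (gmod_rep N)).
Qed.

(** The span of the monomials is stable under the modes of [x], hence under all
    the modes. *)
Lemma monomial_span (V : gva h) (mu : C) (N : gmod V mu) (x : V) (v : N) :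
  gva_cyclic x -> gmod_deg 0 v -> gmod_generated v ->
  forall u, span_set (fun u => exists ns, u = monomial x ns v) u.
Proof.
move=> [x1 _ xgen] v0 vgen.
set H := fun u => _; have sH := span_is_subspace H.
apply: vgen => // [|b n u Hu]; first by move=> A _; apply; exists [::].
apply: (generator_stable (gmod_rep N) x1 xgen) Hu => [w [ns ->]|k w [ns ->]].
  by exists (size ns); apply: monomial_deg.
by move=> A _; apply; exists (- k :: ns); rewrite /= opprK.
Qed.

End Monomials.

(** * Maps defined by a local field and a vacuum vector *)

Section FreeField.
Variables (R : realType) (h c : R[i]).
Local Notation C := (R[i]).
Variables (U : lmodType C) (f : C -> U -> U) (w : U).
Hypothesis lf : forall n, linear (f n).
Hypothesis f_local : local_field h f.
Hypothesis f_vac : forall e : int, e < 0 -> f (- 1 - e%:~R - c) w = 0.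
Local Notation fock := (fock R).
Local Notation ys := (ys R).
Local Notation Gi := (G (- h)).

(** The coefficient of [z^(c + h n + e)] in the field [f], acting in charge [n]. *)
Definition xmode (n : nat) (e : int) (u : U) : U :=
  f (- 1 - e%:~R - (c + h * n%:R)) u.

Lemma xmode_linear n e : linear (xmode n e). Proof. exact: lf. Qed.

HB.instance Definition _ n e :=
  GRing.isLinear.Build C U U *:%R (xmode n e) (xmode_linear n e).

Lemma xmode_comm n E E' u : fsum_eq
  (fun j => ((-1) ^+ j * cbinom (- h) j) *: xmode n.+1 (E + j%:Z) (xmode n (E' - j%:Z) u))
  (fun j => ((-1) ^+ j * cbinom (- h) j) *: xmode n.+1 (E' + j%:Z) (xmode n (E - j%:Z) u)).
Proof.
have [K0 e] := f_local (- 1 - E%:~R - (c + h * n%:R)) (- 1 - E'%:~R - (c + h * n%:R)) u.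
have E1 (A : int) (j : nat) : - 1 - (A + j%:Z)%:~R - (c + h * n.+1%:R) =
    - 1 - A%:~R - (c + h * n%:R) - h - j%:R :> C.
  by rewrite rmorphD /= -pmulrn -natr1; ring.
have E2 (A : int) (j : nat) : - 1 - (A - j%:Z)%:~R - (c + h * n%:R) =
    - 1 - A%:~R - (c + h * n%:R) + j%:R :> C.
  by rewrite rmorphB /= -pmulrn; ring.
exists K0 => K /e eK; rewrite /xmode.
under eq_bigr do rewrite E1 E2; under [RHS]eq_bigr do rewrite E1 E2.
exact: eK.
Qed.

Lemma fsum_eq_sum (I : Type) (r : seq I) (F F' : I -> nat -> U) :
  (forall i, fsum_eq (F i) (F' i)) ->
  fsum_eq (fun j => \sum_(i <- r) F i j) (fun j => \sum_(i <- r) F' i j).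
Proof.
move=> e; elim: r => [|i r [K1 e1]]; first by exists 0%N => K _; rewrite !big1 // => j _; rewrite !big_nil.
have [K2 e2] := e i; exists (maxn K1 K2) => K; rewrite geq_max => /andP[/e1 {}e1 /e2 {}e2].
under eq_bigr do rewrite big_cons; under [RHS]eq_bigr do rewrite big_cons.
by rewrite !big_split /= e1 e2.
Qed.

(** On charge [n], the map must be compatible with [y_act_x]: it sends [y_q b] to
    the combination [Zq] of modes of [f] below. That the result is independent of
    the order of the entries is proved in [Psn_step]. *)
Fixpoint Psn (n : nat) : fock -> U :=
  if n is m.+1 then
    lift (fun l => if size l == m.+1 then
      if l is q :: l' then
        \sum_(d < (sumn l').+1) xmode m (q%:Z + d%:Z) (Psn m (Gi d (ys l')))
      else 0 else 0)
  else lift (fun l => if l is [::] then w else 0).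

Lemma Psn_linear n : linear (Psn n).
Proof. by case: n => [|n]; exact: lift_is_linear. Qed.

HB.instance Definition _ n :=
  GRing.isLinear.Build C fock U *:%R (Psn n) (Psn_linear n).

Arguments Psn : simpl never.

Definition Zq W n (q : int) (b : fock) : U :=
  \sum_(d < W) xmode n (q + d%:Z) (Psn n (Gi d b)).

Lemma Zq_linear W n q : linear (Zq W n q).
Proof.
move=> k u v; rewrite /Zq scaler_sumr -big_split; apply: eq_bigr => d _ /=.
by rewrite (linearP (Gi d)) (linearP (Psn n)) (linearP (xmode _ _)).
Qed.

Lemma Zq_bound W W' s (wb : int) n q b : hom s wb b -> wb < W%:Z -> (W <= W')%N ->
  Zq W' n q b = Zq W n q b.
Proof.
move=> hb wbW WW; apply: (@sum_ord_bound _ (fun d => xmode n (q + d%:Z) (Psn n (Gi d b)))) => // d Wd.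
by rewrite (G_big (- h) hb) ?linear0 //; lia.
Qed.

Lemma Psn0 : Psn 0 (ys [::]) = w.
Proof. by rewrite /Psn lift_ys // => s t; case: s t => [|a s] [|b t] // /perm_size. Qed.

(** The value of [Zq] at [y_q' b], an expression in the modes of [f] at [q] and
    [q']. *)
Definition S2 W n (q q' : int) b :=
  \sum_(j < W) \sum_(d < W) ((-1) ^+ j * cbinom (- h) j) *:
    xmode n.+1 (q + (d + j)%N%:Z) (Zq W n (q' - j%:Z) (Gi d b)).

(** Exchanging [q] and [q'] is the locality of [f]. *)
Lemma S2_swap n q q' (wb : int) b : hom n wb b ->
  exists K0, forall W, (K0 <= W)%N -> S2 W n q q' b = S2 W n q' q b.
Proof.
move=> hb; pose B := `|wb|.+1%N.
have E A A' W : (B <= W)%N -> S2 W n A A' b = \sum_(j < W) \sum_(d < B) \sum_(d' < B)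
    ((-1) ^+ j * cbinom (- h) j) *:
    xmode n.+1 ((A + d%:Z) + j%:Z) (xmode n ((A' + d'%:Z) - j%:Z) (Psn n (Gi d' (Gi d b)))).
  move=> BW; apply: eq_bigr => j _.
  rewrite (@sum_ord_bound _ (fun d => ((-1) ^+ j * cbinom (- h) j) *:
    xmode n.+1 (A + (d + j)%N%:Z) (Zq W n (A' - j%:Z) (Gi d b))) B) // => [|d Bd].
    apply: eq_bigr => d _; have hd := hom_G (- h) d hb.
    rewrite (Zq_bound (W := B) _ _ hd) //; last by rewrite /B; lia.
    rewrite /Zq linear_sum scaler_sumr; apply: eq_bigr => d' _.
    by congr (_ *: xmode _ _ (xmode _ _ _)); lia.
  rewrite (G_big (- h) hb); last by move: Bd; rewrite /B; lia.
  by rewrite (lin0 (Zq_linear _ _ _)) linear0 scaler0.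
have [K0 e] : fsum_eq
    (fun j => \sum_(d < B) \sum_(d' < B) ((-1) ^+ j * cbinom (- h) j) *:
      xmode n.+1 ((q + d%:Z) + j%:Z) (xmode n ((q' + d'%:Z) - j%:Z) (Psn n (Gi d' (Gi d b)))))
    (fun j => \sum_(d < B) \sum_(d' < B) ((-1) ^+ j * cbinom (- h) j) *:
      xmode n.+1 ((q' + d'%:Z) + j%:Z) (xmode n ((q + d%:Z) - j%:Z) (Psn n (Gi d' (Gi d b))))).
  apply: fsum_eq_sum => d; apply: fsum_eq_sum => d'.
  exact: xmode_comm.
exists (maxn K0 B) => W; rewrite geq_max => /andP[/e {}e BW].
rewrite !E // {}e; apply: eq_bigr => j _; rewrite exchange_big.
by apply: eq_bigr => d _; apply: eq_bigr => d' _; rewrite G_comm.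
Qed.

Definition Psn_y n := forall (q : nat) (wb : int) b W, hom n wb b -> wb < W%:Z ->
  Psn n.+1 (y q b) = Zq W n q b.
(** Compatibility with [y_q = 0] for [q < 0]. *)
Definition Zq_neg n := forall (q : int) (wb : int) b W, q < 0 -> hom n wb b -> wb < W%:Z ->
  Zq W n q b = 0.

Lemma Zq_y n (q : int) (q' : nat) (wb : int) b W : Psn_y n -> Zq_neg n ->
  hom n wb b -> q'%:Z + wb < W%:Z -> wb < W%:Z ->
  Zq W n.+1 q (y q' b) = S2 W n q q' b.
Proof.
move=> Py Zn hb qW wbW.
pose phi D : {linear fock -> U} := xmode n.+1 (q + D%:Z) \o Psn n.+1.
rewrite /Zq -[LHS]/(\sum_(D < W) phi D (Gi D (y q' b))) (G_y_sum (- h) phi hb qW).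
apply: eq_bigr => j _; apply: eq_bigr => d _; rewrite /phi /=.
congr (_ *: xmode _ _ _); have hd := hom_G (- h) d hb.
have [jq|qj] := leqP j q'.
  by rewrite subzn // (Py _ _ _ W hd) //; lia.
rewrite y_neg ?subr_lt0 // linear0 (Zn _ _ _ _ _ hd) //; lia.
Qed.

(** The symmetry [S2_swap] shows that two entries may be exchanged, and reduces the
    vanishing for [q < 0] on [y_q' b] to the vanishing on [b]. *)
Lemma Psn_step n : Psn_y n -> Zq_neg n -> Psn_y n.+1 /\ Zq_neg n.+1.
Proof.
move=> Py Zn; split=> [q wb b W hb wbW|q wb b W q0 hb wbW].
  move: b hb; apply: hom_ind => [|l lr lw].
    apply: linear_eq_subspace; last exact: Zq_linear.
    by move=> k u v; rewrite (linearP (y q)) (linearP (Psn _)).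
  rewrite y_ys /Psn lift_ys -/(Psn n.+1); last first.
    move=> s t st; rewrite (perm_size st); case: eqP => // tn.
    case: s t st tn => [|a s] [|a' t] // st tn; try by have := perm_size st.
    have Zs q1 l1 : \sum_(d < (sumn l1).+1) xmode n.+1 (q1%:Z + d%:Z) (Psn n.+1 (Gi d (ys l1))) =
      Zq (sumn l1).+1 n.+1 q1 (ys l1) by [].
    have [aa|aa] := eqVneq a a'.
      move: st; rewrite aa perm_cons => st.
      by rewrite !Zs (ys_perm _ st) (perm_sumn st).
    have at_ : a \in t by have := perm_mem st a; rewrite mem_head in_cons (negPf aa).
    set l2 := rem a t; have tl : perm_eq t (a :: l2) := perm_to_rem at_.
    have sl : perm_eq s (a' :: l2).
      rewrite -(perm_cons a); apply: (perm_trans st).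
      rewrite -(perm_cons a') in tl; apply: (perm_trans tl).
      by have /permEl := perm_catCA [:: a'] [:: a] l2.
    have hl2 : hom n (sumn l2) (ys l2).
      have <- : size l2 = n by move: tn; rewrite /= (perm_size tl) /= => -[].
      exact: hom_ys.
    rewrite !Zs (ys_perm _ tl) (ys_perm _ sl) (perm_sumn tl) (perm_sumn sl) -!y_ys.
    have [K0 e] := S2_swap a a' hl2.
    have [W1 W1b] : exists W1, (K0 + sumn l2 + a + a' < W1)%N by eexists; apply: leqnn.
    have h1 := hom_y a hl2; have h2 := hom_y a' hl2.
    rewrite -(Zq_bound (W' := W1) _ _ h2) /=; [|lia|lia].
    rewrite -(Zq_bound (W' := W1) _ a' h1) /=; [|lia|lia].
    rewrite (Zq_y _ Py Zn hl2); [|lia|lia].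
    by rewrite (Zq_y _ Py Zn hl2) ?e //; lia.
  rewrite /= lr eqxx -/(Zq (sumn l).+1 n.+1 q (ys l)).
  by rewrite -(Zq_bound (W' := W) _ _ (hom_ys R l)) //; lia.
move: b hb; apply: hom_ind => [|[//|q' l] [lr] lw].
  apply: linear_eq_subspace; first exact: Zq_linear.
  by move=> k u v; rewrite scaler0 addr0.
have hl : hom n (sumn l) (ys l) by rewrite -lr; exact: hom_ys.
rewrite -y_ys; have [K0 e] := S2_swap q q' hl.
rewrite -(Zq_bound (W' := maxn K0 W) _ _ (hom_y q' hl)); first last.
- exact: leq_maxr.
- by move: wbW; rewrite -lw /=; lia.
have WW : (W <= maxn K0 W)%N by exact: leq_maxr.
have lW : q'%:Z + (sumn l)%:Z < W%:Z by move: wbW; rewrite -lw /=; lia.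
rewrite (Zq_y _ Py Zn hl); try lia.
rewrite e ?leq_maxl // /S2 big1 // => j _; rewrite big1 // => d _.
by rewrite (Zn _ _ _ _ _ (hom_G (- h) d hl)) ?linear0 ?scaler0 //; lia.
Qed.

Lemma Psn_free n : Psn_y n /\ Zq_neg n.
Proof.
elim: n => [|n [Py Zn]]; last exact: Psn_step.
have Z1 W q : (0 < W)%N -> Zq W 0 q (ys [::]) = xmode 0 q w.
  move=> W0; rewrite /Zq (@sum_only0 _ W (fun d => xmode 0 (q + d%:Z) (Psn 0 (Gi d (ys [::]))))) //.
    by rewrite addr0 G_0 Psn0.
  by case=> // d _; rewrite G_one !linear0.
split=> [q wb b W hb wbW|q wb b W q0 hb wbW]; move: b hb; apply: hom_ind => [|[|//] _ wE].
- apply: linear_eq_subspace; last exact: Zq_linear.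
  by move=> k u v; rewrite (linearP (y q)) (linearP (Psn _)).
- rewrite Z1; last by lia.
  rewrite y_ys /Psn lift_ys -/(Psn 0) => [|s t st] /=.
    by rewrite big_ord1 addr0 G_0 Psn0.
  rewrite (perm_size st); case: eqP => //.
  by case: s t st => [|a [|a' s]] [|b [|b' t]] // st; move: (perm_size st) => // _ _;
    move: st; rewrite perm_sym => /perm_consP; case=> i [u []]; case: i => [|i] //= -[-> _].
- apply: linear_eq_subspace; first exact: Zq_linear.
  by move=> k u v; rewrite scaler0 addr0.
- by rewrite Z1 ?/xmode ?mulr0 ?addr0 ?f_vac //; lia.
Qed.

Definition Psi : fock -> U := lift (fun l => Psn (size l) (ys l)).

HB.instance Definition _ := GRing.Linear.on Psi.

Lemma Psi_hom n (wb : int) b : hom n wb b -> Psi b = Psn n b.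
Proof.
move: b; apply: hom_ind => [|l <- _].
  by apply: linear_eq_subspace; exact: linearP.
by rewrite /Psi lift_ys // => s t st; rewrite (perm_size st) (ys_perm _ st).
Qed.

Lemma Psi_one : Psi (ys [::]) = w.
Proof. by rewrite (Psi_hom (hom_ys R [::])) Psn0. Qed.

(** [Psi] intertwines the field [x(z) = z^c X(z) Gamma(z)] of the model with [f]. *)
Lemma Psi_x n (wb : int) b e W : hom n wb b -> wb < W%:Z ->
  Psi (\sum_(d < W) y (e + d%:Z) (G h d b)) = xmode n e (Psi b).
Proof.
move=> hb wbW; have [wb0|wb0] := ltP wb 0.
  move: hb => /(hom_neg wb0) ->.
  by rewrite big1 => [|d _]; rewrite !linear0.
have [Py Zn] := Psn_free n; rewrite (Psi_hom hb).
pose phi D : {linear fock -> U} := xmode n (e + D%:Z) \o Psn n.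
have := G_add_sum (- h) h phi hb wbW; rewrite addNr.
rewrite (@sum_only0 _ W (fun D => phi D (G 0 D b))); first last.
- by case=> // D _; rewrite G_zero linear0.
- lia.
rewrite G_zero /phi /= addr0 => <-.
rewrite linear_sum exchange_big; apply: eq_bigr => d _ /=.
have hd := hom_G h d hb; rewrite (Psi_hom (hom_y _ hd)).
transitivity (Zq W n (e + d%:Z) (G h d b)).
  have [ed|ed] := lerP 0 (e + d%:Z).
    by rewrite -[X in y X](gez0_abs ed) (Py _ _ _ W hd) ?gez0_abs //; lia.
  by rewrite y_neg // linear0 (Zn _ _ _ _ ed hd) //; lia.
by apply: eq_bigr => d' _; congr (xmode _ _ _); lia.
Qed.

End FreeField.

(** * Monomials in the modes of the generator *)

Section ModelMonomials.
Variables (R : realType) (h c : R[i]).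
Local Notation C := (R[i]).
Local Notation fock := (fock R).
Local Notation ys := (ys R).
Local Notation x0 := (ys [:: 0%N]).

Definition mmono (ns : seq C) : fock := foldr (fun n u => act h c x0 (- n) u) (ys [::]) ns.

(** The sum of the [n - 1 + d] over the modes [- n] of a product of length [r] which
    maps 1 into weight [w], for the field with parameters [h] and [c]:
    the exponents of the field on charge [i] lie in [c + h i + Z]. *)
Definition energy (d : C) (r : nat) (w : int) : C :=
  w%:~R + r%:R * (c + d) + h * (r%:R * (r%:R - 1) / 2).

Lemma energyS d r (w e : int) :
  1 + e%:~R + (c + h * r%:R) - 1 + d + energy d r w = energy d r.+1 (e + w).
Proof. by rewrite /energy rmorphD /= -natr1; field. Qed.

(** A product of modes with an exponent outside its coset is 0. *)
Lemma mmono_hom ns : exists w : int, hom (size ns) w (mmono ns) /\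
  (mmono ns = 0 \/ forall d, \sum_(n <- ns) (n - 1 + d) = energy d (size ns) w).
Proof.
elim: ns => [|n ns [w [hw IH]]].
  exists 0; split; first exact: (hom_ys R [::]).
  by right=> d; rewrite big_nil /energy !mul0r mulr0 !addr0.
have [[e nE]|ne] := pselect (exists e : int, - n = - 1 - e%:~R - (c + h * (size ns)%:R)).
  exists (e + w); split.
    have wW : w < (`|w|.+1)%:Z by lia.
    rewrite /= nE (act_x h c e hw wW); apply: hom_sum => d.
    by have := hom_y (e + d%:Z) (hom_G h d hw); rewrite (_ : e + d%:Z + _ = e + w) //; lia.
  case: IH => [b0|IH]; first by left; rewrite /= b0 linear0.
  right=> d; rewrite big_cons IH -energyS; congr (_ - 1 + d + _).
  by rewrite -[n]opprK nE; ring.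
exists 0; have -> : mmono (n :: ns) = 0.
  by apply: (act_x_zero hw) => e nE; apply: ne; exists e.
by split; [exact: hom0|left].
Qed.

(** By [y_act_x], with an explicit list of modes at each step. The predicate [I]
    records that these modes are integral in the case of F(p). *)
Lemma mmono_span (I : C -> Prop) r (w : int) v :
  (forall (e : int) (s : nat), I (1 + e%:~R + (c + h * s%:R))) -> hom r w v ->
  span_set (fun u => exists ns, [/\ u = mmono ns, size ns = r,
    forall n, n \in ns -> I n & forall d, \sum_(n <- ns) (n - 1 + d) = energy d r w]) v.
Proof.
move=> I1; elim: r w v => [|r IH] w v hv.
  move: v hv; apply: hom_ind => [|[|//] _ <-]; first exact: span_is_subspace.
  move=> A _; apply; exists [::]; split=> // d.
  by rewrite big_nil /energy !mul0r mulr0 !addr0.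
move: v hv; apply: hom_ind => [|[//|q l] [lr] lw]; first exact: span_is_subspace.
have hl := hom_ys R l; rewrite lr in hl.
rewrite -y_ys -(y_act_x h c q%:Z hl (W := (sumn l).+1)); last by lia.
apply: (subspace_sum _ (span_is_subspace _)) => d.
have hd := hom_G (- h) d hl; move: (G _ _ _) hd => u hu.
have {hu} := IH _ _ hu.
set M := (X in span_set X (act _ _ _ _ _)).
move=> /(_ (fun u => span_set M (act h c x0 (- 1 - (q%:Z + d%:Z)%:~R - (c + h * r%:R)) u))).
apply; first exact: (lin_preim (act_linear h c x0 _) (span_is_subspace M)).
move=> _ [ns [-> nr In nsE]] A _; apply.
exists (1 + (q%:Z + d%:Z)%:~R + (c + h * r%:R) :: ns); split=> /=.
- by congr act; ring.
- by rewrite nr.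
- by move=> n; rewrite in_cons => /orP[/eqP ->|/In].
- move=> d'; rewrite big_cons nsE energyS; congr (energy _ _ _); move: lw => /=; lia.
Qed.

Variables (V : gva h) (x : V) (mu : C) (M : gmod V mu) (v : M) (Ps : fock -> M).
Hypothesis Ps1 : Ps (ys [::]) = v.
Hypothesis PsE : forall b n, Ps (act h c x0 n b) = gmod_act x n (Ps b).

Lemma mmono_monomial ns : Ps (mmono ns) = monomial x ns v.
Proof. by elim: ns => //= n ns IH; rewrite PsE IH. Qed.

End ModelMonomials.

(** * Cyclic modules as images of the polynomial algebra *)

Section ModelGeneration.
Variables (R : realType) (h : R[i]).
Local Notation C := (R[i]).
Local Notation fock := (fock R).
Local Notation ys := (ys R).
Local Notation x0 := (ys [:: 0%N]).

(** By [y_act_x], the modes of the generator produce all the monomials. *)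
Lemma model_ind c (P : fock -> Prop) : is_subspace P -> P (ys [::]) ->
  (forall n (wb : int) b k, hom n wb b -> P b -> P (act h c x0 k b)) ->
  forall v, P v.
Proof.
move=> sP P1 Px; apply: fock_ind => // l.
have : forall n (wb : int) b, hom n wb b -> P b; last by apply; exact: hom_ys.
move=> {l}; elim=> [|n IH] wb b; apply: hom_ind => // -[//|q l] // [ln] lw.
have hl : hom n (sumn l) (ys l) by rewrite -ln; exact: hom_ys.
rewrite -y_ys -(y_act_x h c q hl (ltnSn _)).
apply: (subspace_sum _ sP) => d.
by apply: (Px _ _ _ _ (hom_G (- h) d hl)); apply: IH (hom_G (- h) d hl).
Qed.

Lemma model_regular (n : nat) : act h 0 x0 (n%:R - h) x0 = 0.
Proof.
have h0 := hom_ys R [:: 0%N].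
rewrite (_ : n%:R - h = - 1 - (- n.+1%:Z)%:~R - (0 + h * 1%:R)); last first.
  by rewrite rmorphN /= -pmulrn -natr1; ring.
by rewrite (act_x (W := 1) h 0 _ h0) // big_ord1 y_neg.
Qed.

Lemma model_cyclic : @gva_cyclic R h (model h) x0.
Proof.
split.
- exact: (@charge_ys R [:: 0%N]).
- apply: (regular_local (gva_rep (model h)) (x := x0)).
    exact: (@charge_ys R [:: 0%N]).
  exact: model_regular.
- move=> A sA A1 Ax Amul; apply: (model_ind (c := 0) sA A1) => n wb b k _ Ab.
  exact: Amul.
Qed.

End ModelGeneration.

Section PullBack.
Variables (R : realType) (h : R[i]) (V : gva h) (f : V -> model h).
Local Notation C := (R[i]).
Hypothesis f_hom : gva_hom f.
Variables (U : lmodType C) (gU : int -> U -> Prop) (mu : C).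
Variable actU : fock R -> C -> U -> U.
Hypothesis rU : field_rep h (@charge R) (ys R [::]) (act h 0) gU mu actU.

Lemma pull_rep : field_rep h (@gva_deg R h V) (gva_one V) (@gva_mul R h V) gU mu
  (fun b => actU (f b)).
Proof.
have [lf f1 fdeg fmul] := f_hom; split.
- exact: rep_grading rU.
- by move=> n u k a b; rewrite lf (rep_linear_l rU).
- by move=> a n; exact: rep_linear_r rU _ _.
- by move=> r t a n u /fdeg ra tu; exact: rep_degree rU _ _ _ _ _ ra tu.
- by move=> r t a u /fdeg ra tu; exact: rep_field rU _ _ _ _ ra tu.
- by move=> n u; rewrite f1 (rep_one rU).
- move=> r s t a b u m k n /fdeg ra /fdeg sb tu nE mE kE.
  have [K0 e] := rep_borcherds rU ra sb tu nE mE kE.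
  exists K0 => K /e ->; apply: eq_bigr => j _; by rewrite fmul.
Qed.

End PullBack.

Section Presentation.
Variables (R : realType) (h : R[i]) (V : gva h) (x : V) (mu c : R[i]) (dl : int).
Local Notation C := (R[i]).
Local Notation fock := (fock R).
Local Notation ys := (ys R).
Local Notation x0 := (ys [:: 0%N]).
Variables (N : gmod V mu) (v : N).
Hypothesis x_cyc : gva_cyclic x.
Hypothesis v0 : gmod_deg 0 v.
Hypothesis v_gen : gmod_generated v.
Hypothesis cE : c = h * mu + dl%:~R.
Hypothesis v_vac : forall e : int, e < 0 -> gmod_act x (- 1 - e%:~R - c) v = 0.
Local Notation Psi := (Psi h c (gmod_act x) v).

Lemma gen_linear n : linear (@gmod_act R h V mu N x n).
Proof. exact: rep_linear_r (gmod_rep N) x n. Qed.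

Lemma gen_local : local_field h (@gmod_act R h V mu N x).
Proof.
have [x1 _ _] := x_cyc.
by have := regular_local (gmod_rep N) x1 (cyclic_regular x_cyc).
Qed.

Lemma Psi_act_x n (wb : int) b e : hom n wb b ->
  Psi (act h c x0 (- 1 - e%:~R - (c + h * n%:R)) b) =
  gmod_act x (- 1 - e%:~R - (c + h * n%:R)) (Psi b).
Proof.
move=> hb; have wbW : wb < (`|wb|.+1)%:Z by lia.
rewrite (act_x h c e hb wbW).
exact: (Psi_x gen_linear gen_local v_vac e hb wbW).
Qed.

Lemma Psi_deg n (wb : int) b : hom n wb b -> gmod_deg n (Psi b).
Proof.
have sub t : is_subspace (@gmod_deg R h V mu N t) by case: (rep_grading (gmod_rep N)).
have [x1 _ _] := x_cyc.
elim: n wb b => [|n IH] wb; apply: hom_ind.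
- exact: (lin_preim (linearP Psi) (sub 0)).
- by case=> // _ _; rewrite (Psi_one h c (gmod_act x) v).
- exact: (lin_preim (linearP Psi) (sub n.+1)).
case=> // q l [ln] _.
have hl : hom n (sumn l) (ys l) by rewrite -ln; exact: hom_ys.
rewrite -y_ys -(y_act_x h c q hl (ltnSn _)) linear_sum.
apply: (subspace_sum _ (sub n.+1)) => d; rewrite -[X in gmod_deg _ X]/(Psi _).
rewrite (Psi_act_x _ (hom_G (- h) d hl)) -add1n PoszD.
by apply: (rep_degree (gmod_rep N)) x1 _; apply: IH (hom_G (- h) d hl).
Qed.

(** Both sides vanish for the modes outside the coset of exponents; this uses that
    [Psi] respects the charge. *)
Lemma Psi_act_hom n (wb : int) b k : hom n wb b ->
  Psi (act h c x0 k b) = gmod_act x k (Psi b).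
Proof.
move=> hb; have [x1 _ _] := x_cyc.
have [[e ->]|kE] := pselect (exists e : int, k = - 1 - e%:~R - (c + h * n%:R)).
  exact: (Psi_act_x e hb).
rewrite (act_x_zero hb) => [|e ke]; last by apply: kE; exists e.
rewrite linear0; apply/esym/(rep_nonexp (gmod_rep N) x1 (Psi_deg hb)) => l ke.
apply: kE; exists (- 1 - l - dl); rewrite ke cE !rmorphB rmorphN /= -!pmulrn; ring.
Qed.

Lemma Psi_act b k : Psi (act h c x0 k b) = gmod_act x k (Psi b).
Proof.
move: b; apply: fock_eq => [u a b|u a b|l].
- by rewrite (linearP (act _ _ _ _)) linearP.
- by rewrite linearP gen_linear.
- exact: Psi_act_hom (hom_ys R l).
Qed.

Lemma Psi_surj u : exists b, Psi b = u.
Proof.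
have := monomial_span x_cyc v0 v_gen u.
move=> /(_ (fun u => exists b, Psi b = u)); apply; last first.
  by move=> w [ns ->]; exists (mmono h c ns); exact: (mmono_monomial (Psi_one _ _ _ _) Psi_act).
split; first by exists 0; rewrite linear0.
by move=> k u1 u2 [b1 <-] [b2 <-]; exists (k *: b1 + b2); rewrite linearP.
Qed.

(** For maps [th] obtained from a universal property: injectivity of [Psi], up to
    the kernel of [pi], follows. *)
Lemma Psi_section (W : lmodType C) (pi : fock -> W) (th : N -> W) :
  linear pi -> linear th -> th v = pi (ys [::]) ->
  (forall k b, th (Psi b) = pi b -> th (gmod_act x k (Psi b)) = pi (act h c x0 k b)) ->
  forall b, th (Psi b) = pi b.
Proof.
move=> lpi lth e1 ex; apply: (@model_ind _ h c (fun b => th (Psi b) = pi b)).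
- apply: linear_eq_subspace => // k a b.
  by rewrite (linearP Psi) lth.
- by rewrite Psi_one.
- by move=> n wb b k hb e; rewrite Psi_act ex.
Qed.

End Presentation.

(** * Presentation of the modules over F(p) *)

Lemma natr_absz_ge0 (R : realType) (z : int) : 0 <= z -> (`|z|%N)%:R = z%:~R :> R[i].
Proof. by move=> z0; rewrite pmulrn gez0_abs. Qed.

Section Truncation.
Variables (R : realType) (h c : R[i]) (D : nat -> Prop) (be : nat -> int).
Local Notation C := (R[i]).
Local Notation fock := (fock R).
Local Notation ys := (ys R).
Local Notation x0 := (ys [:: 0%N]).

(** The relations imposed on both modules are of this kind: a bound, depending on
    the charge, on the exponents of X(z). *)
Definition trunc_set (b : fock) := exists t wu u (e : int),
  [/\ D t, hom t wu u, be t < e & b = y e u].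
Definition trunc : subspace fock := Defs.span trunc_set.

Definition mode_trunc_set (b : fock) := exists t wu u (e : int),
  [/\ D t, hom t wu u, be t < e & b = act h c x0 (- 1 - e%:~R - (c + h * t%:R)) u].

(** A bound on the exponents of the field is the same as a bound on those of X(z),
    since [act_x] and [y_act_x] only raise the exponent. *)
Lemma mode_trunc b : span_set mode_trunc_set b <-> trunc b.
Proof.
have sT := subspaceP trunc; have sM := span_is_subspace mode_trunc_set.
split=> [/(_ trunc)|/(_ (span_set mode_trunc_set))]; apply=> // _ [t [wu [u [e [Dt hu te ->]]]]].
  have wW : wu < (`|wu|.+1)%:Z by lia.
  rewrite (act_x h c e hu wW); apply: (subspace_sum _ sT) => d.
  move=> A _; apply; exists t, (wu - d%:Z), (G h d u), (e + d%:Z); split=> //.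
    exact: hom_G.
  by lia.
have wW : wu < (`|wu|.+1)%:Z by lia.
rewrite -(y_act_x h c e hu wW); apply: (subspace_sum _ sM) => d.
move=> A _; apply; exists t, (wu - d%:Z), (G (- h) d u), (e + d%:Z); split=> //.
  exact: hom_G.
by lia.
Qed.

End Truncation.

Section Quotient.
Variables (R : realType) (p : nat) (k m : int).
Local Notation C := (R[i]).
Local Notation h := (p%:R : C).
Local Notation c := (m%:~R : C).
Local Notation fock := (fock R).
Local Notation ys := (ys R).
Local Notation x0 := (ys [:: 0%N]).

Let cE0 : c = h * 0 + m%:~R. Proof. by rewrite mulr0 add0r. Qed.
Let rU := act_rep cE0.

Definition relation_set (b : fock) := exists (n : nat) (t : int) u,
  charge t u /\ b = act h c x0 (- k%:~R - n%:R) u.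
Definition relations : subspace fock := Defs.span relation_set.

Lemma relations_mem n u : relations (act h c x0 (- k%:~R - n%:R) u).
Proof.
move: u; apply: fock_ind => [|l].
  exact: (lin_preim (act_linear h c x0 _) (subspaceP relations)).
by move=> A _; apply; exists n, (size l)%:Z, (ys l); split=> //; exact: charge_ys.
Qed.

(** The modes of the generator of F(p) commute up to a sign. *)
Lemma relations_stable b n u : relations u -> relations (act h c b n u).
Proof.
have [x1 _ xgen] := model_cyclic h.
have : forall b n u, span_set relation_set u -> span_set relation_set (act h c b n u); last by apply.
move=> {b n u}.
apply: (@generator_stable R h (model h) fock (@charge R) 0 (act h c) rU x0 relation_set x1 xgen) => [u [n [t [w [tw ->]]]]|n u [n' [t [w [tw ->]]]]].
  by exists (1 + t); exact: (act_charge h c _ x1 tw).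
have [[i ->]|nE] := pselect (exists i : int, n = i%:~R); last first.
  rewrite (act_gen_nonint (model_cyclic h) rU); first by case: (span_is_subspace relation_set).
  by move=> i e; apply: nE; exists i.
have [eps comm] := gen_commute (model_cyclic h) rU.
have -> : - k%:~R - n'%:R = (- k - n'%:Z)%:~R :> C.
  by rewrite rmorphB rmorphN /= -pmulrn.
rewrite comm; apply: (@subspaceZ _ _ (span_set relation_set)); first exact: span_is_subspace.
rewrite rmorphB rmorphN /= -pmulrn; exact: relations_mem.
Qed.

Lemma relations_cproj t u : relations u -> relations (cproj t u).
Proof.
move=> /(_ (fun u => relations (cproj t u))); apply.
  exact: (lin_preim (linearP (cproj t)) (subspaceP relations)).
move=> _ [n [s [w [sw ->]]]].
have [x1 _ _] := model_cyclic h.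
rewrite (cproj_charge _ (act_charge h c _ x1 sw)); case: eqP => _.
  exact: relations_mem.
by case: (subspaceP relations).
Qed.

Local Notation quot := (quotient_type relations).
Local Notation cl := (cls relations).

Definition quot_act (b : fock) (n : C) (q : quot) : quot := cl (act h c b n (rep q)).
Definition quot_deg (t : int) (q : quot) := exists u, charge t u /\ q = cl u.

Lemma cls_linear : linear cl. Proof. exact: cls_is_linear. Qed.

Lemma cls_eq0 u : cl u = 0 <-> relations u.
Proof.
by rewrite -(lin0 cls_linear); split=> [/cls_eqP|ku]; [|apply/cls_eqP]; rewrite subr0.
Qed.

Lemma quot_act_cls b n u : quot_act b n (cl u) = cl (act h c b n u).
Proof.
apply/cls_eqP; rewrite -linearB; apply: relations_stable.
by apply/cls_eqP; rewrite repK.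
Qed.

Lemma quot_rep : field_rep h (@charge R) (ys [::]) (act h 0) quot_deg 0 quot_act.
Proof.
split.
- have [sC dC iC] := @charge_grading R; split=> [t|q|s f us fP f0 i si].
  + split; first by exists 0; split; [case: (charge_sub R t)|rewrite (lin0 cls_linear)].
    move=> z q q' [u [tu ->]] [u' [tu' ->]]; exists (z *: u + u').
    by rewrite cls_linear; split=> //; apply: (charge_sub R t).2.
  + have [s [f [fP fE]]] := dC (rep q); exists s, (fun i => cl (f i)).
    split=> [i|]; first by exists (f i).
    by rewrite -(lin_sum _ _ cls_linear) -fE repK.
  + have [g gP] : exists g : int -> fock, forall i, charge i (g i) /\ f i = cl (g i).
      exists (fun i => projT1 (cid (fP i))) => j; exact: (projT2 (cid (fP j))).
    have : relations (\sum_(i <- s) g i).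
      apply/cls_eq0; rewrite (lin_sum _ _ cls_linear) -[RHS]f0.
      by apply: eq_bigr => j _; rewrite (gP j).2.
    move/(relations_cproj i); rewrite linear_sum (bigD1_seq i) //= big1 ?addr0.
      rewrite (cproj_charge _ (gP i).1) eqxx (gP i).2 => ki; exact/cls_eq0.
    by move=> j ji; rewrite (cproj_charge _ (gP j).1) (negPf ji).
- by move=> n q z a b; rewrite /quot_act act_linear_l cls_linear.
- move=> b n z q q'; rewrite -[q]repK -[q']repK -cls_linear !quot_act_cls.
  by rewrite act_linear cls_linear.
- move=> r t b n _ rb [u [tu ->]]; rewrite quot_act_cls.
  by exists (act h c b n u); split=> //; exact: (act_charge h c n rb tu).
- move=> r t b _ rb [u [tu ->]]; have [N HN] := rep_field rU rb tu.
  exists N => n; rewrite quot_act_cls => ne; apply: HN => e; apply: ne.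
  by rewrite e (lin0 cls_linear).
- move=> n q; rewrite -[q]repK quot_act_cls (rep_one rU).
  by case: eqP => // _; rewrite (lin0 cls_linear).
- move=> r s t a b _ m0 k0 n ra sb [u [tu ->]] nE mE kE.
  have [K0 e] := rep_borcherds rU ra sb tu nE mE kE.
  exists K0 => K /e eK; under eq_bigr do rewrite !quot_act_cls.
  under [RHS]eq_bigr do rewrite quot_act_cls.
  transitivity (cl (\sum_(j < K) cbinom m0 j *:
     act h c (act h 0 a (n + j%:R) b) (m0 + k0 - j%:R) u)).
    rewrite -eK (lin_sum _ _ cls_linear); apply: eq_bigr => j _.
    have clZ z w : cl (z *: w) = z *: cl w.
      by have := cls_linear z w 0; rewrite !addr0 (lin0 cls_linear) addr0.
    by rewrite clZ -scaleN1r -[act _ _ _ _ _ - _]addrC -scaleN1r cls_linear clZ addrC !scaleN1r.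
  rewrite (lin_sum _ _ cls_linear); apply: eq_bigr => j _.
  by have := cls_linear (cbinom m0 j) (act h c (act h 0 a (n + j%:R) b) (m0 + k0 - j%:R) u) 0;
    rewrite !addr0 (lin0 cls_linear) addr0.
Qed.

(** On charge [t] the mode [- k - n] of the field with parameters [p] and [m] is
    the exponent [k - 1 - m - p t + n]. *)
Lemma relations_trunc b : relations b <->
  trunc R (fun=> True) (fun t => k - 2 - m - p%:Z * t%:Z) b.
Proof.
rewrite -(mode_trunc h c); split.
  move=> /(_ (span_set (mode_trunc_set h c (fun=> True) (fun t => k - 2 - m - p%:Z * t%:Z)))).
  have sS := span_is_subspace (mode_trunc_set h c (fun=> True) (fun t => k - 2 - m - p%:Z * t%:Z)).
  apply=> // _ [n [t [u [_ ->]]]]; move: u.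
  apply: fock_ind => [|l]; first exact: (lin_preim (act_linear h c x0 _) sS).
  move=> A _; apply; exists (size l), (sumn l), (ys l), (k - 1 - m - p%:Z * (size l)%:Z + n%:Z).
  split=> //; [exact: hom_ys|by lia|].
  by congr act; rewrite !(rmorphB, rmorphD, rmorphM) /= -!pmulrn; ring.
move=> /(_ relations); apply=> [|_ [t [wu [u [e [_ hu te ->]]]]]]; first exact: subspaceP.
rewrite (_ : - 1 - e%:~R - _ = - k%:~R - (`|(e - (k - 1 - m - p%:Z * t%:Z))%R|%N)%:R).
  exact: relations_mem.
rewrite natr_absz_ge0; last by lia.
by rewrite !(rmorphB, rmorphD, rmorphM) /= -!pmulrn; ring.
Qed.

End Quotient.

Section MkPresentation.
Variables (R : realType) (p : nat) (k m : int).
Local Notation C := (R[i]).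
Local Notation h := (p%:R : C).
Local Notation c := (m%:~R : C).
Local Notation ys := (ys R).
Local Notation x0 := (ys [:: 0%N]).
Variables (Fp : gva h) (a : Fp) (M : gmod Fp 0) (v : M).
Hypotheses (Fp_free : is_free_gva a) (M_free : is_Mk a k m v).

Lemma Mk_vac (e : int) : e < 0 -> gmod_act a (- 1 - e%:~R - c) v = 0.
Proof.
have [[av _] _ _ _] := M_free => e0.
rewrite (_ : - 1 - e%:~R - c = - c + (`|(- 1 - e)%R|%N)%:R); first exact: av.
by rewrite natr_absz_ge0; [rewrite rmorphB /=; ring|lia].
Qed.

(** The quotient of the polynomial algebra by the relations satisfies the condition
    for which M_k(m) is universal; the resulting map from M_k(m) is inverse to the
    map induced by [Psi]. *)
Lemma Mk_presentation : let Ps := Psi h c (gmod_act a) v in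
  [/\ forall u, exists b, Ps b = u,
      forall b n, Ps (act h c x0 n b) = gmod_act a n (Ps b)
    & forall b, Ps b = 0 <-> relations R p k m b].
Proof.
have cE0 : c = h * 0 + m%:~R by rewrite mulr0 add0r.
have [a_cyc univ] := Fp_free; have [[av ak] v0 vgen univM] := M_free.
have pact := Psi_act a_cyc v0 cE0 Mk_vac.
have psurj := Psi_surj a_cyc v0 vgen cE0 Mk_vac.
split=> // b; split; last first.
  move=> /(_ (fun b => Psi h c (gmod_act a) v b = 0)); apply.
    apply: linear_eq_subspace; first exact: linearP.
    by move=> z u u'; rewrite scaler0 addr0.
  by move=> _ [n [t [u [_ ->]]]]; rewrite pact ak.
have [f [[f_hom fa] _]] := univ _ _ (model_cyclic h).
pose N := Gmod (pull_rep f_hom (quot_rep R p k m)).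
pose w : N := cls (relations R p k m) (ys [::]).
have wact n b1 : gmod_act a n (cls (relations R p k m) b1 : N) = cls (relations R p k m) (act h c x0 n b1).
  by rewrite -quot_act_cls /= fa.
have [th [[[lth _ thact] thv] _]] : exists! th : M -> N, gmod_hom th /\ th v = w.
  apply: univM.
  - split=> [n|n u].
      rewrite wact; apply/cls_eq0.
      have -> : - c + n%:R = - 1 - (- n.+1%:Z)%:~R - (c + h * 0%:R) :> C.
        by rewrite rmorphN /= -pmulrn -natr1; ring.
      rewrite (act_x (W := 1) h c _ (hom_ys R [::])) // big_ord1 y_neg //.
      by case: (subspaceP (relations R p k m)).
    by rewrite -[u]repK wact; apply/cls_eq0; exact: relations_mem.
  - by exists (ys [::]); split=> //; exact: (@charge_ys R [::]).
  - move=> A sA Aw Aact u; rewrite -[u]repK; move: (rep u).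
    apply: (@model_ind _ h c (fun b => A (cls (relations R p k m) b))) => //.
      exact: (lin_preim (@cls_linear R p k m) sA).
    by move=> n wb b1 n1 _ Ab; rewrite -wact; apply: Aact.
move=> Pb; apply/cls_eq0.
have := @Psi_section R h Fp a 0 c m M v a_cyc v0 cE0 Mk_vac _ (cls (relations R p k m)) th
  (@cls_linear R p k m) lth thv.
move=> <-; last by move=> n b1 e; rewrite thact e wact.
by rewrite Pb (lin0 lth).
Qed.

End MkPresentation.

(** * Presentation of the modules over F(1/p) *)

Section McircPresentation.
Variables (R : realType) (p : nat) (m : int).
Local Notation C := (R[i]).
Local Notation h := ((p%:R : C)^-1).
Local Notation c := ((m%:~R : C) / p%:R).
Local Notation ys := (ys R).
Local Notation x0 := (ys [:: 0%N]).

(** Each of the modes involved is the exponent 0 of the field, which multiplies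
    vectors of weight 0 by [y_0]. *)
Lemma model_x_monomial i : x_monomial (h := h) (V := model h) x0 i = ys (nseq i.+1 0%N).
Proof.
elim: i => //= i ->.
have hn : hom i.+1 0 (ys (nseq i.+1 0%N)).
  by have := hom_ys R (nseq i.+1 0%N); rewrite size_nseq sumn_nseq mul0n.
have -> : - (i.+1%:R * h) - 1 = - 1 - (0 : int)%:~R - (0 + h * i.+1%:R) by ring.
by rewrite -[LHS]/(act h 0 x0 _ _) (act_x (W := 1) h 0 _ hn) // big_ord1 addr0 G_0 y_ys.
Qed.

Variables (F1p : gva h) (x : F1p) (M : gmod F1p m%:~R) (v : M).
Hypotheses (F1p_free : is_free_gva x) (M_free : is_Mcirc x v).

Let cE : c = h * m%:~R + (0 : int)%:~R. Proof. by rewrite addr0 mulrC. Qed.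

Lemma Mcirc_vac (e : int) : e < 0 -> gmod_act x (- 1 - e%:~R - c) v = 0.
Proof.
have [av _ _ _] := M_free => e0.
rewrite (_ : - 1 - e%:~R - c = - c + (- 1 - e)%:~R); last by rewrite rmorphB /=; ring.
apply: av => l; rewrite pmulrn -rmorphN => /intr_inj; lia.
Qed.

(** The polynomial algebra itself satisfies the universal condition, and the
    resulting map is inverse to [Psi]. *)
Lemma Mcirc_presentation : let Ps := Psi h c (gmod_act x) v in
  [/\ forall u, exists b, Ps b = u,
      forall b n, Ps (act h c x0 n b) = gmod_act x n (Ps b),
      injective Ps
    & (0 < p)%N -> forall b n,
      Ps (act h c (ys (nseq p 0%N)) n b) = gmod_act (a_elt x) n (Ps b)].
Proof.
have [x_cyc univ] := F1p_free; have [av v0 vgen univM] := M_free.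
have pact := Psi_act x_cyc v0 cE Mcirc_vac.
have psurj := Psi_surj x_cyc v0 vgen cE Mcirc_vac.
have [f [[f_hom fx] _]] := univ _ _ (model_cyclic h).
have [lf f1 fdeg fmul] := f_hom.
pose N := Gmod (pull_rep f_hom (act_rep cE)).
pose w : N := ys [::].
have [th [[[lth _ thact] thv] _]] : exists! th : M -> N, gmod_hom th /\ th v = w.
  apply: univM.
  - move=> n nE; rewrite -[LHS]/(act h c (f x) _ w) fx.
    have [[e nE']|ne] := pselect (exists e : int, n = e%:~R); last first.
      apply: (act_x_zero (hom_ys R [::])) => e nE'; apply: ne; exists (- 1 - e).
      by rewrite -[n](addKr (- c)) opprK nE' mulr0 rmorphB /=; ring.
    have e0 : 0 <= e.
      rewrite leNgt; apply/negP => e0; apply: (nE `|(e + 1)%R|%N).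
      by rewrite nE' pmulrn -rmorphN; congr _%:~R; lia.
    rewrite (_ : - c + n = - 1 - (- 1 - e)%:~R - (c + h * 0%:R)); last first.
      by rewrite nE' rmorphB /=; ring.
    rewrite (act_x (W := 1) h c _ (hom_ys R [::])) // big_ord1 y_neg // addr0; lia.
  - exact: (@charge_ys R [::]).
  - move=> A sA Aw Aact u; apply: (@model_ind _ h c A) => // n wb b1 n1 _ Ab.
    by rewrite -fx; apply: (Aact x).
have thK b : th (Psi h c (gmod_act x) v b) = b.
  apply: (Psi_section x_cyc v0 cE Mcirc_vac (pi := id)) => // n b1 e.
  by rewrite thact e -fx.
have psK u : Psi h c (gmod_act x) v (th u) = u.
  by have [b <-] := psurj u; rewrite thK.
split=> //; first exact: can_inj thK.
move=> p0 b n; rewrite -{1}[b]thK.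
have -> : ys (nseq p 0%N) = f (a_elt x).
  rewrite -[in LHS](prednK p0) -model_x_monomial /a_elt.
  by elim: p.-1 => [|i IH] /=; rewrite ?fx // fmul fx IH.
by rewrite -[act h c (f _) _ _]/(gmod_act (g := N) (a_elt x) n _) -thact psK.
Qed.

End McircPresentation.

(** * The bilinear form *)

Section Pairing.
Variable R : realType.
Local Notation C := (R[i]).
Local Notation fock := (fock R).
Local Notation ys := (ys R).
Local Notation G1 := (G (1 : C)).

(** The algebra map sending X(z) to 1; it is the pairing with the monomial 1. *)
Definition eps : fock -> C^o := lift (fun l => ((sumn l == 0%N)%:R : C^o)).

HB.instance Definition _ := GRing.Linear.on eps.

Lemma eps_ys l : eps (ys l) = (sumn l == 0%N)%:R.
Proof. by rewrite /eps lift_ys // => s t /perm_sumn ->. Qed.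

Fixpoint pair_seq (l : seq nat) (b : fock) : C^o :=
  if l is n :: l' then pair_seq l' (G1 n b) else eps b.

Lemma pair_seq_perm : perm_inv pair_seq.
Proof.
apply: (perm_inv_rec (Op := fun n (F : fock -> C^o) b => F (G1 n b))) => // m n s.
by apply/funext => b; rewrite G_comm.
Qed.

Lemma pair_seq_linear l : linear (pair_seq l).
Proof.
elim: l => [|n l IH] k u v /=; first exact: linearP.
by rewrite (linearP (G1 n)) IH.
Qed.

(** [pairing (y_l) (y_m)] is the coefficient of [z^l w^m] in the product of the
    [1 - z_i w_j]. *)
Definition pairing (a b : fock) : C^o := lift (fun l => pair_seq l b) a.

Lemma pairing_ys l b : pairing (ys l) b = pair_seq l b.
Proof. by rewrite /pairing lift_ys // => s t /pair_seq_perm ->. Qed.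

Lemma pairing_linear_l b : linear (pairing^~ b).
Proof. exact: lift_is_linear. Qed.

Definition pairing_l (b a : fock) : C^o := pairing a b.

HB.instance Definition _ b :=
  GRing.isLinear.Build C fock C^o *:%R (pairing_l b) (pairing_linear_l b).

Lemma pairing_linear a : linear (pairing a).
Proof.
move=> k u v; move: a; apply: fock_eq => [|k' a a'|l] /=.
- exact: pairing_linear_l.
- by rewrite !pairing_linear_l !scalerDr !scalerA [k * k']mulrC addrACA.
- by rewrite !pairing_ys pair_seq_linear.
Qed.

HB.instance Definition _ a :=
  GRing.isLinear.Build C fock C^o *:%R (pairing a) (pairing_linear a).

Lemma pairing0l b : pairing 0 b = 0.
Proof. exact: lin0 (pairing_linear_l b). Qed.

Lemma pairing_y (n : nat) a b : pairing (y n a) b = pairing a (G1 n b).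
Proof.
move: a; apply: fock_eq => [k u v|k u v|l].
- by rewrite (linearP (y n)) pairing_linear_l.
- exact: pairing_linear_l.
- by rewrite y_ys !pairing_ys.
Qed.

(** For [h = 1] the factor [(1 - w/z)^h] has two terms. *)
Lemma G1_yS d q (b : fock) :
  G1 d.+1 (y q b) = y q (G1 d.+1 b) - y (q - 1) (G1 d b).
Proof.
rewrite G_y 2!big_ord_recl big1 ?addr0 => [|j _].
  rewrite cbinom0 mul1r scale1r lift0 /= subn0 expr1 mulN1r.
  by rewrite (cbinom_nat R 1 1) binn scaleN1r subSS subn0.
by rewrite !lift0 (cbinom_nat R 1 j.+2) bin_small // mulr0 scale0r.
Qed.

Lemma pairing_y_right (n : nat) a b : pairing a (y n b) = pairing (G1 n a) b.
Proof.
move: a b n; apply: fock_ind => [|l].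
  split=> [b n|k u v Hu Hv b n]; first by rewrite linear0 !pairing0l.
  by rewrite pairing_linear_l (linearP (G1 n)) pairing_linear_l Hu Hv.
elim: l => [|q l IH] b n.
  rewrite pairing_ys G_one /=; case: n => [|n] /=.
    rewrite pairing_ys /=; move: b; apply: fock_eq => [k u v|k u v|l].
    - by rewrite (linearP (y 0)) linearP.
    - by rewrite linearP.
    - by rewrite y_ys !eps_ys.
  rewrite pairing0l; move: b; apply: fock_eq => [k u v|k u v|l].
  - by rewrite (linearP (y _)) linearP.
  - by rewrite scaler0 addr0.
  - by rewrite y_ys eps_ys.
have pN a1 a2 b1 : pairing (a1 - a2) b1 = pairing a1 b1 - pairing a2 b1.
  by rewrite -[LHS]/(pairing_l b1 (a1 - a2)) linearB.
rewrite -y_ys pairing_y; case: q n => [|q] [|n]; rewrite ?G_0.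
- by rewrite IH pairing_y !G_0.
- rewrite IH G1_yS pN pairing_y G_0. by rewrite (y_neg (z := 0 - 1)) // pairing0l subr0.
- rewrite G1_yS linearB /= IH G_0 pairing_y. rewrite (y_neg (z := 0 - 1)) // linear0 subr0. by [].
- rewrite !G1_yS linearB /= pN IH pairing_y; congr (_ - _).
  rewrite (_ : n.+1%:Z - 1 = n); last by lia.
  by rewrite (_ : q.+1%:Z - 1 = q) ?IH ?pairing_y //; lia.
Qed.

Lemma pairing_orth r (w w' : int) s a b : hom r w a -> hom s w' b -> w != w' ->
  pairing a b = 0.
Proof.
move=> ha hb ww; move: a ha; apply: hom_ind => [|l _ lw].
  apply: linear_eq_subspace; first exact: pairing_linear_l.
  by move=> k u v; rewrite scaler0 addr0.
rewrite pairing_ys; elim: l w w' b hb ww lw => [|n l IH] w w' b hb ww lw /=.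
  move: b hb; apply: hom_ind => [|m _ mw].
    by apply: linear_eq_subspace; [exact: linearP|move=> k u v; rewrite scaler0 addr0].
  by rewrite eps_ys; case: eqP => // m0; case/eqP: ww; rewrite -lw -mw m0.
apply: (IH (w - n%:Z) (w' - n%:Z)) => //; first exact: hom_G.
  by apply: contra ww => /eqP e; apply/eqP; lia.
by rewrite -lw /=; lia.
Qed.

(** [Gamma_1(z)] multiplies each of the [s] factors by a polynomial of degree 1 in
    [1/z]. *)
Lemma G1_big s (w : int) b d : hom s w b -> (s < d)%N -> G1 d b = 0.
Proof.
move=> hb sd; move: b hb; apply: hom_ind => [|l ls _].
  by apply: linear_eq_subspace; [exact: linearP|move=> k u v; rewrite scaler0 addr0].
elim: l s d sd ls => [|q l IH] s [//|d] sd ls; first by rewrite G_one.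
have ld : (size l < d)%N by move: sd; rewrite -ls.
by rewrite -y_ys G1_yS !(IH (size l)) ?ltnS ?(ltnW ld) // !linear0 ?subr0 ?addr0.
Qed.

Lemma pairing_y_big (q : int) s (w : int) a b : hom s w b -> s%:Z < q ->
  pairing (y q a) b = 0.
Proof.
case: q => q // hb sq; rewrite pairing_y (G1_big hb) ?linear0 //.
Qed.

Lemma pairing_y_right_big (q : int) r (w : int) a b : hom r w a -> r%:Z < q ->
  pairing a (y q b) = 0.
Proof.
case: q => q // ha rq; rewrite pairing_y_right (G1_big ha) ?pairing0l //.
Qed.

(** The field of [y_0^i] on the right is the product of [i] copies of the creation
    operators and [i] annihilation parts; moved to the left, the former become the
    annihilation part [G i]. *)
Lemma pairing_nseq (h al : C) W i r (wa : int) a s (wb : int) b (w : int) :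
  hom r wa a -> hom s wb b -> wa < W%:Z -> wb < W%:Z -> (0 < W)%N ->
  pairing a (AVs h W al (nseq i 0%N) w b) =
  \sum_(Q < W) \sum_(d < W) (Q%:Z + wb == w + d%:Z)%:R *:
    pairing (G i%:R Q a) (G (h * i%:R) d b).
Proof.
move=> ha hb waW wbW W0; elim: i r wa a s wb b w ha hb waW wbW =>
  [|i IH] r wa a s wb b w ha hb waW wbW.
  rewrite (@sum_only0 _ W (fun Q => \sum_(d < W) (Q%:Z + wb == w + d%:Z)%:R *:
    pairing (G 0 Q a) (G (h * 0) d b))) //.
    rewrite (@sum_only0 _ W (fun d => (0%:Z + wb == w + d%:Z)%:R *:
      pairing (G 0 0 a) (G (h * 0) d b))) //.
      rewrite !G_0 /= (wproj_hom _ hb) addr0 add0r.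
      rewrite -[LHS]/(pairing a (if wb == w then b else 0)).
      by case: eqP => _; [rewrite scale1r|rewrite linear0 scale0r].
    by case=> // d _; rewrite mulr0 (G_zero d.+1) linear0 scaler0.
  case=> // Q _; rewrite big1 // => d _.
  by rewrite (G_zero Q.+1) pairing0l scaler0.
rewrite /= linear_sum /=.
transitivity (\sum_(d < W) \sum_(d2 < W) \sum_(q < W) \sum_(Q < W)
  (Q%:Z + q%:Z + wb == w + (d2 + d)%N%:Z)%:R *:
    pairing (G i%:R Q (G 1 q a)) (G (h * i%:R) d2 (G h d b))).
  apply: eq_bigr => d _; rewrite linear_sum [RHS]exchange_big; apply: eq_bigr => q _ /=.
  rewrite cbinom0 scale1r pairing_y_right.
  rewrite (IH _ _ _ _ _ _ _ (hom_G 1 q ha) (hom_G h d hb)); try lia.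
  rewrite exchange_big; apply: eq_bigr => d2 _; apply: eq_bigr => Q _.
  congr ((_ : bool)%:R *: _); lia.
transitivity (\sum_(d < W) \sum_(d2 < W) \sum_(Q < W)
  (Q%:Z + wb == w + (d2 + d)%N%:Z)%:R *:
    pairing (G i.+1%:R Q a) (G (h * i%:R) d2 (G h d b))).
  apply: eq_bigr => d _; apply: eq_bigr => d2 _.
  pose phi D : {linear fock -> C^o} :=
    (D%:Z + wb == w + (d2 + d)%N%:Z)%:R \*: pairing_l (G (h * i%:R) d2 (G h d b)).
  rewrite -natr1 -[RHS]/(\sum_(Q < W) phi Q (G (i%:R + 1) Q a)).
  by rewrite -(G_add_sum _ _ phi ha waW) exchange_big.
rewrite [LHS]sum_rot3; apply: eq_bigr => Q _; rewrite exchange_big /=.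
pose psi D : {linear fock -> C^o} :=
  (Q%:Z + wb == w + D%:Z)%:R \*: pairing (G (i%:R + 1) Q a).
rewrite -natr1 mulrDr mulr1 -[RHS]/(\sum_(d < W) psi d (G (h * i%:R + h) d b)).
by rewrite -(G_add_sum _ _ psi hb wbW).
Qed.

(** With [h p = 1], the mode of [a = y_0^p] of the field with parameters [h, al] is
    adjoint to a mode of the generator of the field with parameter [p]. *)
Lemma pairing_adjoint (p : nat) (h al : C) W r (wa : int) a s (wb : int) b (w : int) :
  h * p%:R = 1 -> hom r wa a -> hom s wb b -> wa < W%:Z -> wb < W%:Z -> (0 < W)%N ->
  pairing a (AVs h W al (nseq p 0%N) w b) =
  pairing (\sum_(d < W) y (wb - w + d%:Z) (G p%:R d a)) b.
Proof.
move=> hp ha hb waW wbW W0; rewrite (pairing_nseq _ _ _ _ ha hb waW wbW W0) hp.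
rewrite -[RHS]/(pairing_l b _) linear_sum; apply: eq_bigr => Q _ /=.
rewrite /pairing_l; have [z0|z0] := ltP (wb - w + Q%:Z) 0.
  rewrite y_neg // pairing0l big1 // => d _.
  by case: eqP => [e|_]; [lia|rewrite scale0r].
rewrite -[X in y X](gez0_abs z0) pairing_y; set z := `|_|%N.
have zE : wb - w + Q%:Z = z by rewrite gez0_abs.
have [Wz|zW] := leqP W z.
  rewrite (G_big _ hb) ?linear0; last by lia.
  by rewrite big1 // => d _; case: eqP => [e|_]; [have := ltn_ord d; lia|rewrite scale0r].
rewrite (bigD1 (Ordinal zW)) //= big1 ?addr0; last first.
  move=> d dz; case: eqP => [e|_]; last by rewrite scale0r.
  by case/negP: dz; apply/eqP/val_inj => /=; lia.
by rewrite (_ : _ == _) ?scale1r //; apply/eqP; lia.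
Qed.

(** The monomials are indexed by the partitions fitting in a box; the form is
    perfect between [box s r] and [box r s]. *)
Definition box_set (s r : nat) (v : fock) :=
  exists l, [/\ size l = s, all (fun i => i <= r)%N l & v = ys l].
Definition box (s r : nat) : subspace fock := Defs.span (box_set s r).

Lemma box_ind s r (P : fock -> Prop) : is_subspace P ->
  (forall l, size l = s -> all (fun i => i <= r)%N l -> P (ys l)) ->
  forall v, box s r v -> P v.
Proof. by move=> sP Pl v; apply=> // _ [l [ls lr ->]]; exact: Pl. Qed.

Lemma box_ys s r l : size l = s -> all (fun i => i <= r)%N l -> box s r (ys l).
Proof. by move=> ls lr P _; apply; exists l. Qed.

Lemma box_y s r (n : nat) v : (n <= r)%N -> box s r v -> box s.+1 r (y n v).
Proof.
move=> nr; move: v; apply: box_ind => [|l ls lr].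
  exact: (lin_preim (linearP (y n)) (subspaceP (box s.+1 r))).
by rewrite y_ys; apply: box_ys; rewrite /= ?ls ?nr.
Qed.

Lemma box0r s v : box s 0 v -> v = eps v *: ys (nseq s 0%N).
Proof.
move: v; apply: box_ind => [|l ls lr].
  split=> [|k u v eu ev]; first by rewrite linear0 scale0r.
  by rewrite linearP scalerDl -scalerA -eu -ev.
have -> : l = nseq s 0%N.
  by rewrite -ls; apply/all_pred1P; apply: sub_all lr => i; rewrite leqn0.
by rewrite eps_ys sumn_nseq mul0n scale1r.
Qed.

Lemma box0l r v : box 0 r v -> v = eps v *: ys [::].
Proof.
move: v; apply: box_ind => [|[|//] _ _]; last by rewrite eps_ys scale1r.
split=> [|k u v eu ev]; first by rewrite linear0 scale0r.
by rewrite linearP scalerDl -scalerA -eu -ev.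
Qed.

(** In the product of the [y_q - y_(q - 1) z^-1] over the entries, the top power of
    [1/z] selects the second terms. *)
Lemma G1_top l : G1 (size l) (ys l) = (-1) ^+ size l *:
  (if all (fun i => 0 < i)%N l then ys (map predn l) else 0).
Proof.
elim: l => [|q l IH]; first by rewrite G_0 scale1r.
rewrite -y_ys /= G1_yS (G1_big (hom_ys R l)) // linear0 sub0r IH linearZ /=.
rewrite exprS mulN1r scaleNr; congr (- (_ *: _)).
case: q => [|q] /=; first by rewrite y_neg.
by rewrite (_ : q.+1%:Z - 1 = q) ?y_ys; [case: ifP; rewrite ?linear0 // y_ys|lia].
Qed.

Definition up : fock -> fock := lift (fun l => ys (map S l)).
Definition drop0 : fock -> fock :=
  lift (fun l => if 0%N \in l then ys (rem 0%N l) else 0).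

HB.instance Definition _ := GRing.Linear.on up.
HB.instance Definition _ := GRing.Linear.on drop0.

Lemma up_ys l : up (ys l) = ys (map S l).
Proof. by rewrite /up lift_ys // => s t st; apply/ys_perm/perm_map. Qed.

Lemma drop0_ys l : drop0 (ys l) = if 0%N \in l then ys (rem 0%N l) else 0.
Proof.
rewrite /drop0 lift_ys // => s t st; rewrite (perm_mem st); case: ifP => // t0.
apply: ys_perm; rewrite -(perm_cons 0%N); have s0 : 0%N \in s by rewrite (perm_mem st).
by rewrite -(permPl (perm_to_rem s0)) -(permPr (perm_to_rem t0)).
Qed.

(** By [G1_top], the first term collects the monomials without [y_0], and the
    second one the others. *)
Lemma up_drop0 s (w : int) v : hom s w v ->
  v = (-1) ^+ s *: up (G1 s v) + y 0 (drop0 v).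
Proof.
move: v; apply: hom_ind => [|l ls _].
  apply: linear_eq_subspace => // k u v.
  rewrite (linearP (G1 s)) (linearP up) (linearP drop0) (linearP (y 0)).
  by rewrite !scalerDr !scalerA [k * _]mulrC addrACA.
rewrite -ls G1_top linearZ /= scalerA -expr2 sqrr_sign scale1r drop0_ys.
case: ifP => [pos|npos].
  rewrite (_ : (0%N \in l) = false) ?linear0 ?addr0; last first.
    by apply/negP => /(allP pos).
  rewrite up_ys -map_comp; congr ys; rewrite -[LHS]map_id; apply/eq_in_map => i /(allP pos).
  by case: i.
have l0 : 0%N \in l.
  have /allPn[i il] := negbT npos; rewrite -leqNgt leqn0 => /eqP i0.
  by rewrite -i0.
by rewrite linear0 add0r l0 y_ys; apply/ys_perm/perm_to_rem.
Qed.

Lemma box_G1_top s r v : box s r.+1 v -> box s r (G1 s v).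
Proof.
move: v; apply: box_ind => [|l ls lr].
  exact: (lin_preim (linearP (G1 s)) (subspaceP (box s r))).
rewrite -ls G1_top; apply: (subspaceZ _ (subspaceP (box (size l) r))).
case: ifP => _; last by case: (subspaceP (box (size l) r)).
apply: box_ys; first by rewrite size_map.
by rewrite all_map; apply: sub_all lr => i /=; case: i.
Qed.

Lemma box_drop0 s r v : box s.+1 r v -> box s r (drop0 v).
Proof.
move: v; apply: box_ind => [|l ls lr].
  exact: (lin_preim (linearP drop0) (subspaceP (box s r))).
rewrite drop0_ys; case: ifP => l0; last by case: (subspaceP (box s r)).
apply: box_ys; first by rewrite size_rem // ls.
by apply/allP => i /mem_rem /(allP lr).
Qed.

Lemma box_up s r v : box s r v -> box s r.+1 (up v).
Proof.
move: v; apply: box_ind => [|l ls lr].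
  exact: (lin_preim (linearP up) (subspaceP (box s r.+1))).
by rewrite up_ys; apply: box_ys; rewrite ?size_map // all_map.
Qed.

Lemma G1_up s r v : box s r v -> G1 s (up v) = (-1) ^+ s *: v.
Proof.
move: v; apply: box_ind => [|l ls lr].
  by apply: linear_eq_subspace => k u v;
    [rewrite (linearP up) (linearP (G1 s))|rewrite scalerDr !scalerA mulrC].
rewrite up_ys -ls -(size_map S l) G1_top size_map all_map /=.
have -> : all (preim S (fun i => 0 < i)%N) l by apply/allP.
by rewrite -map_comp (map_id l).
Qed.

(** Induction on [s + r]. Pairing with [y_s a] shows that the top coefficient
    [G1 s b] is 0; so all the monomials of [b] contain [y_0], and [b = y_0 b']
    where [b'] satisfies the hypotheses for [s - 1], the adjoint of [y_0] being the
    identity. *)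
Lemma pairing_inj s r b : box s r b ->
  (forall l, size l = r -> pairing (ys l) b = 0) -> b = 0.
Proof.
have [n] := ubnP (s + r); elim: n s r b => // n IH [|s] [|r] b srn hb pb.
- by rewrite (box0l hb); have := pb [::] erefl; rewrite pairing_ys /= => ->; rewrite scale0r.
- rewrite (box0l hb); have := pb (nseq r.+1 0%N) (size_nseq _ _); rewrite pairing_ys.
  have -> : pair_seq (nseq r.+1 0%N) b = eps b.
    by elim: r.+1 => //= i; rewrite G_0.
  by move=> ->; rewrite scale0r.
- by rewrite (box0r hb); have := pb [::] erefl; rewrite pairing_ys /= => ->; rewrite scale0r.
have G0 : G1 s.+1 b = 0.
  apply: (IH s.+1 r); [by move: srn; lia|exact: box_G1_top|move=> l lr].
  by rewrite -pairing_y y_ys pb //= lr.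
have split_b : b = (-1) ^+ s.+1 *: up (G1 s.+1 b) + y 0 (drop0 b).
  move: b hb {pb G0}; apply: box_ind => [|l ls _].
    apply: linear_eq_subspace => // k u v.
    rewrite (linearP (G1 _)) (linearP up) (linearP drop0) (linearP (y 0)).
    by rewrite !scalerDr !scalerA [k * _]mulrC addrACA.
  by apply: up_drop0; rewrite -ls; exact: hom_ys.
rewrite split_b G0 linear0 scaler0 add0r.
rewrite (IH s r.+1 (drop0 b)) ?linear0 //; first exact: box_drop0.
move=> l lr; rewrite -[ys l](G_0 1) -pairing_y_right -[RHS](pb l lr) [in RHS]split_b.
by rewrite G0 linear0 scaler0 add0r.
Qed.

(** The same induction: the vector for [phi] composed with [y_s], with all its
    indices raised by 1, represents [phi] on the monomials containing [y_s]; the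
    remainder vanishes on them, so that it is represented by some [y_0 b2]. *)
Lemma pairing_surj s r (phi : fock -> C^o) : linear phi ->
  (forall l, size l = r -> ~~ all (fun i => i <= s)%N l -> phi (ys l) = 0) ->
  exists b, box s r b /\ forall l, size l = r -> phi (ys l) = pairing (ys l) b.
Proof.
have [n] := ubnP (s + r); elim: n s r phi => // n IH s [|r] phi srn lphi phi0.
  exists (phi (ys [::]) *: ys (nseq s 0%N)); split.
    apply: (subspaceZ _ (subspaceP (box s 0))); apply: box_ys; first exact: size_nseq.
    by apply/allP => i /nseqP[->].
  by case=> // _; rewrite linearZ /= pairing_ys /= eps_ys sumn_nseq mul0n [RHS]mulr1.
case: s srn phi0 => [|s] srn phi0.
  exists (phi (ys (nseq r.+1 0%N)) *: ys [::]); split.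
    by apply: (subspaceZ _ (subspaceP (box 0 r.+1))); apply: box_ys.
  move=> l lr; rewrite linearZ /= pairing_ys.
  have [l0|l0] := boolP (all (fun i => i <= 0)%N l).
    have -> : l = nseq r.+1 0%N.
      by rewrite -lr; apply/all_pred1P; apply: sub_all l0 => i; rewrite leqn0.
    have -> : pair_seq (nseq r.+1 0%N) (ys [::]) = 1.
      by elim: r.+1 => [|i IHi] /=; rewrite ?eps_ys // G_0.
    by rewrite [RHS]mulr1.
  rewrite phi0 //; have -> : pair_seq l (ys [::]) = 0; last by rewrite [RHS]mulr0.
  elim: l l0 {lr} => //= q l IHl; rewrite leqn0 G_one; case: eqP => //= _ _.
  by elim: l {IHl} => [|q' l IHl] /=; rewrite linear0.
have [b1 [hb1 b1P]] := IH s.+1 r (phi \o y s.+1%:Z) (ltac:(lia))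
   (fun k u v => etrans (congr1 phi (linearP (y s.+1%:Z) k u v)) (lphi k _ _))
   (fun l lr ln => etrans (congr1 phi (y_ys R s.+1 l)) (phi0 (s.+1 :: l) (congr1 S lr)
     (ltac:(by rewrite /= leqnn)))).
pose b1' := (-1) ^+ s.+1 *: up b1.
have hb1' : box s.+1 r.+1 b1'.
  by apply: (subspaceZ _ (subspaceP (box s.+1 r.+1))); exact: box_up.
have Gb1' : G1 s.+1 b1' = b1.
  by rewrite linearZ /= (G1_up hb1) scalerA -expr2 sqrr_sign scale1r.
pose phi2 u : C^o := phi u - pairing u b1'.
have lphi2 : linear phi2.
  by move=> k u v; rewrite /phi2 lphi pairing_linear_l opprD addrACA scalerBr.
have phi20 l : size l = r.+1 -> ~~ all (fun i => i <= s)%N l -> phi2 (ys l) = 0.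
  move=> lr /allPn[i il]; rewrite -ltnNge => si.
  rewrite /phi2 (ys_perm _ (perm_to_rem il)) -y_ys.
  have remr : size (rem i l) = r by rewrite size_rem // lr.
  have [is1|is1] := eqVneq i s.+1.
    by rewrite is1 pairing_y Gb1' -b1P ?subrr // -is1.
  rewrite y_ys phi0 ?sub0r /= ?remr //; last by rewrite leqNgt ltn_neqAle eq_sym is1 si.
  rewrite -y_ys pairing_y (_ : G1 i b1' = 0) ?linear0 ?oppr0 //.
  move: b1' hb1' {Gb1' phi2 lphi2}; apply: box_ind => [|l' ls' _].
    by apply: linear_eq_subspace; [exact: linearP|move=> k u v; rewrite scaler0 addr0].
  by apply: G1_big (hom_ys R l') _; rewrite ls' ltn_neqAle eq_sym is1.
have [b2 [hb2 b2P]] := IH s r.+1 phi2 (ltac:(lia)) lphi2 phi20.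
exists (b1' + y 0 b2); split.
  by apply: (subspaceD (subspaceP (box s.+1 r.+1))) => //; exact: box_y.
move=> l lr; rewrite linearD /= pairing_y_right G_0 -b2P // /phi2.
by rewrite addrC subrK.
Qed.

End Pairing.

(** * The form between the two modules *)

Section TwistedPairing.
Variables (R : realType) (p N : nat) (z : R[i]).
Local Notation C := (R[i]).
Local Notation fock := (fock R).
Local Notation ys := (ys R).
Local Notation x0 := (ys [:: 0%N]).

(** The charge in duality with the charge [r]. *)
Definition partner (r : nat) : int := N%:Z - p%:Z * r%:Z.

(** The form restricted to the pairs of dual charges. With [z] for
    [exp(pi i p/2)], the power of [z^-1] compensates for the factor in the contragredient
    action. *)
Definition twisted (b b' : fock) : C^o :=
  lift (fun l => z^-1 ^+ size l *: pairing (ys l) (cproj (partner (size l)) b') : C^o) b.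

Lemma twisted_ys l b' :
  twisted (ys l) b' = z^-1 ^+ size l *: pairing (ys l) (cproj (partner (size l)) b').
Proof.
by rewrite /twisted lift_ys // => s t st; rewrite (perm_size st) (ys_perm _ st).
Qed.

Lemma twisted_linear_l b' : linear (twisted^~ b').
Proof. exact: lift_is_linear. Qed.

Lemma twisted_linear b : linear (twisted b).
Proof.
move=> k u v; move: b; apply: fock_eq => [|k' a a'|l] /=.
- exact: twisted_linear_l.
- by rewrite !twisted_linear_l !scalerDr !scalerA [k * k']mulrC addrACA.
- by rewrite !twisted_ys (linearP (cproj _)) linearP scalerDr !scalerA mulrC.
Qed.

Lemma twisted_charge (r : nat) b b' : charge r b ->
  twisted b b' = z^-1 ^+ r *: pairing b (cproj (partner r) b').
Proof.
move: b; apply: charge_ind => [|l [<-]]; last exact: twisted_ys.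
apply: linear_eq_subspace; first exact: twisted_linear_l.
by move=> k u v; rewrite pairing_linear_l scalerDr !scalerA mulrC.
Qed.

Lemma twisted_hom r (w : int) b s (w' : int) b' : hom r w b -> hom s w' b' ->
  twisted b b' = if (p * r + s == N)%N && (w == w') then z^-1 ^+ r *: pairing b b' else 0.
Proof.
move=> hb hb'; rewrite (twisted_charge _ (hom_charge hb)).
rewrite (cproj_charge _ (hom_charge hb')).
have -> : (s%:Z == partner r) = (p * r + s == N)%N by rewrite /partner; lia.
case: eqP => _ /=; last by rewrite linear0 scaler0.
by case: (eqVneq w w') => // ww; rewrite (pairing_orth hb hb') // scaler0.
Qed.

(** The relations of M_k(m), where [N = k' - m]. *)
Definition trunc_Mk : subspace fock :=
  trunc R (fun=> True) (fun t => N%:Z - p%:Z - p%:Z * t%:Z).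

Lemma twisted_trunc_Mk b b' : trunc_Mk b -> twisted b b' = 0.
Proof.
move=> /(_ (fun b => twisted b b' = 0)); apply.
  apply: linear_eq_subspace; first exact: twisted_linear_l.
  by move=> k u v; rewrite scaler0 addr0.
move=> _ [t [wu [u [e [_ hu te ->]]]]].
rewrite (twisted_charge _ (hom_charge (hom_y e hu))).
suff -> : pairing (y e u) (cproj (partner t.+1) b') = 0 by rewrite scaler0.
have := @charge_cproj R (partner t.+1) b'; move: (cproj _ _).
apply: charge_ind => [|l ls].
  by apply: linear_eq_subspace; [exact: linearP|move=> k a a'; rewrite scaler0 addr0].
by apply: (pairing_y_big _ (hom_ys R l)); move: ls te; rewrite /partner; lia.
Qed.

(** The subspace divided out in RF. When [t + 1 = N - p r], the exponents larger
    than [r] are divided out. *)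
Definition trunc_RF : subspace fock :=
  trunc R (fun t => exists r : int, N%:Z = p%:Z * r + t.+1%:Z)
    (fun t => ((N%:Z - t.+1%:Z) %/ p%:Z)%Z).

Hypothesis p_gt0 : (0 < p)%N.

Lemma partner_div (r : int) t : N%:Z = p%:Z * r + t.+1%:Z ->
  ((N%:Z - t.+1%:Z) %/ p%:Z)%Z = r.
Proof. by move=> ->; rewrite addrK mulKz //; lia. Qed.

Lemma twisted_trunc_RF b b' : trunc_RF b' -> twisted b b' = 0.
Proof.
move=> /(_ (fun b' => twisted b b' = 0)); apply.
  apply: linear_eq_subspace; first exact: twisted_linear.
  by move=> k u v; rewrite scaler0 addr0.
move=> _ [t [wu [u [e [[r rE] hu re ->]]]]].
rewrite (partner_div rE) in re.
move: b; apply: fock_eq => [|k u' v'|l]; first exact: twisted_linear_l.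
  by rewrite scaler0 addr0.
rewrite (twisted_hom (hom_ys R l) (hom_y e hu)); case: ifP => // /andP[/eqP lt _].
rewrite (pairing_y_right_big _ (hom_ys R l)) ?scaler0 //.
suff -> : (size l)%:Z = r by [].
have p0 : p%:Z != 0 by lia.
by apply: (mulfI p0); lia.
Qed.

(** The charges which occur in RF. *)
Definition residue : subspace fock :=
  Defs.span (fun v => exists l, (exists r : int, N%:Z = p%:Z * r + (size l)%:Z) /\ v = ys l).

(** Monomials representing a basis of RF. *)
Definition normal : subspace fock :=
  Defs.span (fun v => exists l r, [/\ (p * r + size l)%N = N,
    all (fun i => i <= r)%N l & v = ys l]).

(** A monomial of charge [N - p r] with an index larger than [r] is divided out; in
    particular all of them are if [r < 0]. *)
Lemma residue_split b : residue b -> exists v, normal v /\ trunc_RF (b - v).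
Proof.
have [n0 nD] := subspaceP normal; have [t0 tD] := subspaceP trunc_RF.
move=> /(_ (fun b => exists v, normal v /\ trunc_RF (b - v))); apply.
  split=> [|k u u' [v [nv tv]] [v' [nv' tv']]]; first by exists 0; rewrite subr0.
  exists (k *: v + v'); split; first exact: nD.
  by rewrite opprD addrACA -scalerBr; exact: tD.
move=> _ [l [[r rE] ->]].
have [/hasP [i il ri]|] := boolP (has (fun i : nat => r < i%:Z) l).
  exists 0; split=> //; rewrite subr0 => A _; apply.
  have ls : size l = (size (rem i l)).+1 by rewrite size_rem //; case: l il {rE}.
  exists (size (rem i l)), (sumn (rem i l)), (ys (rem i l)), i%:Z; split.
  - by exists r; rewrite -ls.
  - exact: hom_ys.
  - by rewrite (partner_div (r := r)) // -ls.
  - by rewrite y_ys; apply/ys_perm/perm_to_rem.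
move/hasPn => lr; exists (ys l); rewrite subrr; split=> //.
have r0 : 0 <= r.
  rewrite leNgt; apply/negP => r0; case: l rE lr => [|i l] rE lr.
    by move: rE => /=; nia.
  by have := lr i; rewrite mem_head => /(_ isT); lia.
move=> A _; apply; exists l, `|r|%N; split=> //; first by nia.
by apply/allP => i /lr; lia.
Qed.

Lemma normal_cproj (r s : nat) v : (p * r + s)%N = N -> normal v -> box R s r (cproj s v).
Proof.
move=> rs /(_ (fun v => box R s r (cproj s v))); apply.
  exact: (lin_preim (linearP (cproj s)) (subspaceP (box R s r))).
move=> _ [l [r' [lr' lr ->]]]; rewrite (cproj_charge _ (@charge_ys R l)).
case: eqP => [[ls]|_]; last by case: (subspaceP (box R s r)).
apply: box_ys => //; suff -> : r = r' by [].
by apply/eqP; rewrite -(eqn_pmul2l p_gt0); apply/eqP; move: lr'; rewrite ls; lia.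
Qed.

Lemma normal_cproj0 (s : nat) v : (forall r : nat, (p * r + s)%N <> N) -> normal v ->
  cproj s v = 0.
Proof.
move=> rs /(_ (fun v => cproj s v = 0)); apply.
  by apply: linear_eq_subspace; [exact: linearP|move=> k a a'; rewrite scaler0 addr0].
move=> _ [l [r' [lr' lr ->]]]; rewrite (cproj_charge _ (@charge_ys R l)).
by case: eqP => // -[ls]; case: (rs r'); rewrite -ls.
Qed.

Hypothesis z0 : z != 0.

Lemma normal_inj v : normal v -> (forall b, twisted b v = 0) -> v = 0.
Proof.
move=> nv tv; have [n /(_ n (leqnn n)) ->] := cproj_sum v.
apply: big1 => s _; have [[r rs]|nrs] := pselect (exists r : nat, (p * r + s)%N = N); last first.
  by apply: normal_cproj0 => // r rs; apply: nrs; exists r.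
apply: (pairing_inj (normal_cproj rs nv)) => l lr.
have := tv (ys l); rewrite twisted_ys lr (_ : partner r = s); last by rewrite /partner; lia.
move/eqP; rewrite scaler_eq0 expf_eq0 invr_eq0 (negPf z0) andbF /=.
by move/eqP.
Qed.

Lemma twisted_inj b' : residue b' -> (forall b, twisted b b' = 0) -> trunc_RF b'.
Proof.
move=> /residue_split [v [nv tv]] tb.
suff v0 : v = 0 by move: tv; rewrite v0 subr0.
apply: normal_inj => // b; rewrite -[v](subKr b').
have -> : b' - (b' - v) = - 1 *: (b' - v) + b' by rewrite scaleN1r addrC.
by rewrite twisted_linear tb (twisted_trunc_RF _ tv) scaler0 addr0.
Qed.

Lemma big_part_trunc_Mk (l : seq nat) (i : nat) : i \in l -> partner (size l) < i%:Z -> trunc_Mk (ys l).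
Proof.
move=> il li A _; apply.
have ls : size l = (size (rem i l)).+1 by rewrite size_rem //; case: l il {li}.
exists (size (rem i l)), (sumn (rem i l)), (ys (rem i l)), i%:Z; split=> //.
- exact: hom_ys.
- by move: li; rewrite /partner ls; lia.
- by rewrite y_ys; apply/ys_perm/perm_to_rem.
Qed.

(** In each charge [r] this is [pairing_surj]. For [p r > N] the functional
    vanishes, so that finitely many charges contribute. *)
Lemma twisted_surj (phi : fock -> C^o) : linear phi ->
  (forall b, trunc_Mk b -> phi b = 0) ->
  exists b', residue b' /\ forall b, phi b = twisted b b'.
Proof.
move=> lphi phi0.
have phir (r : nat) : exists b, forall s : nat, (p * r + s)%N = N -> box R s r b /\
    forall l, size l = r -> z ^+ r *: phi (ys l) = pairing (ys l) b.
  have [rN|rN] := leqP (p * r) N; last by exists 0 => s; lia.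
  have [||b [bb bE]] := @pairing_surj R (N - p * r) r (fun b => z ^+ r *: phi b : C^o).
  - by move=> k u v; rewrite lphi scalerDr !scalerA mulrC.
  - move=> l lr /allPn[i il] ni; rewrite phi0 ?scaler0 //.
    by apply: big_part_trunc_Mk il _; rewrite /partner lr; lia.
  exists b => s sE; rewrite (_ : s = (N - p * r)%N); last by lia.
  by split.
have {phir} [beta betaP] := choice phir.
pose b' := \sum_(r < N.+1 | (p * r <= N)%N) beta r.
have resb (r : nat) : (p * r <= N)%N -> residue (beta r).
  move=> rN; have [] := betaP r (N - p * r)%N; first by lia.
  move=> bb _; move: (beta r) bb; apply: box_ind => [|l ls _]; first exact: subspaceP.
  by move=> A _; apply; exists l; split=> //; exists r%:Z; lia.
exists b'; split.
  by rewrite /b'; elim/big_rec: _ => [|r u rN ru]; [case: (subspaceP residue)|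
     apply: (subspaceD (subspaceP residue)) => //; exact: resb].
apply: fock_eq => // [|l]; first exact: twisted_linear_l.
rewrite twisted_ys; have [lN|lN] := leqP (p * size l) N; last first.
  have [i il] : exists i : nat, i \in l by case: l lN => [|i l] lN; [move: lN => /=; lia|exists i; rewrite mem_head].
  rewrite phi0; last by apply: big_part_trunc_Mk il _; rewrite /partner; lia.
  suff -> : cproj (partner (size l)) b' = 0 by rewrite linear0 scaler0.
  move: b'; apply: fock_eq => [|k u v|l']; first exact: linearP.
    by rewrite scaler0 addr0.
  rewrite (cproj_charge _ (@charge_ys R l')); case: eqP => // e; move: e lN; rewrite /partner; lia.
have pE : partner (size l) = (N - p * size l)%N by rewrite /partner; lia.
have sE : (p * size l + (N - p * size l))%N = N by lia.
have -> : cproj (partner (size l)) b' = beta (size l).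
  have lN1 : (size l < N.+1)%N by nia.
  rewrite /b' linear_sum (bigD1 (Ordinal lN1)) //= big1 ?addr0 => [|r /andP[rN rl]].
    have [bb _] := betaP _ _ sE; rewrite pE.
    move: (beta _) bb; apply: box_ind => [|l' ls _].
      by apply: linear_eq_subspace => //; exact: linearP.
    by rewrite (cproj_charge _ (@charge_ys R l')) ls eqxx.
  have sE' : (p * r + (N - p * r))%N = N by lia.
  have [bb _] := betaP _ _ sE'; rewrite pE.
  move: (beta _) bb; apply: box_ind => [|l' ls _].
    by apply: linear_eq_subspace; [exact: linearP|move=> k a a'; rewrite scaler0 addr0].
  rewrite (cproj_charge _ (@charge_ys R l')) ls; case: eqP => // -[e].
  case/eqP: rl; apply/val_inj => /=.
  by apply/eqP; rewrite -(eqn_pmul2l p_gt0); apply/eqP; lia.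
have [_ <-] := betaP _ _ sE; last by [].
by rewrite scalerA -exprMn mulVf // expr1n scale1r.
Qed.

(** This is [pairing_adjoint] when the charges are in duality, and otherwise both
    sides vanish: raising the charge on the right by [p] is equivalent to raising
    the charge on the left by 1. *)
Lemma twisted_adjoint (m n : int) b b' :
  let c := (- (m + N%:Z))%:~R / p%:R in
  twisted b (act (p%:R)^-1 c (ys (nseq p 0%N)) n%:~R b') =
  z *: twisted (act p%:R m%:~R x0 (- n + p%:Z - 2)%:~R b) b'.
Proof.
move=> c; move: b; apply: fock_eq => [|k u v|l]; first exact: twisted_linear_l.
  by rewrite act_linear twisted_linear_l scalerDr !scalerA mulrC.
move: b'; apply: fock_eq => [k u v|k u v|l'].
- by rewrite act_linear twisted_linear.
- by rewrite twisted_linear scalerDr !scalerA mulrC.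
have cl1 : charge (size l).+1 (act p%:R m%:~R x0 (- n + p%:Z - 2)%:~R (ys l)).
  have := act_charge p%:R m%:~R (- n + p%:Z - 2)%:~R (@charge_ys R [:: 0%N]) (@charge_ys R l).
  by rewrite -PoszD add1n.
rewrite twisted_ys (twisted_charge _ cl1).
have cl2 : charge (p + size l')%N (act (p%:R)^-1 c (ys (nseq p 0%N)) n%:~R (ys l')).
  have := act_charge (p%:R)^-1 c n%:~R (@charge_ys R (nseq p 0%N)) (@charge_ys R l').
  by rewrite size_nseq -PoszD.
rewrite (cproj_charge _ cl2) (cproj_charge _ (@charge_ys R l')).
have -> : ((p + size l')%N%:Z == partner (size l)) = ((size l')%:Z == partner (size l).+1).
  by rewrite /partner; lia.
case: eqP => [lE|_]; last by rewrite !linear0 ?scaler0.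
rewrite exprS scalerA mulrA divff // mul1r; congr (_ *: _).
have hb := hom_ys R l; have hb' := hom_ys R l'.
have p0 : (p%:R : C) != 0 by rewrite pnatr_eq0; lia.
(* The weight of the value, forced by the mode [n] since [p c = - (m + N)]. *)
pose w : int := (sumn l')%:Z - 1 - n + m + N%:Z - (size l')%:Z.
have [W [wW lW l'W W0]] : exists W, [/\ w < W%:Z, (sumn l)%:Z < W%:Z, (sumn l')%:Z < W%:Z & (0 < W)%N].
  by exists (`|w| + sumn l + sumn l').+1; split; lia.
have hp : hom p 0 (ys (nseq p 0%N)).
  by have := hom_ys R (nseq p 0%N); rewrite size_nseq sumn_nseq mul0n.
rewrite (act_eq (W := W) (w := w) hp hb') //; last first.
  rewrite mulrDr mulrA divff // mul1r /c mulrCA divff // mulr1.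
  by rewrite /w !(rmorphB, rmorphD, rmorphN) /= -!pmulrn; ring.
rewrite AV_ys (pairing_adjoint _ _ (mulVf p0) hb hb') //.
congr (pairing _ _).
rewrite -(act_x p%:R m%:~R _ hb lW); congr act.
have lE' : (size l')%:~R = N%:R - p%:R * ((size l)%:R + 1) :> C.
  by move: lE; rewrite /partner => ->; rewrite rmorphB rmorphM /= -!pmulrn natr1.
rewrite /w !(rmorphB, rmorphD, rmorphN) /= lE' -!pmulrn; ring.
Qed.

End TwistedPairing.

(** * Subquotients and bidegrees *)

Section SubQuotient.
Variables (R : realType) (U : lmodType R[i]) (A B : subspace U).

Lemma val_into u : A u -> subspace_val (into A u) = u.
Proof. by move=> Au; rewrite -[LHS]/(val (into A u)) /into insubdK //; apply/asboolP. Qed.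

Lemma subspace_valP (u : subspace_type A) : A (subspace_val u).
Proof. by apply/asboolP; exact: (valP u). Qed.

Lemma subcls_eq u u' : A u -> A u' -> (subcls A B u = subcls A B u' <-> B (u - u')).
Proof.
move=> Au Au'; rewrite /subcls cls_eqP -[X in X <-> _]/(B (val (into A u - into A u'))).
rewrite (raddfB val) /=.
by rewrite !val_into.
Qed.

Lemma subcls_linear k u u' : A u -> A u' ->
  subcls A B (k *: u + u') = k *: subcls A B u + subcls A B u'.
Proof.
move=> Au Au'; rewrite /subcls -cls_is_linear; congr cls; apply: val_inj.
rewrite -![val _]/(subspace_val _) subspace_val_is_linear !val_into //.
exact: (subspaceP A).2.
Qed.

Lemma subcls_rep q : subcls A B (subspace_val (rep q)) = q.
Proof.
rewrite /subcls (_ : into A _ = rep q) ?repK //.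
by apply: val_inj; rewrite -![val _]/(subspace_val _) val_into //; exact: subspace_valP.
Qed.

(** The operator is defined by means of a representative; stability of [B] makes
    it independent of the choice. *)
Lemma subop_cls f u : linear f -> (forall w, A w -> A (f w)) ->
  (forall w, A w -> B w -> B (f w)) -> A u ->
  subop f (subcls A B u) = subcls A B (f u).
Proof.
move=> lf fA fB Au; set q := subcls A B u.
have Aq := subspace_valP (rep q).
apply/subcls_eq; [exact: fA|exact: fA|].
have -> : f (subspace_val (rep q)) - f u = f (subspace_val (rep q) - u).
  have := lf (-1) u (subspace_val (rep q)).
  by rewrite !scaleN1r ![- _ + _]addrC => ->.
have Bq : B (subspace_val (rep q) - u) by apply/subcls_eq => //; rewrite subcls_rep.
apply: fB => //; rewrite addrC -scaleN1r; exact: (subspaceP A).2.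
Qed.

End SubQuotient.

Section MkDegrees.
Variables (R : realType) (p : nat) (m : int).
Local Notation C := (R[i]).
Local Notation h := (p%:R : C).
Local Notation c := (m%:~R : C).
Local Notation fock := (fock R).
Local Notation ys := (ys R).
Local Notation x0 := (ys [:: 0%N]).
Variables (Fp : gva h) (a : Fp) (M : gmod Fp 0) (v : M) (Ps : fock -> M).
Hypothesis lPs : linear Ps.
Hypothesis Ps1 : Ps (ys [::]) = v.
Hypothesis PsE : forall b n, Ps (act h c x0 n b) = gmod_act a n (Ps b).
Variables (S E : C).

Lemma Mk_deg_hom r (w : int) b : hom r w b ->
  @bg_deg R (Mk_bg a v S E) (S + r%:R) (E + energy h c (h / 2) r w) (Ps b).
Proof.
move=> hb; have I1 (e : int) (s : nat) : exists i : int, 1 + e%:~R + (c + h * s%:R) = i%:~R.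
  by exists (1 + e + (m + p%:Z * s%:Z)); rewrite !(rmorphD, rmorphM) /= -!pmulrn.
have := mmono_span (I := fun n => exists i : int, n = i%:~R) I1 hb.
move=> /(_ (fun b => @bg_deg R (Mk_bg a v S E) (S + r%:R) (E + energy h c (h / 2) r w) (Ps b))).
apply; first exact: (lin_preim lPs (span_is_subspace _)).
move=> _ [ns [-> nr In nsE]] A _; apply.
have {In} [js jsE] : exists js : seq int, ns = [seq n%:~R | n <- js].
  elim: ns In {nr nsE} => [|n ns IH] In; first by exists [::].
  have [i nE] := In n (mem_head _ _); have [js jsE] := IH (fun n' n'i =>
    In n' (mem_behead (s := n :: ns) n'i)).
  by exists (i :: js); rewrite /= -nE -jsE.
exists js; rewrite /= -jsE (mmono_monomial Ps1 PsE); split=> //.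
by split; rewrite ?nr // nsE.
Qed.

(** Each monomial in the modes of the generator is the image of a homogeneous
    polynomial, possibly 0. *)
Lemma Mk_deg_ind s e u (P : M -> Prop) : is_subspace P ->
  (forall r (w : int) b, hom r w b -> s = S + r%:R -> e = E + energy h c (h / 2) r w -> P (Ps b)) ->
  @bg_deg R (Mk_bg a v S E) s e u -> P u.
Proof.
move=> sP Pb; apply=> // _ [js /= [-> [sE eE]]].
rewrite -(mmono_monomial Ps1 PsE); move: {js}[seq _ | _ <- js] sE eE => ns sE eE.
have [w [hw [->|nE]]] := mmono_hom h c ns; first by rewrite (lin0 lPs); case: sP.
by apply: Pb hw sE _; rewrite eE nE.
Qed.

End MkDegrees.

Section RFDegrees.
Variables (R : realType) (p : nat) (m : int).
Local Notation C := (R[i]).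
Local Notation h := ((p%:R : C)^-1).
Local Notation c := ((m%:~R : C) / p%:R).
Local Notation fock := (fock R).
Local Notation ys := (ys R).
Local Notation x0 := (ys [:: 0%N]).
Variables (F1p : gva h) (x : F1p) (M : gmod F1p m%:~R) (v : M) (Ps : fock -> M).
Hypothesis lPs : linear Ps.
Hypothesis Ps1 : Ps (ys [::]) = v.
Hypothesis PsE : forall b n, Ps (act h c x0 n b) = gmod_act x n (Ps b).
Hypothesis Ps_inj : injective Ps.
Hypothesis Ps_surj : forall u, exists b, Ps b = u.

Definition part (j : int) : subspace fock :=
  Defs.span (fun b => exists l, (m + (size l)%:Z = j %[mod p%:Z])%Z /\ b = ys l).

Lemma part_hom j r (w : int) b : (m + r%:Z = j %[mod p%:Z])%Z -> hom r w b -> part j b.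
Proof.
move=> rj; move: b; apply: hom_ind => [|l lr _]; first exact: subspaceP.
by move=> A _; apply; exists l; rewrite lr.
Qed.

(** Sorting by charge is possible in the module because [Psi] is injective. *)
Lemma Mcirc_partE j b : Mcirc_part x v j (Ps b) <-> part j b.
Proof.
split=> [Ab|].
  suff [b' [/Ps_inj -> //]] : exists b', Ps b = Ps b' /\ part j b'.
  move: Ab => /(_ (fun u => exists b', u = Ps b' /\ part j b')); apply.
    split; first by exists 0; rewrite (lin0 lPs); split=> //; case: (subspaceP (part j)).
    move=> k _ _ [b1 [-> j1]] [b2 [-> j2]]; exists (k *: b1 + b2); rewrite lPs.
    by split=> //; apply: (subspaceP (part j)).2.
  move=> _ [ns [-> nsj]]; exists (mmono h c ns); rewrite (mmono_monomial Ps1 PsE).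
  by split=> //; have [w [hw _]] := mmono_hom h c ns; exact: part_hom hw.
move=> /(_ (fun b => Mcirc_part x v j (Ps b))); apply.
  exact: (lin_preim lPs (subspaceP _)).
move=> _ [l [lj ->]].
have := mmono_span (I := fun=> True) (fun _ _ => Logic.I) (hom_ys R l).
move=> /(_ h c (fun b => Mcirc_part x v j (Ps b))); apply.
  exact: (lin_preim lPs (subspaceP _)).
move=> _ [ns [-> nl _ _]] A _; apply; exists ns.
by rewrite (mmono_monomial Ps1 PsE) nl.
Qed.

(** On charge [t] with [t + 1 = N - p r], the modes [- k/p - n] are the exponents
    [r + 1 + n]. *)
Lemma RF_kernelE (N : nat) (k : int) b : (0 < p)%N -> m + N%:Z = k + 1 - 2 * p%:Z ->
  RF_kernel x k v (Ps b) <-> trunc_RF R p N b.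
Proof.
move=> p_gt0 kE; have p0 : (p%:R : C) != 0 by rewrite pnatr_eq0; lia.
rewrite /trunc_RF -(mode_trunc h c).
set D := (X in mode_trunc_set _ _ X _); set be := (X in mode_trunc_set _ _ _ X).
have modeE (n : nat) t (r : int) : N%:Z = p%:Z * r + t.+1%:Z ->
    - (k%:~R / p%:R) - n%:R = - 1 - (r + 1 + n%:Z)%:~R - (c + h * t%:R) :> C.
  move=> NE.
  have -> : k%:~R = m%:~R + (p%:R * r%:~R + (t%:R + 1)) - 1 + 2 * p%:R :> C.
    have -> : k = m + (p%:Z * r + (t%:Z + 1)) - 1 + 2 * p%:Z by lia.
    by rewrite !(rmorphD, rmorphB, rmorphM) /= -!pmulrn.
  by rewrite !rmorphD /= -!pmulrn; field.
split=> [Kb|].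
  suff [b' [/Ps_inj -> //]] : exists b', Ps b = Ps b' /\ span_set (mode_trunc_set h c D be) b'.
  move: Kb => /(_ (fun u => exists b', u = Ps b' /\ span_set (mode_trunc_set h c D be) b')).
  have sS := span_is_subspace (mode_trunc_set h c D be).
  apply.
    split; first by exists 0; rewrite (lin0 lPs); split=> //; case: sS.
    move=> z _ _ [b1 [-> j1]] [b2 [-> j2]]; exists (z *: b1 + b2); rewrite lPs.
    by split=> //; apply: sS.2.
  move=> _ [n [w [pw ->]]]; have [b' bw] := Ps_surj w; rewrite -bw in pw *.
  exists (act h c x0 (- (k%:~R / p%:R) - n%:R) b'); rewrite PsE; split=> //.
  move/Mcirc_partE: pw.
  move=> /(_ (fun b => span_set (mode_trunc_set h c D be) (act h c x0 (- (k%:~R / p%:R) - n%:R) b))).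
  apply; first exact: (lin_preim (act_linear _ _ _ _) sS).
  move=> _ [l [/eqP + ->]]; rewrite eqz_mod_dvd => /dvdzP[q qE] A _; apply.
  have NE : N%:Z = p%:Z * (- 2 - q) + (size l).+1%:Z by lia.
  exists (size l), (sumn l), (ys l), (- 2 - q + 1 + n%:Z); split.
  - by exists (- 2 - q).
  - exact: hom_ys.
  - by rewrite /be (partner_div p_gt0 NE); lia.
  - by rewrite (modeE _ _ _ NE).
move=> /(_ (fun b => RF_kernel x k v (Ps b))); apply.
  exact: (lin_preim lPs (subspaceP _)).
move=> _ [t [wu [u [e [[r NE] hu re ->]]]]].
rewrite /be (partner_div p_gt0 NE) in re.
move=> A _; apply; exists `|(e - r - 1)%R|%N, (Ps u); split.
  apply/Mcirc_partE; apply: part_hom hu; apply/eqP; rewrite eqz_mod_dvd; apply/dvdzP.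
  by exists (- 2 - r); lia.
rewrite (modeE _ _ _ NE) PsE; congr (gmod_act x (_ - _%:~R - _) _); lia.
Qed.

Variables (k : int) (S E : C).
Local Notation A := (Mcirc_part x v (k + 1)).
Local Notation B := (RF_kernel x k v).

Lemma RF_deg_hom r (w : int) b : (m + r%:Z = k + 1 %[mod p%:Z])%Z -> hom r w b ->
  @bg_deg R (RF_bg x k v S E) (S + h *+ r) (E + energy h c (2 * p%:R)^-1 r w)
    (subcls A B (Ps b)).
Proof.
move=> rk hb.
set s := S + _; set e := E + _.
pose D (q : subquotient A B) := span_set (fun q => exists ns : seq C,
  [/\ A (monomial x ns v), q = subcls A B (monomial x ns v)
    & has_bidegree h (2 * p%:R)^-1 S E ns s e]) q.
have sD : is_subspace D by exact: span_is_subspace.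
rewrite -[bg_deg _ _ _]/(D (subcls A B (Ps b))).
have /(_ h c (fun b => A (Ps b) /\ D (subcls A B (Ps b)))) :=
  mmono_span (I := fun=> True) (fun _ _ => Logic.I) hb.
case=> //.
  split=> [|z u u' [Au Du] [Au' Du']].
    rewrite (lin0 lPs); split; first by case: (subspaceP A).
    have := @subcls_linear R M A B (-1) 0 0; rewrite scaler0 addr0 scaleN1r addNr => ->.
      by case: sD.
    by case: (subspaceP A).
    by case: (subspaceP A).
  rewrite lPs subcls_linear //; split; first exact: (subspaceP A).2.
  exact: sD.2.
move=> _ [ns [-> nr _ nsE]].
have An : A (Ps (mmono h c ns)).
  by apply/Mcirc_partE; have [w' [hw _]] := mmono_hom h c ns; apply: part_hom hw; rewrite nr.
split=> // P _; apply; exists ns; rewrite -(mmono_monomial Ps1 PsE); split=> //.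
by rewrite /s /e; split; rewrite ?nr // nsE.
Qed.

Lemma RF_deg_ind s e q (P : subquotient A B -> Prop) : is_subspace P ->
  (forall r (w : int) b, hom r w b -> A (Ps b) ->
     b = 0 \/ s = S + h *+ r /\ e = E + energy h c (2 * p%:R)^-1 r w ->
     P (subcls A B (Ps b))) ->
  @bg_deg R (RF_bg x k v S E) s e q -> P q.
Proof.
move=> sP Pb; apply=> // _ [ns [An -> [sE eE]]].
rewrite -(mmono_monomial Ps1 PsE) in An *.
have [w [hw nE]] := mmono_hom h c ns; apply: Pb hw An _.
by case: nE => [->|nE]; [left|right; split=> //; rewrite eE nE].
Qed.

End RFDegrees.

(** * The duality *)

Section Duality.
Variables (R : realType) (p : nat).
Hypothesis p_gt0 : (0 < p)%N.
Local Notation C := (R[i]).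
Local Notation fock := (fock R).
Local Notation ys := (ys R).
Local Notation x0 := (ys [:: 0%N]).
Variables (Fp : gva (p%:R : C)) (a : Fp) (F1p : gva ((p%:R : C)^-1)) (x : F1p).
Hypotheses (Fp_free : is_free_gva a) (F1p_free : is_free_gva x).
Variables (k m : int) (N : nat) (j : int).
Hypotheses (kE : k - 2 - m = N%:Z - p%:Z) (jE : j = 2 * p%:Z - m - 1).
Variables (M : gmod Fp 0) (v : M) (Mc : gmod F1p (- (m + N%:Z))%:~R) (vc : Mc).
Hypotheses (M_free : is_Mk a k m v) (Mc_free : is_Mcirc x vc).
Variables (S E : C).

Local Notation z := (expipi (p%:R / 2 : C)).
Local Notation c' := ((- (m + N%:Z))%:~R / p%:R : C).
Local Notation PM := (Psi p%:R m%:~R (gmod_act a) v).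
Local Notation PC := (Psi (p%:R)^-1 c' (gmod_act x) vc).
Local Notation tw := (twisted p N z).
Local Notation A := (Mcirc_part x vc (j + 1)).
Local Notation B := (RF_kernel x j vc).
Local Notation SM := (S + m%:~R / p%:R).
Local Notation EM := (E + m%:~R ^+ 2 / (2 * p%:R)).
Local Notation SR := (- S - (m + N%:Z)%:~R / p%:R).
Local Notation ER := (E + (m + N%:Z)%:~R ^+ 2 / (2 * p%:R)).
Local Notation MM := (Mk_bg a v SM EM).
Local Notation RF := (RF_bg x j vc SR ER).

Let pC : (p%:R : C) != 0. Proof. by rewrite pnatr_eq0; lia. Qed.

Lemma PM_linear : linear PM. Proof. exact: linearP. Qed.
Lemma PC_linear : linear PC. Proof. exact: linearP. Qed.

Lemma PM_kernel b : PM b = 0 <-> trunc_Mk R p N b.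
Proof.
have [_ _ ->] := Mk_presentation Fp_free M_free; rewrite relations_trunc /trunc_Mk.
by rewrite (_ : (fun t => _) = (fun t : nat => N%:Z - p%:Z - p%:Z * t%:Z)) // -kE.
Qed.

Lemma twisted_PM b1 b2 b' : PM b1 = PM b2 -> tw b1 b' = tw b2 b'.
Proof.
move=> e; have : trunc_Mk R p N (-1 *: b2 + b1).
  by apply/PM_kernel; rewrite PM_linear e scaleN1r addNr.
move=> tr; have := twisted_trunc_Mk z b' tr; rewrite twisted_linear_l scaleN1r addrC.
by move/eqP; rewrite subr_eq0 => /eqP.
Qed.

Lemma residueP (s : nat) : (exists r : int, N%:Z = p%:Z * r + s%:Z) <->
  (- (m + N%:Z) + s%:Z = j + 1 %[mod p%:Z])%Z.
Proof.
split=> [[r rE]|/eqP].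
  (* The shift by 2 comes from [j + 1 = 2 p - m]. *)
  by apply/eqP; rewrite eqz_mod_dvd; apply/dvdzP; exists (- 2 - r); rewrite jE; lia.
by rewrite eqz_mod_dvd => /dvdzP[q qE]; exists (- 2 - q); lia.
Qed.

Lemma part_residue b : A (PC b) <-> residue R p N b.
Proof.
have [PCs PCE PCi _] := Mcirc_presentation F1p_free Mc_free.
rewrite (Mcirc_partE PC_linear (Psi_one _ _ _ _) PCE PCi).
split=> H D sD DX; apply: (H D sD) => _ [l [lj ->]]; apply: DX; exists l;
  by split=> //; apply/residueP.
Qed.

Lemma kernel_trunc b : B (PC b) <-> trunc_RF R p N b.
Proof.
have [PCs PCE PCi _] := Mcirc_presentation F1p_free Mc_free.
apply: (RF_kernelE PC_linear (Psi_one _ _ _ _) PCE PCi PCs) => //.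
by rewrite jE; lia.
Qed.

(** Both energies are [E + (m + p r)^2 / (2 p) + w], since [m + p r] is
    [m + N - s]. *)
Lemma dual_bidegree (r s : nat) (w : int) : (p * r + s)%N = N ->
  SM + r%:R = - (SR + (p%:R)^-1 *+ s) /\
  EM + energy p%:R m%:~R (p%:R / 2) r w =
    ER + energy (p%:R)^-1 c' (2 * p%:R)^-1 s w.
Proof.
move=> rs; have NE : N%:Z%:~R = p%:R * r%:R + s%:R :> C by rewrite -rs -pmulrn natrD natrM.
rewrite /energy !(rmorphN, rmorphD) /= NE -mulr_natr.
by split; field.
Qed.

Lemma bidegree_inj (r r' : nat) (w w' : int) : SM + r%:R = SM + r'%:R ->
  EM + energy p%:R m%:~R (p%:R / 2) r w = EM + energy p%:R m%:~R (p%:R / 2) r' w' ->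
  r = r' /\ w = w'.
Proof.
move=> /addrI /eqP; rewrite eqr_nat => /eqP <- /addrI.
by rewrite /energy -!addrA => /addIr /intr_inj.
Qed.

Local Notation dual := (subspace_type (restricted_dual MM)).

(** The functionals on M_k(m) are the forms [twisted _ b'], where [b'] is unique
    modulo [trunc_RF]. *)
Definition represents (phi : dual) (b' : fock) :=
  residue R p N b' /\ forall b, subspace_val phi (PM b) = tw b b'.

Lemma dual_linear (phi : dual) : linear (subspace_val phi).
Proof. by have [] := subspace_valP phi. Qed.

Lemma represents_exists phi : exists b', represents phi b'.
Proof.
apply: (@twisted_surj R p N z p_gt0 (expipi_neq0 _) (fun b => subspace_val phi (PM b))) =>
  [k1 u u'|b /PM_kernel ->].
  by rewrite PM_linear dual_linear.
exact: lin0 (dual_linear phi).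
Qed.

Lemma MM_deg_ind s e u (P : M -> Prop) : is_subspace P ->
  (forall r (w : int) b, hom r w b -> s = SM + r%:R ->
     e = EM + energy p%:R m%:~R (p%:R / 2) r w -> P (PM b)) ->
  bg_deg (b := MM) s e u -> P u.
Proof.
have [PMs PME _] := Mk_presentation Fp_free M_free.
exact: (Mk_deg_ind PM_linear (Psi_one _ _ _ _) PME).
Qed.

(** Only finitely many bidegrees contribute: a monomial [y_l] pairs non-trivially
    with one charge and one weight at most. *)
Lemma represented b' : exists phi : dual, forall b, subspace_val phi (PM b) = tw b b'.
Proof.
have [PMs _ _] := Mk_presentation Fp_free M_free.
have [sg sgK] := choice PMs.
pose f b' : M -> C^o := fun u => tw (sg u) b'.
have fE b'' b : f b'' (PM b) = tw b b'' by apply: twisted_PM; rewrite sgK.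
have flin b'' : linear (f b'').
  move=> k1 u u'; rewrite /f -twisted_linear_l; apply: twisted_PM.
  by rewrite PM_linear !sgK.
suff fR : restricted_dual MM (f b').
  by exists (into (restricted_dual MM) (f b')) => b; rewrite val_into.
move: b'; apply: fock_ind => [|l].
  have lf : linear (f : fock -> MM -> C^o).
    by move=> k1 u u'; apply/funext => w; rewrite /f twisted_linear.
  exact: (preim_is_subspace (restricted_dual MM) lf).
split=> //; exists [seq (SM + r%:R, EM + energy p%:R m%:~R (p%:R / 2) r (sumn l))
  | r : nat <- iota 0 N.+1] => s e u us.
apply: contraNeq => fu0; apply/mapP.
have [[r rN [sE eE]]|nr] := pselect (exists2 r : nat, (r < N.+1)%N &
    s = SM + r%:R /\ e = EM + energy p%:R m%:~R (p%:R / 2) r (sumn l)).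
  by exists r; [rewrite mem_iota|rewrite sE eE].
case/eqP: fu0; apply: (MM_deg_ind (P := fun u => f (ys l) u = 0) _ _ us) =>
  [|r w b hb sE eE].
  by apply: linear_eq_subspace => // k1 u1 u2; rewrite scaler0 addr0.
rewrite fE (twisted_hom _ _ _ hb (hom_ys R l)); case: ifP => // /andP[/eqP rN /eqP wl].
by case: nr; exists r; [nia|rewrite -wl].
Qed.

Definition to_RF (phi : dual) : RF :=
  subcls A B (PC (projT1 (cid (represents_exists phi)))).

Lemma to_RF_E phi b' : represents phi b' -> to_RF phi = subcls A B (PC b').
Proof.
move=> [rb' tb']; rewrite /to_RF; case: cid => b1 [rb1 tb1] /=.
apply/subcls_eq; [exact/part_residue|exact/part_residue|].
rewrite -linearB; apply/kernel_trunc; apply: (twisted_inj p_gt0 (expipi_neq0 (p%:R / 2))) => [|b].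
  by rewrite addrC -scaleN1r; apply: (subspaceP (residue R p N)).2.
rewrite (addrC b1) -scaleN1r twisted_linear.
by rewrite -tb1 -tb' scaleN1r addNr.
Qed.

Lemma to_RF_linear : linear to_RF.
Proof.
move=> k1 phi psi; have [b1 [rb1 tb1]] := represents_exists phi.
have [b2 [rb2 tb2]] := represents_exists psi.
rewrite (@to_RF_E (k1 *: phi + psi) (k1 *: b1 + b2)); last first.
  split; first exact: (subspaceP (residue R p N)).2.
  by move=> b; rewrite subspace_val_is_linear !fctE tb1 tb2 twisted_linear.
rewrite PC_linear subcls_linear; [|exact/part_residue|exact/part_residue].
by rewrite (@to_RF_E phi b1) // (@to_RF_E psi b2).
Qed.

Lemma dual_eq (phi psi : dual) :
  (forall b, subspace_val phi (PM b) = subspace_val psi (PM b)) -> phi = psi.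
Proof.
have [PMs _ _] := Mk_presentation Fp_free M_free.
by move=> e; apply/val_inj/funext => u; have [b <-] := PMs u; exact: e.
Qed.

Lemma to_RF_inj : injective to_RF.
Proof.
move=> phi psi; have [b1 r1] := represents_exists phi.
have [b2 r2] := represents_exists psi.
rewrite (to_RF_E r1) (to_RF_E r2); move: r1 r2 => [/part_residue A1 t1] [/part_residue A2 t2].
move=> /(subcls_eq _ A1 A2); rewrite -linearB => /kernel_trunc T; apply: dual_eq => b.
rewrite t1 t2 -[b1](subrK b2) -[b1 - b2]scale1r twisted_linear.
by rewrite (twisted_trunc_RF z p_gt0) // scaler0 add0r.
Qed.

Lemma to_RF_surj q : exists phi, to_RF phi = q.
Proof.
have [PCs _ _ _] := Mcirc_presentation F1p_free Mc_free.
have [b bE] := PCs (subspace_val (rep q)); have [phi phiE] := represented b.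
exists phi; rewrite -[RHS]subcls_rep -bE; apply: to_RF_E; split=> //.
by apply/part_residue; rewrite bE; exact: subspace_valP.
Qed.

(** The subspaces defining RF are stable under the modes of [a]: the charge is
    raised by [p], and [trunc_RF] is the radical of the form by [twisted_inj], so
    that its stability follows from [twisted_adjoint]. *)
Lemma to_RF_act n phi : to_RF (bg_act (b := bg_dual p MM) n phi) = bg_act (b := RF) n (to_RF phi).
Proof.
have [PMs PME _] := Mk_presentation Fp_free M_free.
have [PCs PCE PCi PCa] := Mcirc_presentation F1p_free Mc_free.
have [b1 r1] := represents_exists phi; rewrite (to_RF_E r1).
have [res1 t1] := r1.
pose T := act (p%:R)^-1 c' (ys (nseq p 0%N)) n%:~R.
have residueT b : residue R p N b -> residue R p N (T b).
  move=> /(_ (fun b => residue R p N (T b))); apply.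
    exact: (lin_preim (act_linear _ _ _ _) (subspaceP _)).
  move=> _ [l [[r rE] ->]].
  have := act_charge (p%:R)^-1 c' n%:~R (@charge_ys R (nseq p 0%N)) (@charge_ys R l).
  rewrite size_nseq -PoszD; apply: charge_ind => [|l' [ls]]; first exact: subspaceP.
  by move=> D _; apply; exists l'; split=> //; exists (r - 1); rewrite ls; lia.
have opT b : PC (T b) = gmod_act (a_elt x) n%:~R (PC b) by rewrite PCa.
have stableA w : A w -> A (gmod_act (a_elt x) n%:~R w).
  have [b <-] := PCs w; rewrite -opT => /part_residue /residueT rT; exact/part_residue.
have stableB w : A w -> B w -> B (gmod_act (a_elt x) n%:~R w).
  have [b <-] := PCs w; rewrite -opT => /part_residue rb /kernel_trunc tb; apply/kernel_trunc.
  apply: (twisted_inj p_gt0 (expipi_neq0 (p%:R / 2))) => [|b2]; first exact: residueT.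
  by rewrite (twisted_adjoint N p_gt0 (expipi_neq0 _)) twisted_trunc_RF // scaler0.
rewrite -[RHS]/(subop _ _) subop_cls //; [|exact: rep_linear_r (gmod_rep Mc) _ _|exact/part_residue].
rewrite -opT; apply: to_RF_E; split=> [|b]; first exact: residueT.
have [psi psiE] := represented (T b1).
pose f : MM -> C^o := fun u =>
  subspace_val phi (z *: gmod_act a (- n + p%:Z - 2)%:~R u).
have fE : f = subspace_val psi.
  apply/funext => u; have [b2 <-] := PMs u; rewrite psiE.
  rewrite (twisted_adjoint N p_gt0 (expipi_neq0 _)) -t1 PME /f.
  have := dual_linear phi z (gmod_act a (- n + p%:Z - 2)%:~R (PM b2)) 0.
  by rewrite (lin0 (dual_linear phi)) !addr0.
rewrite -[bg_act _ _]/(into (restricted_dual MM) f) fE val_into ?psiE //.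
exact: subspace_valP.
Qed.

Lemma dual_degP s e (phi : dual) : bg_deg (b := bg_dual p MM) s e phi <->
  forall r (w : int) b, hom r w b ->
    (SM + r%:R, EM + energy p%:R m%:~R (p%:R / 2) r w) <> (- s, e) ->
    subspace_val phi (PM b) = 0.
Proof.
have [PMs PME _] := Mk_presentation Fp_free M_free; split=> [H r w b hb|H s' e' u us ne].
  apply: H; exact: (Mk_deg_hom PM_linear (Psi_one _ _ _ _) PME).
apply: (MM_deg_ind (P := fun u => subspace_val phi u = 0) _ _ us) => [|r w b hb sE eE].
  apply: linear_eq_subspace; first exact: dual_linear.
  by move=> k1 u1 u2; rewrite scaler0 addr0.
by apply: (H r w b hb); rewrite -sE -eE.
Qed.

Lemma to_RF_0 : to_RF 0 = 0.
Proof. exact: lin0 to_RF_linear. Qed.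

(** If [phi] is homogeneous, then so is the representing vector, after projection to
    the charge and weight in duality. *)
Lemma to_RF_hom s e phi : bg_deg (b := bg_dual p MM) s e phi ->
  bg_deg (b := RF) s e (to_RF phi).
Proof.
have [PCs PCE PCi _] := Mcirc_presentation F1p_free Mc_free.
move=> /dual_degP phi0; have [b1 [rb1 tb1]] := represents_exists phi.
have phi_ys l : (SM + (size l)%:R,
    EM + energy p%:R m%:~R (p%:R / 2) (size l) (sumn l)) <> (- s, e) ->
    subspace_val phi (PM (ys l)) = 0 by apply: phi0; exact: hom_ys.
have phi_eq (f : fock -> C^o) : linear f ->
    (forall l, subspace_val phi (PM (ys l)) = f (ys l)) ->
    forall b, subspace_val phi (PM b) = f b.
  by move=> lf; apply: fock_eq => // k1 u u'; rewrite PM_linear dual_linear.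
have [[r [s0 [w [rs sE eE]]]]|none] := pselect (exists (r s0 : nat) (w : int),
  [/\ (p * r + s0)%N = N, SM + r%:R = - s &
      EM + energy p%:R m%:~R (p%:R / 2) r w = e]); last first.
  suff -> : phi = 0 by rewrite to_RF_0; exact: (proj1 (span_is_subspace _)).
  apply: dual_eq; rewrite -[subspace_val 0]/((0 : M -> C^o)).
  apply: phi_eq => [k1 u u'|l]; first by rewrite scaler0 addr0.
  have [lN|lN] := leqP (p * size l) N.
    apply: phi_ys => -[sE eE]; apply: none.
    by exists (size l), (N - p * size l)%N, (sumn l); split=> //; lia.
  rewrite tb1 twisted_ys; suff -> : cproj (partner p N (size l)) b1 = 0.
    by rewrite linear0 scaler0.
  have := @charge_cproj R (partner p N (size l)) b1; move: (cproj _ _).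
  apply: charge_ind => [|l']; last by rewrite /partner; lia.
  by split=> // k1 u u' -> ->; rewrite scaler0 addr0.
pose u := cproj s0 b1; pose b' := wproj w u.
have cu : charge s0 u by exact: charge_cproj.
have hb' : hom s0 w b'.
  rewrite /b'; move: u cu {b'}; apply: charge_ind => [|l [<-]].
    exact: (lin_preim (linearP (wproj w)) (hom_sub _ _ _)).
  exact: hom_wproj (hom_ys R l).
have uE l : size l = r -> (sumn l)%:Z = w -> pairing (ys l) u = pairing (ys l) b'.
  move=> lr lw; rewrite /b'; move: u cu {b' hb'}; apply: charge_ind => [|l' _].
    apply: linear_eq_subspace; first exact: linearP.
    by move=> k1 u u'; rewrite (linearP (wproj w)) linearP.
  rewrite (wproj_hom _ (hom_ys R l')); case: eqP => // /eqP ww.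
  rewrite linear0 (pairing_orth (hom_ys R l) (hom_ys R l')) //.
  by rewrite lw eq_sym.
have res' : residue R p N b'.
  move: b' hb' {uE}; apply: hom_ind => [|l ls _]; first exact: subspaceP.
  by move=> D _; apply; exists l; split=> //; exists r%:Z; lia.
have rep' : represents phi b'.
  split=> //; apply: phi_eq => [|l]; first exact: twisted_linear_l.
  rewrite (twisted_hom _ _ _ (hom_ys R l) hb').
  case: ifP => [/andP[/eqP ls /eqP lw]|ne].
    have lr : size l = r by apply/eqP; rewrite -(eqn_pmul2l p_gt0); lia.
    rewrite -(uE _ lr lw) tb1 twisted_ys; congr (_ *: pairing _ (cproj _ _)).
    by rewrite /partner; lia.
  apply: phi_ys => -[sE' eE']; move: ne.
  have [lr lw] : size l = r /\ (sumn l)%:Z = w.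
    by apply: bidegree_inj; rewrite ?sE ?sE' ?eE ?eE'.
  by rewrite lr lw rs !eqxx.
rewrite (to_RF_E rep'); have [sE' eE'] := dual_bidegree w rs.
have -> : s = SR + (p%:R)^-1 *+ s0 by apply: oppr_inj; rewrite -sE -sE'.
rewrite -eE eE'; apply: (RF_deg_hom PC_linear (Psi_one _ _ _ _) PCE PCi) => //.
by apply/residueP; exists r%:Z; lia.
Qed.

(** Conversely a homogeneous vector represents a homogeneous functional, and
    [to_RF] is injective. *)
Lemma to_RF_deg s e phi : bg_deg (b := bg_dual p MM) s e phi <->
  bg_deg (b := RF) s e (to_RF phi).
Proof.
have [PCs PCE PCi _] := Mcirc_presentation F1p_free Mc_free.
split; first exact: to_RF_hom.
suff H q : bg_deg (b := RF) s e q ->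
    exists psi, bg_deg (b := bg_dual p MM) s e psi /\ to_RF psi = q.
  by move=> /H [psi [dpsi /to_RF_inj <-]].
move=> qs; apply: (RF_deg_ind (Psi_one _ _ _ _) PCE
  (P := fun q => exists psi, bg_deg (b := bg_dual p MM) s e psi /\ to_RF psi = q) _ _ qs) =>
  [|r w b hb /part_residue rb wE].
  split; first by exists 0; split; [move=> s' e' u _ _|exact: to_RF_0].
  move=> k1 _ _ [psi1 [d1 <-]] [psi2 [d2 <-]]; exists (k1 *: psi1 + psi2).
  rewrite to_RF_linear; split=> // s' e' u us ne; rewrite -[val _]/(subspace_val _).
  by rewrite subspace_val_is_linear !fctE (d1 _ _ _ us ne) (d2 _ _ _ us ne) scaler0 addr0.
have [psi psiE] := represented b; exists psi; split; last by apply: to_RF_E.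
apply/dual_degP => r' w' b' hb' ne; rewrite psiE.
case: wE => [->|[sE eE]]; first exact: lin0 (twisted_linear _ _ _ _).
rewrite (twisted_hom _ _ _ hb' hb); case: ifP => // /andP[/eqP rr /eqP ww].
by case: ne; have [-> ->] := dual_bidegree w' rr; rewrite sE eE ww.
Qed.

Lemma dual_iso : bg_iso (bg_dual p MM) RF.
Proof.
exists to_RF; split.
- exact: to_RF_linear.
- have [inv invK] := choice to_RF_surj.
  by exists inv => // phi; apply: to_RF_inj.
- exact: to_RF_act.
- exact: to_RF_deg.
Qed.

End Duality.

Theorem corollary18 (R : realType) (p : nat) (p_gt0 : (0 < p)%N)
  (Fp : gva (p%:R : R[i])) (a : Fp) (Fp_free : is_free_gva a)
  (F1p : gva ((p%:R : R[i])^-1)) (x : F1p) (F1p_free : is_free_gva x)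
  (k m k' m' : int)
  (k'E : k' = k + p%:Z - 2) (m'E : m' = m - 2 * p%:Z + 1)
  (km : m <= k')
  (M : gmod Fp 0) (v : M) (M_free : is_Mk a k m v)
  (Mc : gmod F1p (- k')%:~R) (vc : Mc) (Mc_free : is_Mcirc x vc)
  (S E : R[i]) :
  bg_iso
    (bg_dual p (Mk_bg a v (S + m%:~R / p%:R) (E + m%:~R ^+ 2 / (2 * p%:R))))
    (RF_bg x (- m') vc (- S - k'%:~R / p%:R) (E + k'%:~R ^+ 2 / (2 * p%:R))).
Proof.
have [N NE] : exists N : nat, k' = m + N%:Z by exists `|k' - m|%N; lia.
have kE : k - 2 - m = N%:Z - p%:Z by lia.
have jE : - m' = 2 * p%:Z - m - 1 by lia.
clear k'E m'E; subst k'; exact: (dual_iso p_gt0 Fp_free F1p_free kE jE M_free Mc_free S E).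
Qed.
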